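(* Let $((A,\phi_0),(A^*,X_0))$ be a generalized Lie bialgebroid over $M$ and let $(\Lambda,E)$ be the induced Jacobi structure on $M$. Consider on the vector bundle $\tilde A=A\times\mathbb R\to M\times\mathbb R$ the Lie algebroid structure $([\,,\,]^{-\,\phi_0},\bar\rho^{\,\phi_0})$ and on $\tilde A^*=A^*\times\mathbb R\to M\times\mathbb R$ the Lie algebroid structure $([\,,\,]_*^{\wedge X_0},\hat\rho_*^{X_0})$ described in the context. Then: (i) The pair $(\tilde A,\tilde A^* )$ is a Lie bialgebroid over $M\times\mathbb R$. (ii) If $\tilde\Lambda$ is the induced Poisson structure on $M\times\mathbb R$, then $\tilde\Lambda$ is the Poissonization of the Jacobi structure $(\Lambda,E)$, i.e. $\tilde\Lambda=e^{-t}\big(\Lambda+\frac{\partial}{\partial t}\wedge E\big)$, $t$ being the coordinate on $\mathbb R$.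
   Context: Lie algebroid $(A,[\,,\,],\rho)$ over $M$: real vector bundle $A\to M$, Lie bracket on $\Gamma(A)$, anchor $\rho:A\to TM$ inducing a Lie algebra homomorphism $\Gamma(A)\to\mathfrak X(M)$, with $[X,fY]=f[X,Y]+\rho(X)(f)Y$. Its differential $d:\Gamma(\wedge^kA^* )\to\Gamma(\wedge^{k+1}A^* )$ is $(d\omega)(X_0,\dots,X_k)=\sum_i(-1)^i\rho(X_i)(\omega(\dots,\hat X_i,\dots))+\sum_{i<j}(-1)^{i+j}\omega([X_i,X_j],\dots,\hat X_i,\dots,\hat X_j,\dots)$. $\phi_0\in\Gamma(A^* )$ is a 1-cocycle if $d\phi_0=0$. Schouten bracket on $\Gamma(\wedge^*A)$: the $\mathbb R$-bilinear extension of the bracket with $[X,f]=\rho(X)(f)$, $[P,P']=(-1)^{kk'}[P',P]$, $[P,P'\wedge P'']=[P,P']\wedge P''+(-1)^{k'(k+1)}P'\wedge[P,P'']$ ($k,k'$ the degrees of $P,P'$); same convention for multivector fields. For a 1-cocycle $\phi_0$ of $A$: $d_{\phi_0}\omega=d\omega+\phi_0\wedge\omega$; on $\Gamma(\wedge^kA^* )$, $(\mathcal L_{\phi_0})_X=d_{\phi_0}\circ i_X+i_X\circ d_{\phi_0}$; $[P,P']_{\phi_0}=[P,P']+(-1)^{k+1}(k-1)P\wedge i_{\phi_0}P'-(k'-1)(i_{\phi_0}P)\wedge P'$ (contraction in the first slot); for $P\in\Gamma(\wedge^kA)$, $(\mathcal L_{\phi_0})_XP=[X,P]_{\phi_0}$.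 Generalized Lie bialgebroid: Lie algebroid structures $([\,,\,],\rho)$ on $A\to M$ and $([\,,\,]_*,\rho_* )$ on $A^*$, with 1-cocycles $\phi_0\in\Gamma(A^* )$ of $A$ and $X_0\in\Gamma(A)$ of $A^*$; with $d_*,d_{*X_0},\mathcal L_{*X_0}$ the differential, $X_0$-differential, $X_0$-Lie derivative of $A^*$ (acting on $\Gamma(\wedge^kA)$), one requires for all $X,Y\in\Gamma(A)$, $P\in\Gamma(\wedge^kA)$: $$d_{*X_0}[X,Y]=[X,d_{*X_0}Y]_{\phi_0}-[Y,d_{*X_0}X]_{\phi_0},\qquad(\mathcal L_{*X_0})_{\phi_0}P+(\mathcal L_{\phi_0})_{X_0}P=0.$$ A Lie bialgebroid $(A,A^* )$ is a pair of Lie algebroids in duality with $d_*[X,Y]=[X,d_*Y]-[Y,d_*X]$ for all $X,Y\in\Gamma(A)$ (the case $\phi_0=0$, $X_0=0$). Induced Jacobi structure: the Jacobi structure $(\Lambda,E)$ on $M$ (i.e. $[\Lambda,\Lambda]=2E\wedge\Lambda$, $[E,\Lambda]=0$) with $\Lambda(\delta f,\delta g)+fE(g)-gE(f)=-d_{\phi_0}f\cdot d_{*X_0}g$ for all functions $f,g$, where $\cdot$ is the pairing of $A^*$ and $A$ and $\delta$ the de Rham differential; explicitly $\Lambda(\delta f,\delta g)=-df\cdot d_*g$ and $E=\rho(X_0)=-\rho_*(\phi_0)$. For a Lie bialgebroid this is a Poisson structure ($E=0$), called the induced Poisson structure. Time-dependent structures: sections of $\tilde A=A\times\mathbb R\to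 M\times\mathbb R$ are identified with time-dependent sections of $A$. For $\tilde X,\tilde Y\in\Gamma(\tilde A)$ put $[\tilde X,\tilde Y](x,t)=[\tilde X_t,\tilde Y_t](x)$, where $\tilde X_t(y)=\tilde X(y,t)$; $\rho(\tilde X)$ is the corresponding time-dependent vector field on $M$, viewed in $\mathfrak X(M\times\mathbb R)$; $\phi_0(\tilde X)(x,t)=\phi_0(x)(\tilde X(x,t))$. Then $$[\tilde X,\tilde Y]^{-\,\phi_0}=[\tilde X,\tilde Y]+\phi_0(\tilde X)\tfrac{\partial\tilde Y}{\partial t}-\phi_0(\tilde Y)\tfrac{\partial\tilde X}{\partial t},\qquad\bar\rho^{\,\phi_0}(\tilde X)=\rho(\tilde X)+\phi_0(\tilde X)\tfrac{\partial}{\partial t},$$ and, for $\tilde\phi,\tilde\psi\in\Gamma(\tilde A^* )$, $$[\tilde\phi,\tilde\psi]_*^{\wedge X_0}=e^{-t}\Big([\tilde\phi,\tilde\psi]_*+\tilde\phi(X_0)\big(\tfrac{\partial\tilde\psi}{\partial t}-\tilde\psi\big)-\tilde\psi(X_0)\big(\tfrac{\partial\tilde\phi}{\partial t}-\tilde\phi\big)\Big),\qquad\hat\rho_*^{X_0}(\tilde\phi)=e^{-t}\Big(\rho_*(\tilde\phi)+\tilde\phi(X_0)\tfrac{\partial}{\partial t}\Big).$$ These are Lie algebroid structures over $M\times\mathbb R$. *)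

(* Defs.v *)
From HB Require Import structures.
From mathcomp Require Import all_boot all_order all_algebra.
From mathcomp Require Import all_classical all_reals all_analysis.

Set Implicit Arguments.
Unset Strict Implicit.
Unset Printing Implicit Defensive.

Import Order.TTheory GRing.Theory Num.Theory.
Import numFieldNormedType.Exports.

Local Open Scope classical_set_scope.
Local Open Scope ring_scope.

(** * Smooth maps between open subsets of normed spaces *)

Section smooth.
Context {R : realType}.

Fixpoint Ck_on (V W : normedModType R) (k : nat) (U : set V) (f : V -> W)
    {struct k} : Prop :=
  match k with
  | 0 => forall u, U u -> {for u, continuous f}
  | k'.+1 => (forall u, U u -> differentiable f u) /\
             (forall v, Ck_on k' U ('D_v f))
  end.

Definition smooth_on (V W : normedModType R) (U : set V) (f : V -> W) : Prop :=
  forall k, Ck_on k U f.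

Implicit Types V W : normedModType R.

Lemma Ck_onS V W k (U U' : set V) (f : V -> W) :
  U' `<=` U -> Ck_on k U f -> Ck_on k U' f.
Proof.
move=> UU; elim: k f => [|k IH] f /=; first by move=> h u /UU /h.
by case=> h1 h2; split=> [u /UU /h1 //|v]; apply: IH.
Qed.

Lemma near_eq_differentiable V W (f g : V -> W) (u : V) :
  (\near u, f u = g u) -> differentiable f u -> differentiable g u.
Proof.
move=> fg df.
have fgu : f u = g u := nbhs_singleton fg.
have dfc := diff_continuous df.
have := diff_locally df => /eqaddoP dfo.
have key : g \o shift u = cst (g u) + 'd f u +o_ 0 id.
  apply/eqaddoP => e e0; have fo := dfo e e0.
  have sfg : \forall h \near (0 : V), f (h + u) = g (h + u).
    by move: fg; rewrite (near_shift 0)/= subr0.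
  apply: filterS2 sfg fo => h /= fgh.
  by rewrite !fctE /= fgh fgu.
have dE := diff_unique dfc key.
by apply/diff_locallyP; rewrite dE.
Qed.

Lemma Ck_on_ext V W k (U : set V) (f g : V -> W) :
  open U -> (forall u, U u -> f u = g u) -> Ck_on k U f -> Ck_on k U g.
Proof.
move=> oU; elim: k f g => [|k IH] f g fg.
  move=> h u Uu; have hu : f z @[z --> u] --> f u := h u Uu.
  have nfg : \forall z \near u, f z = g z.
    by apply: filterS (open_nbhs_nbhs (conj oU Uu)).
  rewrite /prop_for /continuous_at -(fg u Uu).
  by apply: cvg_trans hu; apply: near_eq_cvg; apply: filterS nfg.
have nfg u : U u -> \forall z \near u, f z = g z.
  by move=> Uu; apply: filterS (open_nbhs_nbhs (conj oU Uu)).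
case=> h1 h2; split.
  by move=> u Uu; apply: near_eq_differentiable (nfg u Uu) (h1 u Uu).
move=> v; apply: IH (h2 v) => u Uu.
by apply: near_eq_derive; exact: nfg.
Qed.

Lemma Ck_onD V W k (U : set V) (f g : V -> W) : open U ->
  Ck_on k U f -> Ck_on k U g -> Ck_on k U (f + g).
Proof.
move=> oU; elim: k f g => [|k IH] f g /=.
  by move=> hf hg u Uu; apply: continuousD; [exact: hf|exact: hg].
move=> [hf1 hf2] [hg1 hg2]; split=> [u Uu|v].
  by apply: differentiableD; [exact: hf1|exact: hg1].
apply: (Ck_on_ext oU _ (IH _ _ (hf2 v) (hg2 v))) => u Uu.
by rewrite deriveD//; apply: diff_derivable; [exact: hf1|exact: hg1].
Qed.

Lemma Ck_on_cst V W k (U : set V) (w : W) : Ck_on k U (cst w).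
Proof.
elim: k w => [|k IH] w /=; first by move=> u _; exact: cst_continuous.
split=> [u _|v]; first exact: differentiable_cst.
suff -> : 'D_v (cst w) = cst 0 by exact: IH.
by apply/funext => u; rewrite derive_cst.
Qed.

Lemma Ck_on_linear V W k (U : set V) (l : {linear V -> W}) :
  continuous l -> Ck_on k U l.
Proof.
move=> lc; case: k => [|k]; first by move=> u _; exact: lc.
split=> [u _|v]; first exact: linear_differentiable.
suff -> : 'D_v l = cst (l v) by exact: Ck_on_cst.
apply/funext => u; rewrite deriveE; last exact: linear_differentiable.
by rewrite diff_lin.
Qed.

Lemma Ck_on_lpost V W W' k (U : set V) (f : V -> W) (l : {linear W -> W'}) :
  open U -> continuous l -> Ck_on k U f -> Ck_on k U (l \o f).
Proof.
move=> oU lc; elim: k f => [|k IH] f /=.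
  by move=> h u Uu; apply: continuous_comp; [exact: h|exact: lc].
case=> h1 h2; split=> [u Uu|v].
  by apply: differentiable_comp; [exact: h1|exact: linear_differentiable].
apply: (Ck_on_ext oU _ (IH _ (h2 v))) => u Uu.
have df := h1 u Uu; have dl := linear_differentiable (f u) lc.
rewrite [RHS]deriveE; last exact: differentiable_comp.
by rewrite diff_comp// diff_lin//= deriveE.
Qed.

Lemma Ck_on_lpre V W W' k (U : set V) (f : V -> W) (p : {linear W' -> V}) :
  continuous p -> Ck_on k U f -> Ck_on k (p @^-1` U) (f \o p).
Proof.
move=> pc; elim: k f => [|k IH] f /=.
  by move=> h u Uu; apply: continuous_comp; [exact: pc|exact: h].
case=> h1 h2; split=> [u Uu|v].
  by apply: differentiable_comp; [exact: linear_differentiable|exact: h1].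
suff -> : 'D_v (f \o p) = 'D_(p v) f \o p by exact: IH.
by apply/funext => u; rewrite /derive /=; under eq_fun do rewrite linearP.
Qed.

Lemma mx_continuous (T : topologicalType) m n (f : T -> 'M[R]_(m, n)) (x : T) :
  (forall i j, {for x, continuous (fun y => f y i j)}) -> {for x, continuous f}.
Proof.
move=> fc A [P fP PA].
have : \forall y \near x, forall i j, P i j (f y i j).
  by apply: filter_forall => i; apply: filter_forall => j; apply: fc; exact: fP.
by apply: filterS => y Py; apply: PA.
Qed.

Lemma mulmx_continuous m n p (A : 'M[R]_(m, n)) :
  continuous (mulmx A : 'M[R]_(n, p) -> 'M[R]_(m, p)).
Proof.
move=> u; apply: mx_continuous => i j.
rewrite (_ : (fun _ => _) = (fun v : 'M[R]_(n, p) => \sum_k A i k * v k j)).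
  apply: (cvg_big (op := +%R)) => [||k _];
    [exact: add_continuous|exact: nbhs_filter|].
  by apply: cvgMl_tmp; [exact: nbhs_filter|exact: coord_continuous].
by apply/funext => v; rewrite mxE.
Qed.

Lemma mulmxr_continuous m n p (B : 'M[R]_(n, p)) :
  continuous (mulmxr B : 'M[R]_(m, n) -> 'M[R]_(m, p)).
Proof.
move=> u; apply: mx_continuous => i j.
rewrite (_ : (fun _ => _) = (fun v : 'M[R]_(m, n) => \sum_k v i k * B k j)).
  apply: (cvg_big (op := +%R)) => [||k _];
    [exact: add_continuous|exact: nbhs_filter|].
  by apply: cvgMr_tmp; [exact: nbhs_filter|exact: coord_continuous].
by apply/funext => v; rewrite mxE.
Qed.

Lemma Ck_on_row_mx V m n k (U : set V) (f : V -> 'rV[R]_m) (g : V -> 'rV[R]_n) :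
  open U -> Ck_on k U f -> Ck_on k U g ->
  Ck_on k U (fun u => row_mx (f u) (g u)).
Proof.
move=> oU kf kg.
rewrite (_ : (fun _ => _) = (mulmxr (row_mx 1%:M 0) \o f) +
                            (mulmxr (row_mx 0 1%:M) \o g)).
  by apply: Ck_onD => //; apply: Ck_on_lpost => //; exact: mulmxr_continuous.
apply/funext => u; rewrite !fctE /= !mul_mx_row !mulmx1 !mulmx0.
by rewrite add_row_mx addr0 add0r.
Qed.

End smooth.

Lemma jacobian_deriveE (R : realType) m p (f : 'rV[R]_m -> 'rV[R]_p) u i j :
  differentiable f u -> jacobian f u i j = 'D_(delta_mx 0 i) f u 0 j.
Proof. by move=> df; rewrite [LHS]mxE deriveE. Qed.

Lemma near_eq_jacobian (R : realType) m p (f g : 'rV[R]_m -> 'rV[R]_p) u :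
  differentiable f u -> differentiable g u -> (\near u, f u = g u) ->
  jacobian f u = jacobian g u.
Proof.
move=> df dg fg.
apply/matrixP => i j.
apply: etrans (jacobian_deriveE i j df) _.
apply: etrans (esym (jacobian_deriveE i j dg)).
by congr (fun_of_matrix _ 0 j); exact: near_eq_derive.
Qed.

Lemma jacobian_comp (R : realType) m p q (f : 'rV[R]_m -> 'rV[R]_p)
    (g : 'rV[R]_p -> 'rV[R]_q) u :
  differentiable f u -> differentiable g (f u) ->
  jacobian (g \o f) u = jacobian f u *m jacobian g (f u).
Proof.
move=> df dg; have dgf := differentiable_comp df dg.
have E : 'd (g \o f) u = 'd g (f u) \o 'd f u :> (_ -> _) by exact: diff_comp.
apply/matrixP => i j.
apply: etrans (jacobian_deriveE i j dgf) _; rewrite (deriveE _ dgf) E /=.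
rewrite -(deriveE _ dg) (deriveEjacobian _ dg) [LHS]mxE [RHS]mxE; apply: eq_bigr => k _.
congr (_ * _); apply: etrans (esym (jacobian_deriveE i k df)).
by rewrite (deriveE _ df).
Qed.

Lemma jacobian_id (R : realType) m u : jacobian (id : 'rV[R]_m -> 'rV[R]_m) u = 1%:M.
Proof.
have did : differentiable (id : 'rV[R]_m -> 'rV[R]_m) u by [].
apply/matrixP => i j; apply: etrans (jacobian_deriveE i j did) _.
rewrite derive_id.
by rewrite !mxE eqxx /= eq_sym.
Qed.

Lemma jacobian_sumE (R : realType) m p (f : 'rV[R]_m -> 'rV[R]_p) u :
  differentiable f u ->
  jacobian f u = \sum_(i < m) (delta_mx i 0 : 'cV[R]_m) *m 'D_(delta_mx 0 i) f u.
Proof.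
move=> df; apply/matrixP => i j; apply: etrans (jacobian_deriveE i j df) _.
rewrite summxE.
rewrite (bigD1 i)//= big1 => [|k ki]; rewrite !mxE big_ord1 !mxE eqxx andbT.
  by rewrite mul1r addr0.
by rewrite eq_sym (negbTE ki) mul0r.
Qed.

Lemma Ck_on_jacobian (R : realType) m p k (U : set 'rV[R]_m) (f : 'rV[R]_m -> 'rV[R]_p) :
  open U -> Ck_on k.+1 U f -> Ck_on k U (jacobian f).
Proof.
move=> oU [df Df].
pose J u := \sum_(i < m) (delta_mx i 0 : 'cV[R]_m) *m 'D_(delta_mx 0 i) f u.
apply: (@Ck_on_ext _ _ _ _ _ J) => // [u Uu|].
  by rewrite (jacobian_sumE (df u Uu)).
rewrite (_ : J = \sum_(i < m) (mulmx (delta_mx i 0 : 'cV[R]_m) \o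
    ('D_(delta_mx 0 i) f : 'rV[R]_m -> 'rV[R]_p))).
  elim/big_ind : _ => [|g h kg kh|i _].
    exact: (Ck_on_cst k U (0 : 'M[R]_(m, p))).
    exact: Ck_onD.
  apply: Ck_on_lpost; [exact: oU|exact: (@mulmx_continuous R m 1 p)|exact: Df].
by apply/funext => u; rewrite fct_sumE.
Qed.

(** * Manifolds *)

(* The atlas is indexed by the points of the carrier: [mchart x] is a chart
   around x, with domain [mdom x] and inverse [mparam x].  Every smooth
   structure has such an atlas. *)
Record manifold (R : realType) (n : nat) := Manifold {
  mcarrier :> topologicalType;
  mdom : mcarrier -> set mcarrier;
  mchart : mcarrier -> mcarrier -> 'rV[R]_n;
  mparam : mcarrier -> 'rV[R]_n -> mcarrier;
  m_hausdorff : hausdorff_space mcarrier;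
  m_second_countable : @second_countable mcarrier;
  mdom_open : forall x, open (mdom x);
  mdom_mem : forall x, mdom x x;
  mimage_open : forall x, open (mchart x @` mdom x);
  mchartK : forall x y, mdom x y -> mparam x (mchart x y) = y;
  mchart_continuous : forall x y, mdom x y -> {for y, continuous (mchart x)};
  mparam_continuous : forall x y, mdom x y ->
    {for mchart x y, continuous (mparam x)};
  mtransition_smooth : forall x y,
    smooth_on (mchart x @` (mdom x `&` mdom y)) (mchart y \o mparam x) }.

Section manifold_theory.
Context {R : realType} {n : nat}.

(* Smooth at y in some, equivalently any, chart around y. *)
Definition smooth_at (M : manifold R n) (W : normedModType R) (f : M -> W)
    (y : M) : Prop :=
  exists x U, [/\ mdom x y, open U, U (mchart x y) & smooth_on U (f \o mparam x)].

Definition smooth_fun (M : manifold R n) (f : M -> R) : Prop :=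
  forall x, smooth_at f x.

Lemma mdomI_image_open (M : manifold R n) (x : M) (D : set M) :
  open D -> open (mchart x @` (mdom x `&` D)).
Proof.
move=> oD.
rewrite (_ : _ @` _ = mchart x @` mdom x `&` mparam x @^-1` D).
  rewrite openE => _ [[y xy <-] Dy]; rewrite /= mchartK// in Dy.
  apply: filterI.
    by apply: open_nbhs_nbhs; split; [exact: mimage_open|exists y].
  apply: mparam_continuous => //; rewrite mchartK//.
  exact: open_nbhs_nbhs.
apply/seteqP; split.
  by move=> _ [y [xy Dy] <-]; split; [exists y|rewrite /= mchartK].
by move=> _ [[y xy <-]] /=; rewrite mchartK// => Dy; exists y.
Qed.

End manifold_theory.

Section prod_topology.

Lemma realType_second_countable (R : realType) : @second_countable R.
Proof.
exists (range (fun ab : rat * rat => `](ratr ab.1 : R), ratr ab.2[%classic)).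
  exact: sub_countable (card_image_le _ _) (countableP _).
split; first by move=> _ [ab _ <-]; exact: interval_open.
move=> x A /nbhs_ballP[e /= e0 xeA].
have /rat_in_itvoo[a] : x - e < x by rewrite ltrBlDr ltrDl.
rewrite in_itv/= => /andP[ea ax].
have /rat_in_itvoo[b] : x < x + e by rewrite ltrDl.
rewrite in_itv/= => /andP[xb be].
exists `](ratr a : R), ratr b[%classic.
  by split; [exists (a, b)|rewrite /= in_itv/= ax xb].
move=> y /=; rewrite in_itv/= => /andP[ay yb]; apply: xeA.
rewrite -ball_normE /= distrC ltr_distl.
by rewrite (lt_trans ea ay) (lt_trans yb be).
Qed.

Lemma open_setX (S T : topologicalType) (A : set S) (B : set T) :
  open A -> open B -> open (A `*` B).
Proof.
rewrite !openE => oA oB [x y] [/= Ax By].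
by exists (A, B) => //=; split; [exact: oA|exact: oB].
Qed.

Lemma prod_second_countable (S T : topologicalType) :
  @second_countable S -> @second_countable T -> @second_countable (S * T)%type.
Proof.
move=> [B cB [oB bB]] [C cC [oC bC]].
exists ((fun UV : set S * set T => UV.1 `*` UV.2) @` (B `*` C)).
  by apply: sub_countable (card_image_le _ _) _; exact: countableX.
split.
  by move=> _ [[U V] [/= BU CV] <-]; apply: open_setX; [exact: oB|exact: oC].
move=> [x y] A [[A1 A2] [/= xA1 yA2] A12].
have [U [BU Ux] UA] := bB x A1 xA1.
have [V [CV Vy] VA] := bC y A2 yA2.
exists (U `*` V); first by split; [exists (U, V)|split].
by move=> z [/= Uz Vz]; apply: A12; split; [exact: UA|exact: VA].
Qed.

Lemma prod_hausdorff (S T : topologicalType) :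
  hausdorff_space S -> hausdorff_space T -> hausdorff_space (S * T)%type.
Proof.
move=> hS hT [x1 x2] [y1 y2] xy; congr (_, _).
  apply: hS => A B Ax By.
  have [|//|[z1 z2] [/= [+ _] [+ _]]] := xy (A `*` setT) (B `*` setT).
  - by exists (A, setT) => //; split => //; exact: filterT.
  - by exists (B, setT) => //; split => //; exact: filterT.
  by exists z1.
apply: hT => A B Ax By.
have [|//|[z1 z2] [/= [_ +] [_ +]]] := xy (setT `*` A) (setT `*` B).
- by exists (setT, A) => //; split => //; exact: filterT.
- by exists (setT, B) => //; split => //; exact: filterT.
by exists z2.
Qed.

End prod_topology.

Section time_manifold.
Context {R : realType} {n : nat} (M : manifold R n).

Let MR : topologicalType := (M * R)%type.

Definition time_dom (p : MR) : set MR := [set q | mdom p.1 q.1].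
Definition time_chart (p q : MR) : 'rV[R]_(n + 1) :=
  row_mx (mchart p.1 q.1) (q.2)%:M.
Definition time_param (p : MR) (u : 'rV[R]_(n + 1)) : MR :=
  (mparam p.1 (lsubmx u), rsubmx u 0 0).

Lemma rV1_scalar (v : 'rV[R]_1) : (v 0 0)%:M = v.
Proof. by apply/rowP => i; rewrite ord1 mxE eqxx mulr1n. Qed.

Lemma time_imageE (p : MR) (D : set M) :
  time_chart p @` [set q | D q.1] = lsubmx @^-1` (mchart p.1 @` D).
Proof.
apply/seteqP; split.
  by move=> _ [q Dq <-]; exists q.1 => //; rewrite row_mxKl.
move=> u [x Dx xu]; exists (x, rsubmx u 0 0) => //.
by rewrite /time_chart /= xu rV1_scalar hsubmxK.
Qed.

Lemma lsubmx_cts : continuous (lsubmx : 'rV[R]_(n + 1) -> 'rV[R]_n).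
Proof. exact: continuous_lsubmx. Qed.

Fact time_hausdorff : hausdorff_space MR.
Proof. exact: (prod_hausdorff (@m_hausdorff _ _ M) (@Rhausdorff R)). Qed.

Fact time_second_countable : @second_countable MR.
Proof.
exact: (prod_second_countable (@m_second_countable _ _ M)
  (@realType_second_countable R)).
Qed.

Fact time_dom_open p : open (time_dom p).
Proof.
rewrite (_ : time_dom p = mdom p.1 `*` setT).
  by apply: open_setX; [exact: mdom_open|exact: openT].
by apply/seteqP; split => [q|q []]//.
Qed.

Fact time_dom_mem p : time_dom p p.
Proof. exact: mdom_mem. Qed.

Fact time_image_open p : open (time_chart p @` time_dom p).
Proof.
rewrite time_imageE; apply: open_comp; first by move=> u _; exact: lsubmx_cts.
exact: mimage_open.
Qed.

Fact time_chartK p q : time_dom p q -> time_param p (time_chart p q) = q.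
Proof.
case: q => x t /= xp; rewrite /time_param /time_chart row_mxKl row_mxKr /=.
by rewrite mchartK// mxE eqxx.
Qed.

Fact time_chart_continuous p q :
  time_dom p q -> {for q, continuous (time_chart p)}.
Proof.
move=> pq; apply: mx_continuous => i j; rewrite ord1.
case: (split_ordP j) => k ->.
  rewrite (_ : (fun _ => _) = (fun v : 'rV_n => v 0 k) \o (mchart p.1 \o fst)).
    apply: continuous_comp; last exact: coord_continuous.
    apply: continuous_comp; first exact: cvg_fst.
    exact: mchart_continuous.
  by apply/funext => y; rewrite /time_chart row_mxEl.
rewrite (_ : (fun _ => _) = snd); first exact: cvg_snd.
by apply/funext => y; rewrite /time_chart row_mxEr ord1 mxE eqxx.
Qed.

Fact time_param_continuous p q :
  time_dom p q -> {for time_chart p q, continuous (time_param p)}.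
Proof.
move=> pq.
have c1 : {for time_chart p q, continuous (mparam p.1 \o
    (lsubmx : 'rV[R]_(n + 1) -> 'rV[R]_n))}.
  apply: continuous_comp; first exact: lsubmx_cts.
  by rewrite /time_chart row_mxKl; exact: mparam_continuous.
have c2 : {for time_chart p q, continuous ((fun v : 'rV[R]_1 => v 0 0) \o
    (rsubmx : 'rV[R]_(n + 1) -> 'rV[R]_1))}.
  by apply: continuous_comp; [exact: continuous_rsubmx|exact: coord_continuous].
exact: (cvg_pair c1 c2).
Qed.

Fact time_transition_smooth p q :
  smooth_on (time_chart p @` (time_dom p `&` time_dom q))
    (time_chart q \o time_param p).
Proof.
move=> k.
have -> : time_dom p `&` time_dom q = [set r | (mdom p.1 `&` mdom q.1) r.1].
  by [].
rewrite time_imageE.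
have oU : open (lsubmx @^-1` (mchart p.1 @` (mdom p.1 `&` mdom q.1)) :
    set 'rV[R]_(n + 1)).
  apply: open_comp; first by move=> u _; exact: lsubmx_cts.
  apply: mdomI_image_open; exact: mdom_open.
rewrite (_ : _ \o _ = fun u : 'rV[R]_(n + 1) =>
    row_mx ((mchart q.1 \o mparam p.1) (lsubmx u)) (rsubmx u)).
  apply: Ck_on_row_mx => //.
    by apply: Ck_on_lpre; [exact: lsubmx_cts|exact: mtransition_smooth].
  by apply: Ck_on_linear; exact: continuous_rsubmx.
by apply/funext => u; rewrite /time_chart /= rV1_scalar.
Qed.

Definition time_manifold : manifold R (n + 1) :=
  Manifold time_hausdorff time_second_countable time_dom_open time_dom_mem
    time_image_open time_chartK time_chart_continuous time_param_continuous
    time_transition_smooth.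

End time_manifold.

(** * Vector bundles *)

(* A rank r vector bundle, presented by choosing a basis of each fibre: every
   fibre is then 'rV_r, with no regularity in the base point, and the smooth
   structure is carried by local trivializations.  [vtriv x y] is the matrix
   (acting on row vectors) of the trivialization indexed by x, on the fibre
   over y, for y in the neighbourhood [vdom x] of x. *)
Record vbundle (R : realType) (n : nat) (M : manifold R n) (r : nat) := VBundle {
  vdom : M -> set M;
  vtriv : M -> M -> 'M[R]_r;
  vdom_open : forall x, open (vdom x);
  vdom_mem : forall x, vdom x x;
  vtriv_unit : forall x y, vdom x y -> vtriv x y \in unitmx;
  vtransition_smooth : forall x x' y, vdom x y -> vdom x' y ->
    smooth_at (fun z => invmx (vtriv x z) *m vtriv x' z) y }.

Definition smooth_section (R : realType) (n : nat) (M : manifold R n) (r : nat)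
    (B : vbundle M r) (X : M -> 'rV[R]_r) : Prop :=
  forall x y, vdom B x y -> smooth_at (fun z => X z *m vtriv B x z) y.

Section dual_bundle.
Context {R : realType} {n : nat} {M : manifold R n} {r : nat} (B : vbundle M r).

Definition dual_triv (x y : M) : 'M[R]_r := (invmx (vtriv B x y))^T.

Fact dual_triv_unit x y : vdom B x y -> dual_triv x y \in unitmx.
Proof. by move=> xy; rewrite unitmx_tr unitmx_inv vtriv_unit. Qed.

Fact dual_transition_smooth x x' y : vdom B x y -> vdom B x' y ->
  smooth_at (fun z => invmx (dual_triv x z) *m dual_triv x' z) y.
Proof.
move=> xy x'y; have [z [U [zy oU Uy sU]]] := vtransition_smooth x'y xy.
exists z, U; split => // k.
rewrite (_ : _ \o _ = trmx \o ((fun z => invmx (vtriv B x' z) *m vtriv B x z)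
  \o mparam z)).
  apply: Ck_on_lpost => // u; apply: mx_continuous => i j.
  rewrite (_ : (fun _ => _) = (fun v : 'M[R]_r => v j i)).
    exact: coord_continuous.
  by apply/funext => v; rewrite mxE.
by apply/funext => u; rewrite /= trmx_mul /dual_triv -trmx_inv invmxK.
Qed.

(* The fibres of the dual are identified with 'rV_r through the dual bases, so
   the pairing is the dot product and the dual of the dual has the same fibres
   and sections as the original bundle. *)
Definition dual_bundle : vbundle M r :=
  VBundle (vdom_open B) (vdom_mem B) dual_triv_unit dual_transition_smooth.

End dual_bundle.

Section time_bundle.
Context {R : realType} {n : nat} {M : manifold R n} {r : nat} (B : vbundle M r).

Let MR := time_manifold M.
Definition time_vdom (p : MR) : set MR := [set q | vdom B p.1 q.1].
Definition time_vtriv (p q : MR) : 'M[R]_r := vtriv B p.1 q.1.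

Fact time_vdom_open p : open (time_vdom p).
Proof.
rewrite (_ : time_vdom p = vdom B p.1 `*` setT).
  by apply: open_setX; [exact: vdom_open|exact: openT].
by apply/seteqP; split => [q|q []]//.
Qed.

Fact time_vdom_mem p : time_vdom p p.
Proof. exact: vdom_mem. Qed.

Fact time_vtriv_unit p q : time_vdom p q -> time_vtriv p q \in unitmx.
Proof. exact: vtriv_unit. Qed.

Lemma smooth_at_fst (W : normedModType R) (f : M -> W) (p : MR) :
  smooth_at f p.1 -> @smooth_at _ _ MR _ (fun q : MR => f q.1) p.
Proof.
move=> [z [U [zy oU Uy sU]]]; exists ((z, 0) : MR), (lsubmx @^-1` U).
split => //.
- by apply: open_comp => // u _; exact: lsubmx_cts.
- by rewrite /= /time_chart row_mxKl.
- by move=> k; exact: (Ck_on_lpre (@lsubmx_cts R n) (sU k)).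
Qed.

Fact time_vtransition_smooth p p' q : time_vdom p q -> time_vdom p' q ->
  smooth_at (fun z => invmx (time_vtriv p z) *m time_vtriv p' z) q.
Proof.
move=> pq p'q.
exact: (@smooth_at_fst _ (fun z => invmx (vtriv B p.1 z) *m vtriv B p'.1 z) q
  (vtransition_smooth pq p'q)).
Qed.

Definition time_bundle : vbundle MR r :=
  VBundle time_vdom_open time_vdom_mem time_vtriv_unit time_vtransition_smooth.

End time_bundle.

Section tangent_bundle.
Context {R : realType} {n : nat} (M : manifold R n).

Definition tangent_triv (x y : M) : 'M[R]_n :=
  jacobian (mchart x \o mparam y) (mchart y y).

Lemma transition_differentiable (x y z : M) : mdom x z -> mdom y z ->
  differentiable (mchart y \o mparam x) (mchart x z).
Proof.
move=> xz yz; have [h _] := mtransition_smooth x y 1.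
by apply: h; exists z.
Qed.

Lemma jacobian_chain (x y z w : M) : mdom x w -> mdom y w -> mdom z w ->
  jacobian (mchart y \o mparam x) (mchart x w) *m
  jacobian (mchart z \o mparam y) (mchart y w) =
  jacobian (mchart z \o mparam x) (mchart x w).
Proof.
move=> xw yw zw.
have d1 := transition_differentiable xw yw.
have E : (mchart y \o mparam x) (mchart x w) = mchart y w by rewrite /= mchartK.
have d2 : differentiable (mchart z \o mparam y)
    ((mchart y \o mparam x) (mchart x w)).
  by rewrite E; exact: transition_differentiable.
rewrite -E -(jacobian_comp d1 d2); apply: near_eq_jacobian.
- exact: differentiable_comp.
- exact: transition_differentiable.
have : open_nbhs (mchart x w) (mchart x @` (mdom x `&` mdom y)).
  split; last by exists w.
  by apply: mdomI_image_open; exact: mdom_open.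
move=> /open_nbhs_nbhs; apply: filterS => _ [v [xv yv] <-] /=.
by rewrite mchartK// mchartK.
Qed.

Lemma jacobian_chartK (x y : M) : mdom x y ->
  jacobian (mchart x \o mparam x) (mchart x y) = 1%:M.
Proof.
move=> xy; rewrite -(jacobian_id (mchart x y)); apply: near_eq_jacobian.
- exact: transition_differentiable.
- by [].
have : open_nbhs (mchart x y) (mchart x @` mdom x).
  by split; [exact: mimage_open|exists y].
move=> /open_nbhs_nbhs; apply: filterS => _ [v xv <-] /=.
by rewrite mchartK.
Qed.

Lemma jacobianV (x y : M) : mdom x y ->
  jacobian (mchart y \o mparam x) (mchart x y) *m tangent_triv x y = 1%:M.
Proof.
move=> xy; rewrite /tangent_triv jacobian_chain ?jacobian_chartK//.
exact: mdom_mem.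
Qed.

Fact tangent_triv_unit x y : mdom x y -> tangent_triv x y \in unitmx.
Proof. by move=> /jacobianV /mulmx1_unit[]. Qed.

Fact tangent_transition_smooth x x' y : mdom x y -> mdom x' y ->
  smooth_at (fun z => invmx (tangent_triv x z) *m tangent_triv x' z) y.
Proof.
move=> xy x'y; exists x, (mchart x @` (mdom x `&` mdom x')).
have oU : open (mchart x @` (mdom x `&` mdom x')).
  by apply: mdomI_image_open; exact: mdom_open.
split => //; first by exists y.
move=> k; apply: (Ck_on_ext oU _ (Ck_on_jacobian oU (mtransition_smooth x x' k.+1))).
move=> _ [v [xv x'v] <-] /=; rewrite mchartK//.
have vv : mdom v v by exact: mdom_mem.
have E : tangent_triv x v *m jacobian (mchart x' \o mparam x) (mchart x v) =
    tangent_triv x' v by exact: jacobian_chain.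
apply: esym; apply: etrans (congr1 (mulmx _) (esym E)) _.
by apply: mulKmx; exact: tangent_triv_unit.
Qed.

(* The tangent space at y is 'rV_n via the chart [mchart y]. *)
Definition tangent_bundle : vbundle M n :=
  VBundle (@mdom_open _ _ M) (@mdom_mem _ _ M) tangent_triv_unit
    tangent_transition_smooth.

End tangent_bundle.

(** * Forms and multisections *)

Section forms.
Context {R : realType} {n : nat} {M : manifold R n} {r : nat}.

(* A section of the k-th exterior power of the dual of a bundle B is encoded as
   an alternating C^oo(M)-multilinear map on k smooth sections of B.  The degree
   is the length of the list of arguments, and a k-form vanishes on lists of
   any other length, so that operations on forms need no degree index. *)
Definition altform := seq (M -> 'rV[R]_r) -> M -> R.

Definition smooth_sections (B : vbundle M r) (Xs : seq (M -> 'rV[R]_r)) : Prop :=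
  forall i, (i < size Xs)%N -> smooth_section B (nth 0 Xs i).

Record is_form (B : vbundle M r) (k : nat) (w : altform) : Prop := IsForm {
  form_degree : forall Xs, size Xs != k -> w Xs = 0;
  form_smooth : forall Xs, smooth_sections B Xs -> smooth_fun (w Xs);
  form_linear : forall Xs Ys X Y (f : M -> R),
    (size Xs + size Ys).+1 = k ->
    smooth_sections B Xs -> smooth_sections B Ys ->
    smooth_section B X -> smooth_section B Y -> smooth_fun f ->
    w (Xs ++ (fun x => f x *: X x + Y x) :: Ys) =
      (fun x => f x * w (Xs ++ X :: Ys) x + w (Xs ++ Y :: Ys) x);
  form_alternating : forall Xs Ys Zs X,
    smooth_sections B Xs -> smooth_sections B Ys -> smooth_sections B Zs ->
    smooth_section B X -> w (Xs ++ X :: Ys ++ X :: Zs) = 0 }.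

Definition eq_form (B : vbundle M r) (w w' : altform) : Prop :=
  forall Xs, smooth_sections B Xs -> w Xs = w' Xs.

Definition dotp {m : nat} (u v : 'rV[R]_m) : R := (u *m v^T) 0 0.

Definition form0 (f : M -> R) : altform :=
  fun Xs => if Xs is [::] then f else 0.

(* With dual bases in dual fibres, this turns a section of the dual of B into a
   1-form on sections of B, and a section of B into a 1-form on sections of the
   dual of B. *)
Definition form1 (a : M -> 'rV[R]_r) : altform :=
  fun Xs => if Xs is [:: X] then fun x => dotp (a x) (X x) else 0.

Definition contr (X : M -> 'rV[R]_r) (w : altform) : altform :=
  fun Xs => w (X :: Xs).

(* [m] selects the arguments of the left factor of a wedge product; this counts
   the inversions of the corresponding shuffle. *)
Definition shuffle_inv (m : seq bool) : nat :=
  \sum_(j < size m | nth false m j) count negb (take j m).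

Definition wedge (a b : altform) : altform := fun Xs x =>
  \sum_(m : (size Xs).-tuple bool)
    (-1) ^+ shuffle_inv m * (a (mask m Xs) x * b (mask (map negb m) Xs) x).

End forms.
Arguments altform {R n} M r.

Definition multisection (R : realType) (n : nat) (M : manifold R n) (r : nat)
    (A : vbundle M r) (k : nat) (P : altform M r) : Prop :=
  is_form (dual_bundle A) k P.

Definition eq_multisection (R : realType) (n : nat) (M : manifold R n) (r : nat)
    (A : vbundle M r) (P Q : altform M r) : Prop :=
  eq_form (dual_bundle A) P Q.

(** * Lie algebroids *)

(* The derivative of f along the vector field X. *)
Definition vderiv (R : realType) (n : nat) (M : manifold R n)
    (X : M -> 'rV[R]_n) (f : M -> R) (x : M) : R :=
  'D_(X x) (f \o mparam x) (mchart x x).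

(* The j-th coordinate of [X, Y] at x is X(Y(c_j)) - Y(X(c_j)), where c_j is the
   j-th coordinate function of the chart at x. *)
Definition vf_bracket (R : realType) (n : nat) (M : manifold R n)
    (X Y : M -> 'rV[R]_n) (x : M) : 'rV[R]_n :=
  \row_j (vderiv X (vderiv Y (fun y => mchart x y 0 j)) x -
          vderiv Y (vderiv X (fun y => mchart x y 0 j)) x).

Record algebroid (R : realType) (n : nat) (M : manifold R n) (r : nat) :=
  Algebroid {
    bracket : (M -> 'rV[R]_r) -> (M -> 'rV[R]_r) -> (M -> 'rV[R]_r);
    anchor : M -> 'rV[R]_r -> 'rV[R]_n }.

Section lie_algebroid.
Context {R : realType} {n : nat} {M : manifold R n} {r : nat}.
Implicit Types (A : vbundle M r) (L : algebroid M r) (X Y Z : M -> 'rV[R]_r).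

Definition sanchor L X : M -> 'rV[R]_n := fun x => anchor L x (X x).

Record is_lie_algebroid A L : Prop := IsLieAlgebroid {
  la_closed : forall X Y, smooth_section A X -> smooth_section A Y ->
    smooth_section A (bracket L X Y);
  la_linear : forall (c : R) X Y Z, smooth_section A X -> smooth_section A Y ->
    smooth_section A Z ->
    bracket L (c *: X + Y) Z = c *: bracket L X Z + bracket L Y Z;
  la_antisym : forall X Y, smooth_section A X -> smooth_section A Y ->
    bracket L X Y = - bracket L Y X;
  la_jacobi : forall X Y Z, smooth_section A X -> smooth_section A Y ->
    smooth_section A Z ->
    bracket L X (bracket L Y Z) + bracket L Y (bracket L Z X) +
    bracket L Z (bracket L X Y) = 0;
  la_anchor_linear : forall x, linear (anchor L x);
  la_anchor_smooth : forall X, smooth_section A X ->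
    smooth_section (tangent_bundle M) (sanchor L X);
  la_anchor_bracket : forall X Y, smooth_section A X -> smooth_section A Y ->
    sanchor L (bracket L X Y) = vf_bracket (sanchor L X) (sanchor L Y);
  la_leibniz : forall X Y (f : M -> R), smooth_section A X ->
    smooth_section A Y -> smooth_fun f ->
    bracket L X (fun x => f x *: Y x) =
      (fun x => f x *: bracket L X Y x + vderiv (sanchor L X) f x *: Y x) }.

(** ** Differential, and Lie derivatives twisted by a 1-cocycle *)

Definition rem_at (T : Type) (i : nat) (s : seq T) : seq T :=
  take i s ++ drop i.+1 s.

Definition dform L (w : altform M r) : altform M r := fun Xs x =>
  \sum_(i < size Xs)
    (-1) ^+ i * vderiv (sanchor L (nth 0 Xs i)) (w (rem_at i Xs)) x +
  \sum_(j < size Xs) \sum_(i < j)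
    (-1) ^+ (i + j) *
      w (bracket L (nth 0 Xs i) (nth 0 Xs j) :: rem_at i (rem_at j Xs)) x.

Definition is_cocycle A L (phi : M -> 'rV[R]_r) : Prop :=
  smooth_section (dual_bundle A) phi /\ eq_form A (dform L (form1 phi)) 0.

Definition dphi L (phi : M -> 'rV[R]_r) (w : altform M r) : altform M r :=
  dform L w + wedge (form1 phi) w.

Definition lie_phi L (phi X : M -> 'rV[R]_r) (w : altform M r) : altform M r :=
  dphi L phi (contr X w) + contr X (dphi L phi w).

(* [dform L (form0 f)] as a section of the dual bundle, in dual bases. *)
Definition dfun L (f : M -> R) : M -> 'rV[R]_r := fun x =>
  \row_i vderiv (fun y => anchor L y (delta_mx 0 i)) f x.

(** ** Schouten bracket *)

(* [S k k'] is the bracket of multisections of degrees k and k'.  These rules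
   determine it on multisections; it has degree -1, so that the bracket of two
   functions is 0. *)
Record is_schouten A L
    (S : nat -> nat -> altform M r -> altform M r -> altform M r) : Prop :=
  IsSchouten {
  sch_closed : forall k k' P P', multisection A k P -> multisection A k' P' ->
    multisection A (k + k').-1 (S k k' P P');
  sch_ext : forall k k' P P' Q Q',
    multisection A k P -> multisection A k Q ->
    multisection A k' P' -> multisection A k' Q' ->
    eq_multisection A P Q -> eq_multisection A P' Q' ->
    eq_multisection A (S k k' P P') (S k k' Q Q');
  sch_linear : forall k k' (c : R) P Q P',
    multisection A k P -> multisection A k Q -> multisection A k' P' ->
    eq_multisection A (S k k' (c *: P + Q) P') (c *: S k k' P P' + S k k' Q P');
  sch_fun_fun : forall f g, smooth_fun f -> smooth_fun g ->
    eq_multisection A (S 0%N 0%N (form0 f) (form0 g)) 0;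
  sch_sec_fun : forall X f, smooth_section A X -> smooth_fun f ->
    eq_multisection A (S 1%N 0%N (form1 X) (form0 f))
      (form0 (vderiv (sanchor L X) f));
  sch_sec_sec : forall X Y, smooth_section A X -> smooth_section A Y ->
    eq_multisection A (S 1%N 1%N (form1 X) (form1 Y)) (form1 (bracket L X Y));
  sch_sym : forall k k' P P', multisection A k P -> multisection A k' P' ->
    eq_multisection A (S k k' P P') ((-1) ^+ (k * k') *: S k' k P' P);
  sch_wedge : forall k k' k'' P P' P'',
    multisection A k P -> multisection A k' P' -> multisection A k'' P'' ->
    eq_multisection A (S k (k' + k'')%N P (wedge P' P''))
      (wedge (S k k' P P') P'' +
       (-1) ^+ (k' * (k + 1)) *: wedge P' (S k k'' P P'')) }.

Definition schouten_phi
    (S : nat -> nat -> altform M r -> altform M r -> altform M r)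
    (phi : M -> 'rV[R]_r) (k k' : nat) (P P' : altform M r) : altform M r :=
  S k k' P P' + ((-1) ^+ k.+1 * (k%:R - 1)) *: wedge P (contr phi P')
  - (k'%:R - 1) *: wedge (contr phi P) P'.

(** ** Bialgebroids *)

Record is_lie_bialgebroid A (L Ls : algebroid M r) : Prop := IsLieBialgebroid {
  lb_algebroid : is_lie_algebroid A L;
  lb_dual : is_lie_algebroid (dual_bundle A) Ls;
  lb_compat : forall S, is_schouten A L S ->
    forall X Y, smooth_section A X -> smooth_section A Y ->
    eq_multisection A (dform Ls (form1 (bracket L X Y)))
      (S 1%N 2%N (form1 X) (dform Ls (form1 Y)) -
       S 1%N 2%N (form1 Y) (dform Ls (form1 X))) }.

Record is_generalized_lie_bialgebroid A (L Ls : algebroid M r)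
    (phi0 X0 : M -> 'rV[R]_r) : Prop := IsGeneralizedLieBialgebroid {
  glb_algebroid : is_lie_algebroid A L;
  glb_dual : is_lie_algebroid (dual_bundle A) Ls;
  glb_phi0 : is_cocycle A L phi0;
  glb_X0_smooth : smooth_section A X0;
  glb_X0 : eq_multisection A (dform Ls (form1 X0)) 0;
  glb_compat : forall S, is_schouten A L S ->
    forall X Y, smooth_section A X -> smooth_section A Y ->
    eq_multisection A (dphi Ls X0 (form1 (bracket L X Y)))
      (schouten_phi S phi0 1 2 (form1 X) (dphi Ls X0 (form1 Y)) -
       schouten_phi S phi0 1 2 (form1 Y) (dphi Ls X0 (form1 X)));
  glb_lie : forall S, is_schouten A L S ->
    forall k P, multisection A k P ->
    eq_multisection A
      (lie_phi Ls X0 phi0 P + schouten_phi S phi0 1 k (form1 X0) P) 0 }.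

End lie_algebroid.

(** * Jacobi and Poisson structures *)

Section jacobi.
Context {R : realType} {n : nat} (M : manifold R n).

Definition tangent_algebroid : algebroid M n :=
  Algebroid (@vf_bracket R n M) (fun _ v => v).

Definition is_jacobi (Lam : altform M n) (E : M -> 'rV[R]_n) : Prop :=
  [/\ multisection (tangent_bundle M) 2 Lam,
      smooth_section (tangent_bundle M) E &
      forall S, is_schouten (tangent_bundle M) tangent_algebroid S ->
        eq_multisection (tangent_bundle M) (S 2%N 2%N Lam Lam)
          (2%:R *: wedge (form1 E) Lam) /\
        eq_multisection (tangent_bundle M) (S 1%N 2%N (form1 E) Lam) 0].

End jacobi.

Section induced.
Context {R : realType} {n : nat} {M : manifold R n} {r : nat}.

Definition is_induced_jacobi (L Ls : algebroid M r) (phi0 X0 : M -> 'rV[R]_r)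
    (Lam : altform M n) (E : M -> 'rV[R]_n) : Prop :=
  is_jacobi Lam E /\
  forall f g, smooth_fun f -> smooth_fun g -> forall x,
    Lam [:: dfun (tangent_algebroid M) f; dfun (tangent_algebroid M) g] x
      + f x * vderiv E g x - g x * vderiv E f x =
    - dotp (dfun L f x + f x *: phi0 x) (dfun Ls g x + g x *: X0 x).

(* For Lie bialgebroids (phi0 = 0 and X0 = 0) the induced Jacobi structure has
   E = 0, i.e. is Poisson. *)
Definition is_induced_poisson (L Ls : algebroid M r) (Lam : altform M n) : Prop :=
  is_induced_jacobi L Ls 0 0 Lam 0.

End induced.

(** * Time-dependent structures *)

Section time.
Context {R : realType} {n : nat} {M : manifold R n} {r : nat}.
Let MR := time_manifold M.
Implicit Types (L Ls : algebroid M r) (X Y : MR -> 'rV[R]_r).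

Definition tslice {m : nat} (t : R) (X : MR -> 'rV[R]_m) : M -> 'rV[R]_m :=
  fun y => X (y, t).

Definition tderiv X : MR -> 'rV[R]_r :=
  fun p => derive1 (fun s : R => X (p.1, s)) p.2.

Definition tbracket L X Y : MR -> 'rV[R]_r :=
  fun p => bracket L (tslice p.2 X) (tslice p.2 Y) p.1.

(* The value at time p.2 of the pairing of X with the time-independent phi. *)
Definition tpair (phi : M -> 'rV[R]_r) X : MR -> R :=
  fun p => dotp (phi p.1) (X p).

(* The tangent space at (x, t) is 'rV_(n + 1), the last coordinate being the
   component on d/dt. *)
Definition bar_algebroid L (phi0 : M -> 'rV[R]_r) : algebroid MR r :=
  @Algebroid R (n + 1) MR r
    (fun X Y p => tbracket L X Y p + tpair phi0 X p *: tderiv Y p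
                  - tpair phi0 Y p *: tderiv X p)
    (fun p v => row_mx (anchor L p.1 v) (dotp (phi0 p.1) v)%:M).

Definition hat_algebroid Ls (X0 : M -> 'rV[R]_r) : algebroid MR r :=
  @Algebroid R (n + 1) MR r
    (fun a b p => expR (- p.2) *:
       (tbracket Ls a b p + tpair X0 a p *: (tderiv b p - b p)
        - tpair X0 b p *: (tderiv a p - a p)))
    (fun p v => expR (- p.2) *: row_mx (anchor Ls p.1 v) (dotp (X0 p.1) v)%:M).

Definition ddt : MR -> 'rV[R]_(n + 1) := fun=> row_mx 0 1%:M.

Definition lift_vf (E : M -> 'rV[R]_n) : MR -> 'rV[R]_(n + 1) :=
  fun p => row_mx (E p.1) 0.

(* A multivector field on M, viewed on M x R: covectors at (x, t) act through
   their restriction to T_x M. *)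
Definition lift_mvf (Lam : altform M n) : altform MR (n + 1) := fun als p =>
  Lam [seq tslice p.2 (fun q => lsubmx (al q)) | al <- als] p.1.

Definition poissonization (Lam : altform M n) (E : M -> 'rV[R]_n) :
    altform MR (n + 1) := fun als p =>
  expR (- p.2) *
    (lift_mvf Lam als p + wedge (form1 ddt) (form1 (lift_vf E)) als p).

End time.

(* Main.v *)
(** The hat structure is the bar structure of the dual transported along the
    bundle automorphism [X |-> e^t X], so both are Lie algebroids as soon as the
    bar structure is.  Bump functions make every section locally a combination
    of global sections; hence brackets and forms are local, and with the symmetry
    of second derivatives [d/dt] is a derivation of the bracket of time-dependent
    sections.

    The axioms of a Schouten bracket force
    [[X, P](a, b) = X (P (a, b)) - P (L_X a, b) - P (a, L_X b)].  The hat
    differential of [Y] is [e^-t (d_{*X0} Y + X0 /\ dY/dt)], so evaluating the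
    compatibility condition on time-independent [a] and [b] splits it into the
    compatibility of the time slices and terms in [dX/dt] and [dY/dt]; the latter
    cancel because [(L_{*X0})_{phi0} X + [X0, X] = 0] and [phi0(X0) = 0].

    For the second part, setting [f] or [g] to [1] in the formula defining the
    Jacobi structure gives [E = rho X0 = - rho_* phi0].  Both bivectors are
    tensorial, so it is enough to compare them on exact one-forms. *)

Require Import Defs.
From HB Require Import structures.
From mathcomp Require Import all_boot all_order all_algebra.
From mathcomp Require Import ring lra zify.
From mathcomp Require Import all_classical all_reals all_analysis.

Set Implicit Arguments.
Unset Strict Implicit.
Unset Printing Implicit Defensive.

Import Order.TTheory GRing.Theory Num.Theory.
Import numFieldNormedType.Exports.

Local Open Scope classical_set_scope.
Local Open Scope ring_scope.

(** * Calculus in normed spaces *)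

Section calculus.
Context {R : realType}.
Implicit Types V W : normedModType R.

(** An algebroid is given only by its operation on global smooth sections, so nothing says in
    advance that the bracket of two time-dependent sections, formed slice by slice, depends smoothly
    on [t]. Most of the preparation overcomes this: in a time-independent frame all the time
    dependence sits in coefficient functions, where smoothness is known and mixed derivatives
    commute. A Schouten bracket is known only through its axioms. The conditions on the generalized
    bialgebroid refer to one on [A], while the conclusion concerns an arbitrary one on the
    time-dependent bundle; the formula for [[X, P](a, b)] removes both from the computation. The Lie
    derivatives in it differ on the product: the bar structure shifts the slicewise [L_X a] by a
    multiple of [phi0]. The shift brings in the values of [d_{*X0} Y] on [phi0], which are exactly
    what the condition on Lie derivatives computes. The equation [phi0(X0) = 0] is itself read off
    from the Jacobi structure at [f = g = 1], so the bivector formula also serves the bialgebroid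
    part. *)

Lemma Ck_onW V W k (U : set V) (f : V -> W) : Ck_on k.+1 U f -> Ck_on k U f.
Proof.
elim: k f => [|k IH] f; first by case=> df _ u /df /differentiable_continuous.
by case=> df Df; split=> // v; apply: IH; exact: Df.
Qed.

(** A matrix-valued map is the finite sum of its entries times the elementary matrices, so
    differentiability, and inductively every iterated derivative, can be checked entry by entry. *)
Lemma Ck_on_mx V m n k (U : set V) (f : V -> 'M[R]_(m, n)) : open U ->
  (forall i j, Ck_on k U (fun u => f u i j)) -> Ck_on k U f.
Proof.
move=> oU; elim: k f => [|k IH] f fU.
  by move=> u Uu; apply: mx_continuous => i j; exact: fU.
have dij i j u : U u -> differentiable (fun u => f u i j) u.
  by move=> Uu; apply: (fU i j).1.
split=> [u Uu|v].
  rewrite (_ : f = \sum_i \sum_j (fun u => f u i j *: delta_mx i j)).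
    apply: differentiable_sum => i; apply: differentiable_sum => j.
    exact/differentiableZl/dij.
  apply/funext => w; rewrite fct_sumE [LHS]matrix_sum_delta; apply: eq_bigr => i _.
  by rewrite fct_sumE.
apply: IH => i j.
apply: (Ck_on_ext oU _ ((fU i j).2 v)) => u Uu.
rewrite derive_mx ?mxE//; apply/derivable_mxP => i' j'; apply: diff_derivable.
exact: dij.
Qed.

Lemma Ck_on_entry V m n k (U : set V) (f : V -> 'M[R]_(m, n)) i j : open U ->
  Ck_on k U f -> Ck_on k U (fun u => f u i j).
Proof.
move=> oU; elim: k f => [|k IH] f.
  move=> h u Uu; apply: (@continuous_comp _ _ _ f (fun A : 'M[R]_(m, n) => A i j)).
    exact: h.
  exact: coord_continuous.
case=> df Df; split=> [u Uu|v].
  apply: (@differentiable_comp _ _ _ _ f (fun A : 'M[R]_(m, n) => A i j)).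
    exact: df.
  exact: differentiable_coord.
apply: (Ck_on_ext oU _ (IH _ (Df v))) => u Uu.
by rewrite derive_mx ?mxE//; apply: diff_derivable; exact: df.
Qed.

Lemma Ck_onM V k (U : set V) (f g : V -> R) : open U ->
  Ck_on k U f -> Ck_on k U g -> Ck_on k U (f * g).
Proof.
move=> oU; elim: k f g => [|k IH] f g fU gU.
  by move=> u Uu; apply: continuousM; [exact: fU|exact: gU].
split=> [u Uu|v]; first by apply: differentiableM; [exact: fU.1|exact: gU.1].
apply: (@Ck_on_ext _ _ _ _ _ (f * 'D_v g + g * 'D_v f)) => //.
  by move=> u Uu; rewrite deriveM//; apply: diff_derivable; [exact: fU.1|exact: gU.1].
apply: Ck_onD => //; apply: IH; [exact: Ck_onW|exact: gU.2|exact: Ck_onW|exact: fU.2].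
Qed.

Lemma Ck_onN V W k (U : set V) (f : V -> W) : open U ->
  Ck_on k U f -> Ck_on k U (- f).
Proof.
move=> oU; elim: k f => [|k IH] f fU.
  by move=> u Uu; apply: continuousN; exact: fU.
split=> [u Uu|v]; first exact/differentiableN/fU.1.
apply: (@Ck_on_ext _ _ _ _ _ (- 'D_v f)) => //.
  by move=> u Uu; rewrite deriveN//; apply: diff_derivable; exact: fU.1.
by apply: IH; exact: fU.2.
Qed.

Lemma Ck_on_sum V W k (U : set V) (I : Type) (s : seq I) (f : I -> V -> W) :
  open U -> (forall i, Ck_on k U (f i)) -> Ck_on k U (\sum_(i <- s) f i).
Proof.
move=> oU fU; elim/big_ind : _ => [|g h kg kh|i _//]; last exact: Ck_onD.
exact: (Ck_on_cst k U (0 : W)).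
Qed.

(** The derivative is [- f^-2 * 'D_v f], in which [f^-1] is already of class [C^k] by induction. *)
Lemma Ck_onV V k (U : set V) (f : V -> R) : open U ->
  (forall u, U u -> f u != 0) -> Ck_on k U f -> Ck_on k U (fun u => (f u)^-1).
Proof.
move=> oU f0; elim: k => [|k IH] fU.
  by move=> u Uu; apply: continuousV; [exact: f0|exact: fU].
have fk := Ck_onW fU.
split=> [u Uu|v]; first by apply: differentiableV; [exact: fU.1|exact: f0].
pose g u := (f u)^-1.
apply: (@Ck_on_ext _ _ _ _ _ (- ((g * g) * 'D_v f))) => //.
  move=> u Uu; rewrite deriveV ?f0//; last by apply: diff_derivable; exact: fU.1.
  by rewrite !fctE /g -invfM scaleNr.
by apply: Ck_onN => //; apply: Ck_onM => //; [apply: Ck_onM => //; exact: IH|exact: fU.2].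
Qed.

(** [Ck_on] differentiates in fixed directions, whereas the chain rule yields the direction
    ['D_v g u], which moves with [u]. A finite-dimensional middle space lets this direction be
    expanded in a basis, giving a sum of products of real functions to which the induction
    applies. *)
Lemma Ck_on_comp V m k (U : set V) (U' : set 'rV[R]_m) (g : V -> 'rV[R]_m)
    (f : 'rV[R]_m -> R) : open U -> U `<=` g @^-1` U' ->
  Ck_on k U g -> Ck_on k U' f -> Ck_on k U (f \o g).
Proof.
move=> oU UU'; elim: k g f UU' => [|k IH] g f UU' gU fU.
  by move=> u Uu; apply: continuous_comp; [exact: gU|exact/fU/UU'].
split=> [u Uu|v].
  by apply: differentiable_comp; [exact: gU.1|exact/fU.1/UU'].
apply: (@Ck_on_ext _ _ _ _ _ (\sum_i
   ((fun u => ('D_v g u) 0 i) * ('D_(delta_mx 0 i) f \o g)))) => //.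
  move=> u Uu; have dg := gU.1 u Uu; have df := fU.1 _ (UU' _ Uu).
  rewrite [RHS]deriveE; last exact: differentiable_comp.
  rewrite diff_comp// /= -(deriveE _ dg) [X in _ = 'd f _ X]matrix_sum_delta.
  rewrite big_ord1 linear_sum fct_sumE; apply: eq_bigr => i _.
  by rewrite linearZ/= -deriveE.
apply: Ck_on_sum => // i; apply: Ck_onM => //.
  by apply: Ck_on_entry => //; exact: gU.2.
by apply: IH => //; [exact: Ck_onW|exact: fU.2].
Qed.

Lemma derive_comp V V' W (g : V -> V') (f : V' -> W) u v :
  differentiable g u -> differentiable f (g u) ->
  'D_v (f \o g) u = 'D_('D_v g u) f (g u).
Proof.
move=> dg df; rewrite [LHS]deriveE; last exact: differentiable_comp.
by rewrite diff_comp// /= -(deriveE _ dg) -(deriveE _ df).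
Qed.

End calculus.

(** * Symmetry of second derivatives *)

Section schwarz.
Context {R : realType} {V : normedModType R}.

Lemma is_derive_line (W : normedModType R) (f : V -> W) (c v : V) (a : R) :
  differentiable f (c + a *: v) ->
  is_derive a 1 (fun s : R => f (c + s *: v)) ('D_v f (c + a *: v)).
Proof.
move=> df.
have dl : is_diff a (fun s : R => c + s *: v) ( *:%R ^~ v).
  by apply: (is_diff_eq (is_diffD (is_diff_cst c a) (is_diff_scalel a v))); rewrite add0r.
have dg : differentiable (fun s : R => c + s *: v) a by exact: ex_diff.
apply: DeriveDef.
  exact: (diff_derivable (differentiable_comp dg df)).
rewrite (derive_comp (g := fun s : R => c + s *: v)) //.
by congr ('D__ f _); rewrite deriveE// diff_val scale1r.
Qed.

Lemma continuous_line (W : normedModType R) (f : V -> W) (c v : V) (a : R) :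
  differentiable f (c + a *: v) ->
  {for a, continuous (fun s : R => f (c + s *: v))}.
Proof.
move=> /is_derive_line[df _]; apply: differentiable_continuous.
exact/derivable1_diffP.
Qed.

(** Two uses of the mean value theorem. The second difference is [g e - g 0], hence [e] times some
    [dg a]; and [dg a] is itself the increment over [[0, e]] of ['D_v f] along the direction [w]. *)
Lemma second_difference (f : V -> R) (U : set V) (u v w : V) (e : R) : 0 < e ->
  (forall a b, 0 <= a <= e -> 0 <= b <= e -> U (u + a *: v + b *: w)) ->
  Ck_on 2 U f ->
  exists a b, [/\ 0 <= a <= e, 0 <= b <= e &
    f (u + e *: v + e *: w) - f (u + e *: w) - f (u + e *: v) + f u =
    'D_w ('D_v f) (u + a *: v + b *: w) * e * e].
Proof.
move=> e0 UU [df Df].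
have U0 a : 0 <= a <= e -> U (u + a *: v).
  by move=> ae; rewrite -(addr0 (u + a *: v)) -(scale0r w); apply: UU => //; rewrite lexx ltW.
have ee : 0 <= e <= e by rewrite lexx ltW.
have Ue a : 0 <= a <= e -> U (u + e *: w + a *: v).
  by move=> ae; rewrite addrAC; apply: UU.
pose g (a : R) := f (u + e *: w + a *: v) - f (u + a *: v).
pose dg (a : R) := 'D_v f (u + e *: w + a *: v) - 'D_v f (u + a *: v).
have gdg a : a \in `]0, e[%R -> is_derive a 1 g (dg a).
  rewrite in_itv/= => /andP[a0 ae].
  have ae' : 0 <= a <= e by rewrite !ltW.
  by apply: is_deriveB; apply: is_derive_line; apply: df; [exact: Ue|exact: U0].
have gc : {within `[0, e], continuous g}.
  apply: continuous_in_subspaceT => a; rewrite inE /= in_itv /= => ae.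
  apply: continuousB; apply: continuous_line; apply: df; [exact: Ue|exact: U0].
have [a] := MVT e0 gdg gc.
rewrite in_itv/= => /andP[a0 ae] ga.
have ae' : 0 <= a <= e by rewrite !ltW.
pose h (b : R) := 'D_v f (u + a *: v + b *: w).
pose dh (b : R) := 'D_w ('D_v f) (u + a *: v + b *: w).
have Dv := (Df v).1.
have hdh b : b \in `]0, e[%R -> is_derive b 1 h (dh b).
  rewrite in_itv/= => /andP[b0 be]; apply: is_derive_line; apply: Dv.
  by apply: UU => //; rewrite !ltW.
have hc : {within `[0, e], continuous h}.
  apply: continuous_in_subspaceT => b; rewrite inE /= in_itv /= => be.
  by apply: (@continuous_line _ ('D_v f)); apply: Dv; apply: UU.
have [b] := MVT e0 hdh hc.
rewrite in_itv/= => /andP[b0 be] hb.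
exists a, b; split; rewrite ?(ltW a0) ?(ltW b0) ?(ltW ae) ?(ltW be)//.
move: ga hb; rewrite /g /h /dg /dh !scale0r !subr0 !addr0 => ga hb.
have -> : u + e *: v + e *: w = u + e *: w + e *: v by rewrite addrAC.
rewrite -hb addrAC [u + a *: v + e *: w]addrAC -ga; ring.
Qed.

(** The second difference is symmetric in [v] and [w], so the two mixed derivatives share a value at
    points arbitrarily close to [u]. If they differed by [r > 0] at [u], continuity would bring both
    within [r / 2] of this common value, forcing [r < r]. *)
Lemma schwarz (f : V -> R) (U : set V) (u v w : V) : open U -> U u ->
  Ck_on 2 U f -> 'D_v ('D_w f) u = 'D_w ('D_v f) u.
Proof.
move=> oU Uu fU; apply/eqP; rewrite -subr_eq0 -normr_eq0.
apply/negP => /negP n0.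
have := fU.2 w; move=> [_ /(_ v u Uu)] /= /cvgr_dist_lt c1.
have := fU.2 v; move=> [_ /(_ w u Uu)] /= /cvgr_dist_lt c2.
set r := `|_| in n0.
have r2 : 0 < r / 2 by rewrite divr_gt0// lt0r n0 normr_ge0.
have nU : \forall x \near u, U x by apply: open_nbhs_nbhs.
have [d /= d0 dP] := (iffLR (nbhs_ballP _ _) (filterI (filterI (c1 _ r2) (c2 _ r2)) nU)).
(* With this [e] the parallelogram spanned by [e *: v] and [e *: w] at [u] stays in the ball of
   radius [d]. The summand 1 keeps the denominator positive when both vectors vanish. *)
pose e := d / 2 / (`|v| + `|w| + 1).
have D0 : 0 < `|v| + `|w| + 1 by rewrite ltr_wpDl// addr_ge0.
have e0 : 0 < e by rewrite !divr_gt0.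
have near_u a b : 0 <= a <= e -> 0 <= b <= e -> ball u d (u + a *: v + b *: w).
  move=> /andP[a0 ae] /andP[b0 be].
  rewrite -ball_normE /= opprD addrA opprD addrA subrr add0r -opprD normrN.
  apply: (le_lt_trans (ler_normD _ _)); rewrite !normrZ (ger0_norm a0) (ger0_norm b0).
  apply: (@le_lt_trans _ _ (e * (`|v| + `|w| + 1))).
    rewrite mulrDr mulrDr mulr1 -[leLHS]addr0 lerD ?(ltW e0)//.
    by rewrite lerD// ler_wpM2r.
  by rewrite /e divfK ?gt_eqF// ltr_pdivrMr// ltr_pMr// ltr1n.
have UU a b : 0 <= a <= e -> 0 <= b <= e -> U (u + a *: v + b *: w).
  by move=> ae be; have [_] := dP _ (near_u a b ae be).
have UU' a b : 0 <= a <= e -> 0 <= b <= e -> U (u + a *: w + b *: v).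
  by move=> ae be; rewrite addrAC; exact: UU.
have [a [b [ae be E1]]] := second_difference e0 UU fU.
have [a' [b' [ae' be' E2]]] := second_difference e0 UU' fU.
have E : 'D_w ('D_v f) (u + a *: v + b *: w) =
         'D_v ('D_w f) (u + a' *: w + b' *: v).
  have ee : e * e != 0 by rewrite mulf_neq0 ?gt_eqF.
  apply: (mulIf ee); rewrite [LHS]mulrA [RHS]mulrA.
  apply: etrans (esym E1) (etrans _ E2).
  by rewrite [u + e *: v + _]addrAC [X in X + _ = _]addrAC.
have [[_ k2] _] := dP _ (near_u a b ae be).
have := near_u b' a' be' ae'; rewrite addrAC => /dP[[k1 _] _].
move: k1 k2 => /= k1 k2; rewrite E in k2.
have tri (x y z t : R) : `|x - z| < t -> `|y - z| < t -> `|x - y| < t + t.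
  by rewrite [`|y - z|]distrC => xz yz; rewrite -(subrKA z) (le_lt_trans (ler_normD _ _))// ltrD.
have : r < r / 2 + r / 2 := tri _ _ _ _ k1 k2.
by rewrite -splitr ltxx.
Qed.

End schwarz.

(** * Smooth bump functions on row vectors *)

Section bump_rV.
Context {R : realType}.

Lemma Ck_on_is_derive k (f df : R -> R) :
  (forall x : R, is_derive x 1 f (df x)) -> Ck_on k setT df -> Ck_on k.+1 setT f.
Proof.
move=> fdf kdf.
have dif x : differentiable f x by apply/derivable1_diffP; exact: ex_derive.
split=> // v; apply: (@Ck_on_ext _ _ _ _ _ (cst v * df)) => [||].
- exact: openT.
- move=> x _; rewrite deriveE// -[v in RHS]mulr1 -[v * 1]/(v *: 1) linearZ /=.
  by rewrite -deriveE// derive_val.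
- by apply: Ck_onM => //; [exact: openT|exact: Ck_on_cst].
Qed.

Lemma Ck_on_expR k : Ck_on k setT (@expR R).
Proof.
elim: k => [|k IH]; first by move=> x _; exact: continuous_expR.
by apply: Ck_on_is_derive IH => x; exact: is_derive_expR.
Qed.

(* [exp(-1/x) / x^j]: derivatives stay within the family, cf. [is_derive_flat]. *)
Definition flat (j : nat) (x : R) : R :=
  if 0 < x then x^-1 ^+ j * expR (- x^-1) else 0.

(** With [y = 1 / x] this says [y ^ (j + 1) <= (j + 1)! * exp y], which follows from a single term
    of the exponential series. It is the estimate that gives the derivative at 0. *)
Lemma flat_le j x : `|flat j x| <= (j.+1)`!%:R * `|x|.
Proof.
rewrite /flat; case: ifPn => [x0|_]; last by rewrite normr0 mulr_ge0.
rewrite !ger0_norm ?(ltW x0) ?mulr_ge0 ?expR_ge0 ?exprn_ge0 ?invr_ge0 ?(ltW x0)//.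
set y := x^-1; have y0 : 0 < y by rewrite invr_gt0.
have xy : x = y^-1 by rewrite invrK.
rewrite expRN ler_pdivrMr ?expR_gt0// xy mulrAC ler_pdivlMr// -exprSr.
have F : (0 : R) < (j.+1)`!%:R by rewrite ltr0n fact_gt0.
rewrite -ler_pdivrMl// mulrC.
by apply: le_trans (expR_ge1Dxn j (ltW y0)); rewrite lerDr.
Qed.

Lemma is_derive_flat j (x : R) : is_derive x 1 (flat j) (flat j.+2 x - j%:R * flat j.+1 x).
Proof.
have [x0|x0|->] := ltrgt0P x.
- apply: (@near_eq_is_derive R R R ((fun y => y^-1) ^+ j * (fun y => expR (- y^-1)))).
  + have : \forall y \near x, 0 < y by exact: lt_nbhsr.
    by apply: filterS => y y0; rewrite /flat y0 !fctE.
  + have dV : is_derive x 1 (fun y : R => y^-1) (- (x^-1 ^+ 2)).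
      have di : derivable (id : R -> R) x 1 by exact: derivable_id.
      have xn0 := lt0r_neq0 x0.
      have H : derivable (fun y : R => y^-1) x 1 by exact: (derivableV xn0 di).
      apply: DeriveDef => //.
      by rewrite (deriveV xn0 di) derive_id /GRing.scale /= mulr1 exprVn.
    have dE : is_derive x 1 (fun y : R => expR (- y^-1)) (expR (- x^-1) * x^-1 ^+ 2).
      have dN : is_derive x 1 (fun y : R => - y^-1) (- - (x^-1 ^+ 2)) by exact: is_deriveN.
      have := @is_derive1_comp R expR (fun y => - y^-1) x _ _ (is_derive_expR (- x^-1)) dN.
      by rewrite opprK.
    apply: (is_derive_eq (is_deriveM (is_deriveX j dV) dE)).
    rewrite /flat x0 !fctE /GRing.scale /=.
    move: (x^-1) (expR _) => y E.
    case: j => [|j]; first by rewrite /=; ring.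
    by rewrite [j.+1.-1]/= -natr1 !exprS expr0; ring.
- apply: (@near_eq_is_derive R R R (cst 0)).
  + have : \forall y \near x, y < 0 by exact: lt_nbhsl.
    by apply: filterS => y y0; rewrite /flat ltNge ltW.
  + by rewrite /flat ltNge (ltW x0) /= mulr0 subr0; exact: is_derive_cst.
(* At 0 the difference quotient of [flat j] is [flat j.+1 h], which [flat_le] bounds by a constant
   times [|h|]. *)
- rewrite /flat ltxx mulr0 subr0.
  suff c : h^-1 *: (flat j (h *: 1 + 0) - flat j 0) @[h --> 0^'] --> 0.
    by apply: DeriveDef; [apply/cvg_ex; exists 0|exact: cvg_lim c].
  apply/cvgrPdist_lt => e e0.
  have F : (0 : R) < (j.+2)`!%:R by rewrite ltr0n fact_gt0.
  near=> h.
  have h0 : h != 0 by near: h; exact: nbhs_dnbhs_neq.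
  rewrite sub0r normrN addr0 [flat j 0]/flat ltxx subr0.
  rewrite /GRing.scale /= mulr1.
  have -> : h^-1 * flat j h = flat j.+1 h.
    by rewrite /flat; case: ifP => _; rewrite ?mulr0// mulrA exprS.
  apply: le_lt_trans (flat_le _ _) _.
  rewrite -ltr_pdivlMl//.
  near: h; apply: dnbhs0_lt; by rewrite mulr_gt0// invr_gt0.
Unshelve. all: by end_near.
Qed.

Lemma Ck_on_flat k j : Ck_on k setT (flat j).
Proof.
elim: k j => [|k IH] j.
  move=> x _; apply: differentiable_continuous; apply/derivable1_diffP.
  by have [] := is_derive_flat j x.
apply: Ck_on_is_derive (is_derive_flat j) _.
apply: Ck_onD; [exact: openT|exact: IH|].
apply: Ck_onN; first exact: openT.
by apply: (@Ck_onM _ _ _ _ (cst j%:R)); [exact: openT|exact: Ck_on_cst|exact: IH].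
Qed.

(** The usual smooth step, descending from 1 to 0 over the unit interval. The denominator never
    vanishes because [x] and [1 - x] cannot both be nonpositive. *)
Definition cutoff (x : R) : R := flat 0 (1 - x) / (flat 0 (1 - x) + flat 0 x).

Lemma flat0_gt0 x : 0 < x -> 0 < flat 0 x.
Proof. by move=> x0; rewrite /flat x0 expr0 mul1r expR_gt0. Qed.

Lemma flat0_ge0 x : 0 <= flat 0 x.
Proof. by rewrite /flat; case: ifP => // _; rewrite expr0 mul1r expR_ge0. Qed.

Lemma cutoff_den x : flat 0 (1 - x) + flat 0 x != 0.
Proof.
rewrite gt_eqF//; have [x0|x0] := ltP 0 x.
  by rewrite ltr_wpDl ?flat0_ge0 ?flat0_gt0.
by rewrite ltr_pwDl ?flat0_ge0 ?flat0_gt0// subr_gt0 (le_lt_trans x0).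
Qed.

Lemma cutoff1 x : x <= 0 -> cutoff x = 1.
Proof.
move=> x0; have := cutoff_den x; rewrite /cutoff.
by rewrite [flat 0 x]/flat ltNge x0 /= addr0 => ?; rewrite divff.
Qed.

Lemma cutoff0 x : 1 <= x -> cutoff x = 0.
Proof. by move=> x1; rewrite /cutoff {1}/flat subr_gt0 ltNge x1 /= mul0r. Qed.

(** The composition lemma requires row vectors in the middle, so the real line is routed through
    ['rV_1]. *)
Lemma Ck_on_real_comp (V : normedModType R) k (U : set V) (f : R -> R) (g : V -> R) :
  open U -> Ck_on k setT f -> Ck_on k U g -> Ck_on k U (f \o g).
Proof.
move=> oU kf kg.
rewrite (_ : f \o g = (f \o (fun v : 'rV[R]_1 => v 0 0)) \o (fun u => (g u)%:M)).
  apply: (@Ck_on_comp _ _ _ _ _ setT) => //.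
    apply: Ck_on_mx => // i j; apply: Ck_on_ext kg => // u _.
    by rewrite !ord1 mxE eqxx mulr1n.
  elim: k f {kg} kf => [|k IH] f kf.
    move=> u _; apply: (@continuous_comp _ _ _ (fun v : 'rV[R]_1 => v 0 0) f).
      exact: coord_continuous.
    exact: kf.
  have d0 (u : 'rV[R]_1) : differentiable (fun v : 'rV[R]_1 => v 0 0) u.
    exact: differentiable_coord.
  have df u : differentiable f u by exact: kf.1.
  split=> [u _|v].
    by apply: (@differentiable_comp _ _ _ _ (fun v : 'rV[R]_1 => v 0 0) f).
  rewrite (_ : 'D_v _ = 'D_(v 0 0) f \o (fun v : 'rV[R]_1 => v 0 0)).
    by apply: IH; exact: kf.2.
  apply/funext => u; rewrite (@derive_comp _ _ _ _ (fun v : 'rV[R]_1 => v 0 0))//=.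
  congr ('D__ f _).
  have did : derivable (id : 'rV[R]_1 -> 'rV[R]_1) u v by exact: derivable_id.
  have := derive_mx did.
  by rewrite derive_id => /matrixP/(_ 0 0); rewrite mxE => ->.
by apply/funext => u /=; rewrite mxE eqxx mulr1n.
Qed.

Lemma Ck_on_cutoff k : Ck_on k setT cutoff.
Proof.
have o : open (setT : set R) by exact: openT.
have k1 : Ck_on k setT (fun x : R => flat 0 (1 - x)).
  apply: (@Ck_on_real_comp _ _ _ (flat 0) (fun x : R => 1 - x)) => //.
    exact: Ck_on_flat.
  apply: (@Ck_onD R R R k setT (cst 1) (- (id : R -> R))) => //; first exact: Ck_on_cst.
  by apply: Ck_onN => //; apply: (@Ck_on_linear R _ _ _ _ idfun) => ? //.
apply: (@Ck_onM R R k setT (fun x : R => flat 0 (1 - x))) => //.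
apply: Ck_onV => // [u _|]; first exact: cutoff_den.
by apply: (@Ck_onD R R R _ _ (fun x : R => flat 0 (1 - x))) => //; exact: Ck_on_flat.
Qed.

Lemma bump_rV n (c : 'rV[R]_n) (U : set 'rV[R]_n) : nbhs c U ->
  exists (b : 'rV[R]_n -> R) (K : set 'rV[R]_n),
    [/\ compact K, K `<=` U, smooth_on setT b,
        \forall u \near c, b u = 1 & forall u, ~ K u -> b u = 0].
Proof.
move=> /nbhs_ballP[d /= d0 dU].
pose e := d / 2; have e0 : 0 < e by rewrite divr_gt0.
(* The argument of [cutoff] is at most 0 when [|u_i - c_i| <= e / sqrt 2] and at least 1 when
   [|u_i - c_i| >= e]. *)
pose b (u : 'rV[R]_n) := \prod_(i < n) cutoff ((u 0 i - c 0 i) ^+ 2 * (2 / e ^+ 2) - 1).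
exists b, [set u | forall i, `[c 0 i - e, c 0 i + e]%classic (u 0 i)].
have e2 : 0 < e ^+ 2 by rewrite exprn_gt0.
split.
- by apply: (@rV_compact R n (fun i => `[c 0 i - e, c 0 i + e]%classic)) => i; exact: segment_compact.
- move=> u /= uK; apply: dU; split => // i j; rewrite ord1.
  have := uK j; rewrite /= in_itv /= => /andP[h1 h2].
  rewrite /ball /= distrC ltr_distl; apply/andP; split.
    by apply: lt_le_trans h1; rewrite ltrD2l ltrN2 ltr_pdivrMr// ltr_pMr// ltr1n.
  by apply: le_lt_trans h2 _; rewrite ltrD2l ltr_pdivrMr// ltr_pMr// ltr1n.
- move=> k.
  have o : open (setT : set 'rV[R]_n) by exact: openT.
  pose f i (u : 'rV[R]_n) := cutoff ((u 0 i - c 0 i) ^+ 2 * (2 / e ^+ 2) - 1).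
  have kf i : Ck_on k setT (f i).
    apply: (@Ck_on_real_comp _ _ _ cutoff (fun u : 'rV[R]_n => (u 0 i - c 0 i) ^+ 2 * (2 / e ^+ 2) - 1)) => //; first exact: Ck_on_cutoff.
    apply: (@Ck_onD R _ R _ _ (fun u : 'rV[R]_n => (u 0 i - c 0 i) ^+ 2 * (2 / e ^+ 2)) (cst (-1))) => //; last exact: Ck_on_cst.
    apply: (@Ck_onM R _ _ _ (fun u : 'rV[R]_n => (u 0 i - c 0 i) ^+ 2) (cst (2 / e ^+ 2))) => //; last exact: Ck_on_cst.
    have kc : Ck_on k setT (fun u : 'rV[R]_n => u 0 i - c 0 i).
      apply: (@Ck_onD R _ R _ _ (fun u : 'rV[R]_n => u 0 i) (cst (- c 0 i))) => //; last exact: Ck_on_cst.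
      by apply: Ck_on_entry => //; apply: (@Ck_on_linear R _ _ _ _ idfun) => ? //.
    by have := Ck_onM o kc kc.
  rewrite (_ : b = \prod_(i < n) f i).
    elim/big_ind : _ => [|g h kg kh|i _//]; last exact: Ck_onM.
    exact: (Ck_on_cst k setT (1 : R)).
  by apply/funext => u; rewrite /b fct_prodE.
- have cc i : \forall u \near c, `|(u : 'rV[R]_n) 0 i - c 0 i| < e / 2.
    have /cvgr_dist_lt : (fun u : 'rV[R]_n => u 0 i) @ c --> c 0 i by exact: coord_continuous.
    move=> /(_ (e / 2)); rewrite divr_gt0// => /(_ isT).
    by apply: filterS => u /=; rewrite distrC.
  have : \forall u \near c, forall i, `|(u : 'rV[R]_n) 0 i - c 0 i| < e / 2.
    by apply: (@filter_forall 'rV[R]_n 'I_n (fun i u => `|u 0 i - c 0 i| < e / 2) (nbhs c)) => i; exact: cc.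
  apply: filterS => u ul; rewrite /b big1 // => i _; apply: cutoff1.
  rewrite subr_le0 mulrA ler_pdivrMr// mul1r -(real_normK (num_real (u 0 i - c 0 i))).
  have := ul i; have := normr_ge0 (u 0 i - c 0 i).
  move: `|_| => x x0 xe; have h : x * x <= (e / 2) * (e / 2) by rewrite ler_pM// ltW.
  by move: h; rewrite !expr2; move: (e) => e' h; nra.
- move=> u /existsNP[i iK].
  have lee : e ^+ 2 <= (u 0 i - c 0 i) ^+ 2.
    rewrite -[leRHS]real_normK ?num_real// lerXn2r ?nnegrE ?(ltW e0)//.
    rewrite leNgt; apply: contra_notN iK; rewrite ltr_distl /= in_itv /= => /andP[h1 h2].
    by rewrite !ltW.
  rewrite /b (bigD1 i)//= cutoff0 ?mul0r//.
  by rewrite lerBrDr mulrA ler_pdivlMr//; lra.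
Qed.

End bump_rV.

(** * Smooth functions and sections *)

Section smooth_at.
Context {R : realType} {n : nat} {M : manifold R n}.
Implicit Types (f g : M -> R) (x y z : M).

Lemma chart_image_open z (N : set M) : open N ->
  open (mchart z @` (mdom z `&` N)).
Proof. exact: mdomI_image_open. Qed.

Lemma chart_nbhs z y (N : set M) : mdom z y -> nbhs y N ->
  exists U : set 'rV[R]_n, [/\ open U, U (mchart z y) &
    forall u, U u -> exists2 w, mdom z w /\ N w & u = mchart z w].
Proof.
rewrite nbhsE => zy [N' [oN' N'y] N'N].
exists (mchart z @` (mdom z `&` N')); split; first exact: chart_image_open.
  by exists y.
by move=> _ [w [zw N'w] <-]; exists w => //; split => //; exact: N'N.
Qed.

Lemma nbhs_mdom z y : mdom z y -> nbhs y (mdom z).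
Proof. by move=> zy; apply: open_nbhs_nbhs; split => //; exact: mdom_open. Qed.

(** Smoothness passes from the chart in the definition to [z] by composing with the transition map
    where both charts are defined. Keeping [U] inside the image of the chart matters: there every
    point is some [mchart z w], while elsewhere [mparam z] is arbitrary. *)
Lemma smooth_atP f z y : mdom z y ->
  smooth_at f y <-> exists U : set 'rV[R]_n, [/\ open U,
    U `<=` mchart z @` mdom z, U (mchart z y) & smooth_on U (f \o mparam z)].
Proof.
move=> zy; split; last first.
  by move=> [U [oU UD Uy sU]]; exists z, U.
move=> [x [U [xy oU Uy sU]]].
have Nz : nbhs y [set w | mdom x w /\ U (mchart x w)].
  apply: filterI; first exact: nbhs_mdom.
  have := mchart_continuous xy; apply.
  exact: open_nbhs_nbhs.
have [U' [oU' U'y U'P]] := chart_nbhs zy Nz.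
exists U'; split => // [u /U'P[w [zw _] ->]|]; first by exists w.
move=> k.
apply: (@Ck_on_ext _ _ _ _ _ ((f \o mparam x) \o (mchart x \o mparam z))) => //.
  by move=> u /U'P[w [zw [xw _]] ->] /=; rewrite (mchartK zw) (mchartK xw).
apply: (@Ck_on_comp _ _ _ _ _ U) => //.
  by move=> u /U'P[w [zw [xw Uw]] ->] /=; rewrite (mchartK zw).
apply: Ck_onS (mtransition_smooth z x k).
by move=> u /U'P[w [zw [xw Uw]] ->] /=; exists w.
Qed.

Lemma smooth_at_op1 (op : (M -> R) -> M -> R) f y :
  (forall z k (U : set 'rV[R]_n), open U -> Ck_on k U (f \o mparam z) ->
     Ck_on k U (op f \o mparam z)) ->
  smooth_at f y -> smooth_at (op f) y.
Proof.
move=> opP [x [U [xy oU Uy sU]]]; exists x, U; split => // k.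
by apply: opP => //; exact: sU.
Qed.

Lemma smooth_at_op2 (op : (M -> R) -> (M -> R) -> M -> R) f g y :
  (forall z k (U : set 'rV[R]_n), open U -> Ck_on k U (f \o mparam z) ->
     Ck_on k U (g \o mparam z) -> Ck_on k U (op f g \o mparam z)) ->
  smooth_at f y -> smooth_at g y -> smooth_at (op f g) y.
Proof.
move=> opP; have yy := mdom_mem y.
move=> /(smooth_atP _ yy)[U [oU UD Uy sU]] /(smooth_atP _ yy)[V [oV VD Vy sV]].
have oUV : open (U `&` V) by exact: openI.
exists y, (U `&` V); split => // k; apply: opP => //.
  by apply: Ck_onS (sU k) => u [].
by apply: Ck_onS (sV k) => u [].
Qed.

Lemma smooth_at_cst (c : R) y : smooth_at (cst c : M -> R) y.
Proof.
exists y, setT; split => //; [exact: mdom_mem|exact: openT|].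
by move=> k; exact: Ck_on_cst.
Qed.

Lemma smooth_atD f g y : smooth_at f y -> smooth_at g y ->
  smooth_at (fun x => f x + g x) y.
Proof.
apply: (@smooth_at_op2 (fun f g x => f x + g x)) => z k U oU fU gU.
exact: (Ck_onD oU fU gU).
Qed.

Lemma smooth_atM f g y : smooth_at f y -> smooth_at g y ->
  smooth_at (fun x => f x * g x) y.
Proof.
apply: (@smooth_at_op2 (fun f g x => f x * g x)) => z k U oU fU gU.
exact: (Ck_onM oU fU gU).
Qed.

Lemma smooth_atN f y : smooth_at f y -> smooth_at (fun x => - f x) y.
Proof.
apply: (@smooth_at_op1 (fun f x => - f x)) => z k U oU fU.
exact: (Ck_onN oU fU).
Qed.

Lemma smooth_atB f g y : smooth_at f y -> smooth_at g y ->
  smooth_at (fun x => f x - g x) y.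
Proof. by move=> sf sg; apply: smooth_atD => //; exact: smooth_atN. Qed.

Lemma smooth_at_comp_real (h : R -> R) f y : smooth_on setT h ->
  smooth_at f y -> smooth_at (fun x => h (f x)) y.
Proof.
move=> sh; apply: (@smooth_at_op1 (fun f x => h (f x))) => z k U oU fU.
exact: (Ck_on_real_comp oU (sh k) fU).
Qed.

Lemma smooth_at_sum (I : Type) (s : seq I) (P : pred I) (F : I -> M -> R) y :
  (forall i, P i -> smooth_at (F i) y) -> smooth_at (fun x => \sum_(i <- s | P i) F i x) y.
Proof.
move=> sF; rewrite (_ : (fun _ => _) = \sum_(i <- s | P i) F i); last first.
  by apply/funext => x; rewrite fct_sumE.
elim/big_ind : _ => [|f g sf sg|//]; first exact: smooth_at_cst.
exact: smooth_atD.
Qed.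

Lemma smooth_at_ext (W : normedModType R) (f g : M -> W) y :
  (\forall z \near y, f z = g z) -> smooth_at f y -> smooth_at g y.
Proof.
move=> fg [x [U [xy oU Uy sU]]].
have [V [oV Vy VP]] := chart_nbhs xy fg.
have oUV : open (U `&` V) by exact: openI.
exists x, (U `&` V); split => // k.
apply: (@Ck_on_ext _ _ _ _ _ (f \o mparam x)) => //.
  by move=> u [_ /VP[w [xw fgw] ->]] /=; rewrite (mchartK xw).
by apply: Ck_onS (sU k) => u [].
Qed.

Lemma smooth_at_near (W : normedModType R) (f : M -> W) y :
  smooth_at f y -> \forall z \near y, smooth_at f z.
Proof.
move=> [x [U [xy oU Uy sU]]].
have : nbhs y [set w | mdom x w /\ U (mchart x w)].
  apply: filterI; first exact: nbhs_mdom.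
  have := mchart_continuous xy; apply; exact: open_nbhs_nbhs.
by apply: filterS => w [xw Uw]; exists x, U.
Qed.

Lemma smooth_at_mxP p q (F : M -> 'M[R]_(p, q)) y :
  smooth_at F y <-> forall i j, smooth_at (fun x => F x i j) y.
Proof.
split.
  move=> [x [U [xy oU Uy sU]]] i j; exists x, U; split => // k.
  exact: (Ck_on_entry i j oU (sU k)).
move=> sF; have yy := mdom_mem y.
have UP ij := (smooth_atP _ yy).1 (sF ij.1 ij.2).
have UP' ij := cid (UP ij).
pose U ij := sval (UP' ij).
(* Each entry comes with its own open set. As there are finitely many, their intersection is a
   neighbourhood, and its interior is an open set that serves them all. *)
have oV : open (interior [set u | forall ij, U ij u]) by exact: open_interior.
exists y, (interior [set u | forall ij, U ij u]); split => //.
  apply: (@filter_forall _ _ U (nbhs (mchart y y))) => ij.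
  have [oU _ Uy _] := svalP (UP' ij).
  exact: open_nbhs_nbhs.
move=> k; apply: Ck_on_mx => // i j.
have [_ _ _ /(_ k)] := svalP (UP' (i, j)).
by apply: Ck_onS => u /interior_subset; apply.
Qed.

Lemma smooth_at_mulmx p q r (F : M -> 'M[R]_(p, q)) (G : M -> 'M[R]_(q, r)) y :
  smooth_at F y -> smooth_at G y -> smooth_at (fun x => F x *m G x) y.
Proof.
move=> /smooth_at_mxP sF /smooth_at_mxP sG; apply/smooth_at_mxP => i j.
apply: (@smooth_at_ext _ (fun x => \sum_k F x i k * G x k j)).
  by near=> z; rewrite mxE.
by apply: smooth_at_sum => k _; apply: smooth_atM.
Unshelve. all: by end_near.
Qed.

Lemma smooth_at_differentiable f z y : mdom z y -> smooth_at f y ->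
  differentiable (f \o mparam z) (mchart z y).
Proof.
by move=> zy /(smooth_atP _ zy)[U [_ _ Uy sU]]; apply: (sU 1%N).1.
Qed.

End smooth_at.

(** * Bilinearity of the pairing *)

Section dotp_theory.
Context {R : realType} {m : nat}.
Implicit Types (u v w : 'rV[R]_m).

Lemma dotpE u v : dotp u v = \sum_i u 0 i * v 0 i.
Proof. by rewrite /dotp mxE; apply: eq_bigr => i _; rewrite mxE. Qed.

Lemma dotpC u v : dotp u v = dotp v u.
Proof. by rewrite !dotpE; apply: eq_bigr => i _; rewrite mulrC. Qed.

Lemma dotpDl u v w : dotp (u + v) w = dotp u w + dotp v w.
Proof. by rewrite /dotp mulmxDl mxE. Qed.

Lemma dotpZl a u v : dotp (a *: u) v = a * dotp u v.
Proof. by rewrite /dotp -scalemxAl mxE. Qed.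

Lemma dotpNl u v : dotp (- u) v = - dotp u v.
Proof. by rewrite /dotp mulNmx mxE. Qed.

Lemma dotpDr u v w : dotp u (v + w) = dotp u v + dotp u w.
Proof. by rewrite dotpC dotpDl !(dotpC u). Qed.

Lemma dotpZr a u v : dotp u (a *: v) = a * dotp u v.
Proof. by rewrite dotpC dotpZl dotpC. Qed.

Lemma dotpNr u v : dotp u (- v) = - dotp u v.
Proof. by rewrite dotpC dotpNl dotpC. Qed.

Lemma dotpBl u v w : dotp (u - v) w = dotp u w - dotp v w.
Proof. by rewrite dotpDl dotpNl. Qed.

Lemma dotpBr u v w : dotp u (v - w) = dotp u v - dotp u w.
Proof. by rewrite dotpDr dotpNr. Qed.

Lemma dotp0l v : dotp (0 : 'rV[R]_m) v = 0.
Proof. by rewrite /dotp mul0mx mxE. Qed.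

Lemma dotp0r v : dotp v (0 : 'rV[R]_m) = 0.
Proof. by rewrite dotpC dotp0l. Qed.

Lemma dotp_delta u i : dotp u (delta_mx 0 i) = u 0 i.
Proof.
rewrite dotpE (bigD1 i)//= big1 ?addr0; last first.
  by move=> j ji; rewrite mxE eqxx (negbTE ji) mulr0.
by rewrite mxE !eqxx mulr1.
Qed.

End dotp_theory.

(** * Directional derivatives at a point of a manifold *)

Section pderiv.
Context {R : realType} {n : nat} {M : manifold R n}.
Implicit Types (f g : M -> R) (x y z : M) (v w : 'rV[R]_n).

(** The vector [v] is read in the chart [mchart x], and [vderiv X f x] is convertible to
    [pderiv x (X x) f]. Separating the point from the vector lets the vector vary, for instance with
    time, while the point stays fixed. *)
Definition pderiv x v f : R := 'D_v (f \o mparam x) (mchart x x).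

Lemma smooth_at_diff f x : smooth_at f x ->
  differentiable (f \o mparam x) (mchart x x).
Proof. by apply: smooth_at_differentiable; exact: mdom_mem. Qed.

Lemma smooth_at_derivable f x v : smooth_at f x ->
  derivable (f \o mparam x) (mchart x x) v.
Proof. by move=> sf; apply/diff_derivable/smooth_at_diff. Qed.

Lemma pderiv_ext f g x v : (\forall z \near x, f z = g z) ->
  pderiv x v f = pderiv x v g.
Proof.
move=> fg; apply: near_eq_derive.
have [U [oU Ux UP]] := chart_nbhs (mdom_mem x) fg.
have : nbhs (mchart x x) U by exact: open_nbhs_nbhs.
by apply: filterS => u /UP[z [xz fgz] ->] /=; rewrite (mchartK xz).
Qed.

Lemma pderivD f g x v : smooth_at f x -> smooth_at g x ->
  pderiv x v (fun z => f z + g z) = pderiv x v f + pderiv x v g.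
Proof. by move=> sf sg; exact: (@deriveD R _ R (f \o mparam x) (g \o mparam x) _ v (smooth_at_derivable sf) (smooth_at_derivable sg)). Qed.

Lemma pderivM f g x v : smooth_at f x -> smooth_at g x ->
  pderiv x v (fun z => f z * g z) = f x * pderiv x v g + pderiv x v f * g x.
Proof.
move=> sf sg; rewrite /pderiv.
rewrite -[X in X * pderiv x v g](f_equal f (mchartK (mdom_mem x))).
rewrite -[X in _ + _ * X](f_equal g (mchartK (mdom_mem x))).
rewrite [X in _ + X]mulrC.
exact: (@deriveM R _ (f \o mparam x) (g \o mparam x) _ v (smooth_at_derivable sf) (smooth_at_derivable sg)).
Qed.

Lemma pderivB f g x v : smooth_at f x -> smooth_at g x ->
  pderiv x v (fun z => f z - g z) = pderiv x v f - pderiv x v g.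
Proof. by move=> sf sg; exact: (@deriveB R _ R (f \o mparam x) (g \o mparam x) _ v (smooth_at_derivable sf) (smooth_at_derivable sg)). Qed.

Lemma pderiv_cst (c : R) x v : pderiv x v (cst c) = 0.
Proof. by rewrite /pderiv (_ : _ \o _ = cst c) ?derive_cst. Qed.

Lemma pderiv_sum (I : Type) (s : seq I) (F : I -> M -> R) x v :
  (forall i, smooth_at (F i) x) ->
  pderiv x v (fun z => \sum_(i <- s) F i z) = \sum_(i <- s) pderiv x v (F i).
Proof.
move=> sF; elim: s => [|i s IH].
  rewrite big_nil (_ : (fun _ => _) = cst 0) ?pderiv_cst//.
  by apply/funext => z; rewrite big_nil.
rewrite big_cons -IH -pderivD//; last by apply: smooth_at_sum => j _; exact: sF.
by congr (pderiv x v); apply/funext => z; rewrite big_cons.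
Qed.

Lemma pderiv_linear f x a v w : smooth_at f x ->
  pderiv x (a *: v + w) f = a * pderiv x v f + pderiv x w f.
Proof.
move=> /smooth_at_diff df.
by rewrite /pderiv (deriveE (a *: v + w) df) linearP -(deriveE v df) -(deriveE w df).
Qed.

Lemma pderivDv f x v w : smooth_at f x ->
  pderiv x (v + w) f = pderiv x v f + pderiv x w f.
Proof. by move=> sf; rewrite -[v]scale1r pderiv_linear// mul1r scale1r. Qed.

Lemma pderiv0v f x : pderiv x 0 f = 0.
Proof. by rewrite /pderiv derive0. Qed.

Lemma pderivZv f x a v : smooth_at f x -> pderiv x (a *: v) f = a * pderiv x v f.
Proof. by move=> sf; rewrite -[_ *: v]addr0 pderiv_linear// pderiv0v addr0. Qed.

Lemma pderiv_sumv (I : Type) (s : seq I) (F : I -> 'rV[R]_n) f x : smooth_at f x ->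
  pderiv x (\sum_(i <- s) F i) f = \sum_(i <- s) pderiv x (F i) f.
Proof.
move=> sf; elim: s => [|i s IH]; first by rewrite !big_nil pderiv0v.
by rewrite !big_cons pderivDv// IH.
Qed.

(** Chain rule through the transition from [mchart x] to [mchart z], whose Jacobian is
    [tangent_triv z x]. The chart [mchart x] need not vary smoothly with [x], so the smoothness of a
    derivative has to be examined in one fixed chart [z]. *)
Lemma pderiv_chart f z x v : mdom z x -> smooth_at f x ->
  pderiv x v f = 'D_(v *m tangent_triv z x) (f \o mparam z) (mchart z x).
Proof.
move=> zx sf; rewrite /pderiv.
have nb : nbhs x (mdom z) by exact: nbhs_mdom.
have [U [oU Ux UP]] := chart_nbhs (mdom_mem x) nb.
have dt := transition_differentiable (mdom_mem x) zx.
have E : (mchart z \o mparam x) (mchart x x) = mchart z x.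
  by rewrite /= (mchartK (mdom_mem x)).
rewrite (@near_eq_derive _ _ _ _ ((f \o mparam z) \o (mchart z \o mparam x))).
  rewrite derive_comp//; last by rewrite E; exact: smooth_at_differentiable.
  by rewrite E (deriveEjacobian _ dt).
have : nbhs (mchart x x) U by exact: open_nbhs_nbhs.
by apply: filterS => u /UP[y [xy zy] ->] /=; rewrite (mchartK xy) (mchartK zy).
Qed.

Lemma smooth_at_vderiv (X : M -> 'rV[R]_n) f z x : mdom z x ->
  smooth_at (fun y => X y *m tangent_triv z y) x -> smooth_at f x ->
  smooth_at (vderiv X f) x.
Proof.
move=> zx sX sf.
pose g y := \sum_i (X y *m tangent_triv z y) 0 i *
   'D_(delta_mx 0 i) (f \o mparam z) (mchart z y).
apply: (@smooth_at_ext _ _ _ _ g).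
  near=> y.
  have zy : mdom z y by near: y; exact: nbhs_mdom.
  have sy : smooth_at f y by near: y; exact: smooth_at_near.
  rewrite -[RHS]/(pderiv y (X y) f) (pderiv_chart _ zy sy) /g.
  have df := smooth_at_differentiable zy sy.
  move: (X y *m _) => v.
  rewrite (deriveE _ df) [X in _ = 'd _ _ X]matrix_sum_delta big_ord1 linear_sum.
  by apply: eq_bigr => i _; rewrite linearZ/= -deriveE.
apply: smooth_at_sum => i _; apply: smooth_atM.
  by move/smooth_at_mxP : sX; apply.
have [U [oU UD Ux sU]] := (smooth_atP f zx).1 sf.
exists z, U; split => // k.
apply: (@Ck_on_ext _ _ _ _ _ ('D_(delta_mx 0 i) (f \o mparam z))) => //.
  by move=> u /UD[w zw <-] /=; rewrite (mchartK zw).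
exact: (sU k.+1).2.
Unshelve. all: by end_near.
Qed.

End pderiv.

(** The last clause is the form in which the support is used: the product of [chi] with anything
    smooth on [N] is smooth everywhere, at each point either because the point lies in [N] or
    because the product vanishes nearby. *)
Lemma bump_function (R : realType) (n : nat) (M : manifold R n) (p : M) (N : set M) :
  nbhs p N -> exists chi : M -> R, [/\ smooth_fun chi,
    \forall z \near p, chi z = 1 &
    forall z, N z \/ \forall w \near z, chi w = 0].
Proof.
rewrite nbhsE => -[N' [oN' N'p] N'N].
have pp := mdom_mem p.
have oU : open (mchart p @` (mdom p `&` N')) by exact: chart_image_open.
have nU : nbhs (mchart p p) (mchart p @` (mdom p `&` N')).
  by apply: open_nbhs_nbhs; split => //; exists p.
have [b [K [cK KU sb b1 b0]]] := bump_rV nU.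
pose K' := mparam p @` K.
have K'N z : K' z -> mdom p z /\ N' z.
  by move=> [u Ku <-]; have [w [pw N'w] <-] := KU _ Ku; rewrite (mchartK pw).
(* The manifold is Hausdorff, so the compact set [K'] is closed, and a function that is zero off
   [K'] vanishes near every point outside it. *)
have clK : closed K'.
  apply: compact_closed; first exact: m_hausdorff.
  apply: continuous_compact => //; apply: continuous_in_subspaceT => u.
  rewrite inE => /KU[w [pw _] <-]; exact: mparam_continuous.
(* Outside its domain [mchart p] takes arbitrary values, hence the explicit test of membership in
   [K']. *)
pose chi z := if `[< K' z >] then b (mchart p z) else 0.
have chiE z : mdom p z -> chi z = b (mchart p z).
  move=> pz; rewrite /chi; case: asboolP => // nK; rewrite b0 // => Kz.
  by apply: nK; exists (mchart p z) => //; rewrite (mchartK pz).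
have chi0 z : ~ K' z -> \forall w \near z, chi w = 0.
  move=> nK; have oC : open (~` K') by exact: closed_openC.
  have : nbhs z (~` K') by exact: open_nbhs_nbhs.
  by apply: filterS => w nKw; rewrite /chi; case: asboolP.
have schi z : mdom p z -> smooth_at chi z.
  move=> pz; exists p, (mchart p @` mdom p); split => //.
    exact: mimage_open.
  move=> k; apply: (@Ck_on_ext _ _ _ _ _ b); first exact: mimage_open.
    by move=> _ [w pw <-] /=; rewrite (mchartK pw) chiE.
  by apply: Ck_onS (sb k).
exists chi; split.
- move=> z; case: (pselect (K' z)) => [/K'N[pz _]|/chi0 z0]; first exact: schi.
  apply: (@smooth_at_ext _ _ _ _ (cst 0)); last exact: smooth_at_cst.
  by apply: filterS z0 => w ->.
- have [U [oU' Up UP]] : exists U, [/\ open U, U (mchart p p) & forall u, U u -> b u = 1].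
    move: b1; rewrite /prop_near1 nbhsE => -[U [oU' Up] UP].
    by exists U; split => // u /UP.
  have : nbhs p [set z | mdom p z /\ U (mchart p z)].
    apply: filterI; first exact: nbhs_mdom.
    have := mchart_continuous pp; apply; exact: open_nbhs_nbhs.
  by apply: filterS => z [pz /UP bz]; rewrite chiE.
- move=> z; case: (pselect (K' z)) => [/K'N[_ /N'N Nz]|/chi0]; [by left|by right].
Qed.

(** * Smooth sections and local frames *)

Section sections.
Context {R : realType} {n : nat} {M : manifold R n} {r : nat}.
Implicit Types (B : vbundle M r) (X Y : M -> 'rV[R]_r) (f : M -> R) (x y : M).

Definition section_at B X y := smooth_at (fun z => X z *m vtriv B y z) y.

Lemma nbhs_vdom B x y : vdom B x y -> nbhs y (vdom B x).
Proof. by move=> xy; apply: open_nbhs_nbhs; split => //; exact: vdom_open. Qed.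

Lemma section_atP B X x y : vdom B x y ->
  section_at B X y <-> smooth_at (fun z => X z *m vtriv B x z) y.
Proof.
have aux u v : vdom B u y -> vdom B v y ->
    smooth_at (fun z => X z *m vtriv B u z) y ->
    smooth_at (fun z => X z *m vtriv B v z) y.
  move=> uy vy sX.
  apply: smooth_at_ext (smooth_at_mulmx sX (vtransition_smooth uy vy)).
  near=> z; rewrite -mulmxA mulKVmx//; apply: vtriv_unit.
  by near: z; exact: nbhs_vdom.
by move=> xy; split; apply: aux => //; exact: vdom_mem.
Unshelve. all: by end_near.
Qed.

Lemma smooth_sectionP B X : smooth_section B X <-> forall y, section_at B X y.
Proof.
split=> [sX y|sX x y xy]; first by apply: sX; exact: vdom_mem.
exact/(section_atP _ xy).
Qed.

Lemma section_at_ext B X Y y : (\forall z \near y, X z = Y z) ->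
  section_at B X y -> section_at B Y y.
Proof. by move=> XY; apply: smooth_at_ext; apply: filterS XY => z ->. Qed.

Lemma section_atD B X Y y : section_at B X y -> section_at B Y y ->
  section_at B (fun z => X z + Y z) y.
Proof.
move=> /smooth_at_mxP sX /smooth_at_mxP sY; apply/smooth_at_mxP => i j.
apply: smooth_at_ext (smooth_atD (sX i j) (sY i j)).
by near=> z; rewrite mulmxDl [RHS]mxE.
Unshelve. all: by end_near.
Qed.

Lemma section_atZ B f X y : smooth_at f y -> section_at B X y ->
  section_at B (fun z => f z *: X z) y.
Proof.
move=> sf /smooth_at_mxP sX; apply/smooth_at_mxP => i j.
apply: smooth_at_ext (smooth_atM sf (sX i j)).
by near=> z; rewrite -scalemxAl [RHS]mxE.
Unshelve. all: by end_near.
Qed.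

Lemma section_at0 B y : section_at B (fun=> 0) y.
Proof.
apply/smooth_at_mxP => i j; apply: smooth_at_ext (smooth_at_cst 0 y).
by near=> z; rewrite mul0mx mxE.
Unshelve. all: by end_near.
Qed.

Lemma section_at_sum B (I : Type) (s : seq I) (F : I -> M -> 'rV[R]_r) y :
  (forall i, section_at B (F i) y) -> section_at B (fun z => \sum_(i <- s) F i z) y.
Proof.
move=> sF; elim: s => [|i s IH].
  by apply: section_at_ext (section_at0 B y); near=> z; rewrite big_nil.
apply: section_at_ext (section_atD (sF i) IH).
by near=> z; rewrite big_cons.
Unshelve. all: by end_near.
Qed.

Lemma smooth_sectionD B X Y : smooth_section B X -> smooth_section B Y ->
  smooth_section B (fun z => X z + Y z).
Proof. by move=> /smooth_sectionP sX /smooth_sectionP sY; apply/smooth_sectionP => y; exact: section_atD. Qed.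

Lemma smooth_sectionZ B f X : smooth_fun f -> smooth_section B X ->
  smooth_section B (fun z => f z *: X z).
Proof. by move=> sf /smooth_sectionP sX; apply/smooth_sectionP => y; exact: section_atZ. Qed.

Lemma smooth_fun_cst (c : R) : smooth_fun (cst c : M -> R).
Proof. by move=> y; exact: smooth_at_cst. Qed.

Lemma smooth_sectionN B X : smooth_section B X -> smooth_section B (fun z => - X z).
Proof.
move=> sX; rewrite (_ : (fun _ => _) = fun z => cst (-1) z *: X z).
  by apply: smooth_sectionZ => //; exact: smooth_fun_cst.
by apply/funext => z; rewrite scaleN1r.
Qed.

Lemma smooth_sectionB B X Y : smooth_section B X -> smooth_section B Y ->
  smooth_section B (fun z => X z - Y z).
Proof. by move=> sX sY; apply: smooth_sectionD => //; exact: smooth_sectionN. Qed.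

Lemma smooth_section0 B : smooth_section B (fun=> 0).
Proof. by apply/smooth_sectionP => y; exact: section_at0. Qed.

Lemma smooth_section_sum B (I : Type) (s : seq I) (F : I -> M -> 'rV[R]_r) :
  (forall i, smooth_section B (F i)) -> smooth_section B (fun z => \sum_(i <- s) F i z).
Proof.
move=> sF; apply/smooth_sectionP => y; apply: section_at_sum => i.
exact: (smooth_sectionP B (F i)).1 (sF i) y.
Qed.

Lemma dual_dualE B : vtriv (dual_bundle (dual_bundle B)) = vtriv B.
Proof.
apply/funext => x; apply/funext => y.
by rewrite /= /dual_triv /= /dual_triv !trmx_inv trmxK invmxK.
Qed.

Lemma smooth_section_dual2 B X :
  smooth_section (dual_bundle (dual_bundle B)) X <-> smooth_section B X.
Proof. by rewrite /smooth_section dual_dualE. Qed.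

(** The trivializations of a bundle and of its dual are inverse transposes of each other, so the
    pairing equals the dot product of the trivialized vectors, whose entries are smooth. *)
Lemma smooth_at_dotp B (a X : M -> 'rV[R]_r) y : section_at (dual_bundle B) a y ->
  section_at B X y -> smooth_at (fun z => dotp (a z) (X z)) y.
Proof.
move=> /smooth_at_mxP sa /smooth_at_mxP sX.
apply: (@smooth_at_ext _ _ _ _ (fun z => \sum_i
   (a z *m dual_triv B y z) 0 i * (X z *m vtriv B y z) 0 i)).
  near=> z; rewrite -dotpE /dotp trmx_mul mulmxA -(mulmxA (a z)) /dual_triv.
  rewrite -trmx_mul mulmxV ?trmx1 ?mulmx1//; apply: vtriv_unit.
  by near: z; apply: nbhs_vdom; exact: vdom_mem.
by apply: smooth_at_sum => i _; apply: smooth_atM.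
Unshelve. all: by end_near.
Qed.

Lemma smooth_dotp B (a X : M -> 'rV[R]_r) : smooth_section (dual_bundle B) a ->
  smooth_section B X -> smooth_fun (fun z => dotp (a z) (X z)).
Proof.
by move=> /smooth_sectionP sa /smooth_sectionP sX y; apply: (@smooth_at_dotp B).
Qed.

(** The sections are global, since brackets and forms accept nothing else, but they are dual bases
    only near [p]; duality is expressed by the two expansions that the proofs use. *)
Definition frame B (p : M) (e es : 'I_r -> M -> 'rV[R]_r) : Prop :=
  [/\ forall i, smooth_section B (e i),
      forall i, smooth_section (dual_bundle B) (es i),
      \forall z \near p, forall v, v = \sum_i dotp v (es i z) *: e i z &
      \forall z \near p, forall a, a = \sum_i dotp a (e i z) *: es i z].

(** The rows of the inverse trivialization and of the transposed trivialization are dual bases, and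
    both become constant once trivialized. A bump function extends them to global sections. *)
Lemma frame_exists B (p : M) : exists e es, frame B p e es.
Proof.
have Np : nbhs p (vdom B p) by apply: nbhs_vdom; exact: vdom_mem.
have [chi [schi chi1 chi0]] := bump_function Np.
have loc C (e : M -> 'rV[R]_r) (v : 'rV[R]_r) : vdom C p = vdom B p ->
    (forall z, vdom C p z -> e z *m vtriv C p z = v) ->
    smooth_section C (fun z => chi z *: e z).
  move=> CB ev; apply/smooth_sectionP => z; case: (chi0 z) => [|z0]; last first.
    apply: section_at_ext (section_at0 C z).
    by apply: filterS z0 => w ->; rewrite scale0r.
  rewrite -CB => pz; apply/(section_atP _ pz); apply/smooth_at_mxP => i j.
  apply: (@smooth_at_ext _ _ _ _ (fun w => chi w * cst (v i j) w)).
    near=> w; rewrite -scalemxAl ev ?mxE//.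
    by near: w; exact: nbhs_vdom.
  by apply: smooth_atM => //; exact: smooth_at_cst.
exists (fun i z => chi z *: row i (invmx (vtriv B p z))).
exists (fun i z => chi z *: row i (vtriv B p z)^T).
split.
- move=> i; apply: (@loc _ _ (row i 1%:M)) => // z pz.
  by rewrite -row_mul mulVmx// vtriv_unit.
- move=> i; apply: (@loc _ _ (row i 1%:M)) => // z pz.
  by rewrite -row_mul /= /dual_triv -trmx_mul mulVmx ?trmx1// vtriv_unit.
- near=> z => v.
  have c1 : chi z = 1 by near: z.
  have pz : vdom B p z by near: z.
  rewrite c1; under eq_bigr => i _ do rewrite !scale1r.
  rewrite -[LHS](mulmxK (vtriv_unit pz)) [LHS]mulmx_sum_row.
  apply: eq_bigr => i _; congr (_ *: _).
  by rewrite /dotp tr_row trmxK colE mulmxA -colE [RHS]mxE.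
- near=> z => a.
  have c1 : chi z = 1 by near: z.
  have pz : vdom B p z by near: z.
  rewrite c1; under eq_bigr => i _ do rewrite !scale1r.
  have uT : (vtriv B p z)^T \in unitmx by rewrite unitmx_tr vtriv_unit.
  rewrite -[LHS](mulmxKV uT) [LHS]mulmx_sum_row.
  apply: eq_bigr => i _; congr (_ *: _).
  by rewrite -trmx_inv /dotp tr_row colE mulmxA -colE [RHS]mxE.
Unshelve. all: by end_near.
Qed.

End sections.
Arguments smooth_section0 {R n M r} B.
Arguments smooth_fun_cst {R n M} c.

(** * Tensorial maps and forms of low degree *)

Section tensorial.
Context {R : realType} {n : nat} {M : manifold R n} {r : nat}.
Implicit Types (B : vbundle M r) (X Y Z : M -> 'rV[R]_r) (f : M -> R) (x y p : M).

Lemma frame_dual B p e es : frame B p e es -> frame (dual_bundle B) p es e.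
Proof. by move=> [se ses h1 h2]; split => // i; apply/smooth_section_dual2. Qed.

Lemma section_through B p v : exists X, smooth_section B X /\ X p = v.
Proof.
have [e [es [se ses h1 h2]]] := frame_exists B p.
exists (fun z => \sum_i cst (dotp v (es i p)) z *: e i z); split.
  apply: smooth_section_sum => i; apply: smooth_sectionZ => //.
  exact: smooth_fun_cst.
by have := nbhs_singleton h1 v.
Qed.

(** The coefficients of [a] in a local dual frame are pairings with global sections, hence smooth by
    assumption. *)
Lemma smooth_section_pairing B (a : M -> 'rV[R]_r) :
  (forall Z, smooth_section B Z -> smooth_fun (fun z => dotp (a z) (Z z))) ->
  smooth_section (dual_bundle B) a.
Proof.
move=> sa; apply/smooth_sectionP => p.
have [e [es [se ses h1 h2]]] := frame_exists B p.
apply: (@section_at_ext _ _ _ _ _ (fun z => \sum_i dotp (a z) (e i z) *: es i z)).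
  by apply: filterS h2 => z {}h2; rewrite -h2.
apply: section_at_sum => i; apply: section_atZ; first exact: sa.
exact: (smooth_sectionP (dual_bundle B) (es i)).1 (ses i) p.
Qed.

Definition tensorial B (T : (M -> 'rV[R]_r) -> M -> R) : Prop :=
  forall X Y f, smooth_section B X -> smooth_section B Y -> smooth_fun f ->
  T (fun x => f x *: X x + Y x) = (fun x => f x * T X x + T Y x).

Section tensorial_theory.
Variables (B : vbundle M r) (T : (M -> 'rV[R]_r) -> M -> R).
Hypothesis tT : tensorial B T.

Lemma tensorialD X Y : smooth_section B X -> smooth_section B Y ->
  T (fun x => X x + Y x) = (fun x => T X x + T Y x).
Proof.
move=> sX sY; have := tT sX sY (smooth_fun_cst 1).
rewrite (_ : (fun x => cst 1 x *: X x + Y x) = fun x => X x + Y x).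
  by move=> ->; apply/funext => x; rewrite mul1r.
by apply/funext => x; rewrite scale1r.
Qed.

Lemma tensorial0 : T (fun=> 0) = (fun=> 0).
Proof.
have s0 := smooth_section0 B.
have := tensorialD s0 s0; rewrite (_ : (fun x => _ + _) = fun=> 0).
  move=> /funeqP h; apply/funext => x; have := h x.
  by move=> /eqP; rewrite -subr_eq0 opprD addrA subrr add0r oppr_eq0 => /eqP.
by apply/funext => x; rewrite addr0.
Qed.

Lemma tensorialZ X f : smooth_section B X -> smooth_fun f ->
  T (fun x => f x *: X x) = (fun x => f x * T X x).
Proof.
move=> sX sf; have := tT sX (smooth_section0 B) sf.
rewrite (_ : (fun x => _ + _) = fun x => f x *: X x).
  by move=> ->; apply/funext => x; rewrite tensorial0 addr0.
by apply/funext => x; rewrite addr0.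
Qed.

Lemma tensorial_sum (I : Type) (s : seq I) (F : I -> M -> 'rV[R]_r) :
  (forall i, smooth_section B (F i)) ->
  T (fun x => \sum_(i <- s) F i x) = (fun x => \sum_(i <- s) T (F i) x).
Proof.
move=> sF; elim: s => [|i s IH].
  rewrite (_ : (fun _ => _) = fun=> 0); last by apply/funext => x; rewrite big_nil.
  by rewrite tensorial0; apply/funext => x; rewrite big_nil.
rewrite (_ : (fun _ => _) = fun x => F i x + \sum_(j <- s) F j x); last first.
  by apply/funext => x; rewrite big_cons.
rewrite tensorialD//; last exact: smooth_section_sum.
by rewrite IH; apply/funext => x; rewrite big_cons.
Qed.

(** The expansion of [X] holds only near [p], but after multiplication by a bump function it holds
    everywhere with smooth coefficients, and [T] can be applied. At [p] the bump function equals 1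
    and disappears. *)
Lemma tensorial_frame p e es X : frame B p e es -> smooth_section B X ->
  T X p = \sum_i dotp (X p) (es i p) * T (e i) p.
Proof.
move=> [se ses h1 _] sX.
have [chi [schi chi1 chi0]] := bump_function h1.
have c1 : chi p = 1 by exact: nbhs_singleton chi1.
have sd i : smooth_fun (fun z => dotp (X z) (es i z)).
  by rewrite (_ : (fun _ => _) = fun z => dotp (es i z) (X z));
    [exact: (smooth_dotp (ses i))|apply/funext => z; exact: dotpC].
have E : (fun z => chi z *: X z) =
    (fun z => \sum_i (chi z * dotp (X z) (es i z)) *: e i z).
  apply/funext => z; under eq_bigr => i _ do rewrite -scalerA.
  rewrite -scaler_sumr; case: (chi0 z) => [/(_ (X z)) <- //|/nbhs_singleton ->].
  by rewrite !scale0r.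
have := tensorialZ sX schi; rewrite E tensorial_sum => [/funeqP/(_ p)|i].
  rewrite c1 mul1r => <-; apply: eq_bigr => i _.
  rewrite tensorialZ//; last by move=> x; apply: smooth_atM; [exact: schi|exact: sd].
  by rewrite c1 mul1r.
by apply: smooth_sectionZ => // x; apply: smooth_atM; [exact: schi|exact: sd].
Qed.

Lemma tensorial_point p X Y : smooth_section B X -> smooth_section B Y ->
  X p = Y p -> T X p = T Y p.
Proof.
move=> sX sY XY; have [e [es fr]] := frame_exists B p.
by rewrite (tensorial_frame fr sX) (tensorial_frame fr sY) XY.
Qed.

(** The coefficients of [a] at [x] are the values of [T] on sections through the basis vectors of
    the fibre. The choice of these sections is immaterial because [T Z x] depends only on [Z x]. *)
Lemma tensorial_dual :
  (forall Z, smooth_section B Z -> smooth_fun (T Z)) ->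
  exists a, smooth_section (dual_bundle B) a /\
    forall Z, smooth_section B Z -> T Z = fun x => dotp (a x) (Z x).
Proof.
move=> sT.
have S x i := cid (section_through B x (delta_mx 0 i)).
have SE x i : smooth_section B (sval (S x i)) /\ sval (S x i) x = delta_mx 0 i.
  exact: (svalP (S x i)).
pose a x : 'rV[R]_r := \row_i T (sval (S x i)) x.
have TE Z : smooth_section B Z -> T Z = fun x => dotp (a x) (Z x).
  move=> sZ; apply/funext => x.
  have sS i : smooth_section B (fun z => cst (Z x 0 i) z *: sval (S x i) z).
    by apply: smooth_sectionZ; [exact: smooth_fun_cst|exact: (SE x i).1].
  rewrite (@tensorial_point x Z (fun z => \sum_i cst (Z x 0 i) z *: sval (S x i) z))//.
  - rewrite tensorial_sum// dotpE; apply: eq_bigr => i _.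
    rewrite tensorialZ; [|exact: (SE x i).1|exact: smooth_fun_cst].
    by rewrite mxE mulrC.
  - exact: smooth_section_sum.
  - rewrite [LHS]matrix_sum_delta big_ord1; apply: eq_bigr => i _.
    by rewrite (SE x i).2.
exists a; split => //; apply: smooth_section_pairing => Z sZ.
by rewrite -TE//; exact: sT.
Qed.

End tensorial_theory.

End tensorial.

(** * Forms of degree two *)

Section alt2.
Context {R : realType} {n : nat} {M : manifold R n} {r : nat}.
Implicit Types (B : vbundle M r) (X Y Z a b : M -> 'rV[R]_r) (f : M -> R).

Definition alt2 (T : (M -> 'rV[R]_r) -> (M -> 'rV[R]_r) -> M -> R) : altform M r :=
  fun Xs => if Xs is [:: X; Y] then T X Y else 0.

Lemma smooth_sections1 B X : smooth_sections B [:: X] <-> smooth_section B X.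
Proof. by split=> [/(_ 0%N)|sX [|i]//]; apply. Qed.

Lemma smooth_sections2 B X Y :
  smooth_sections B [:: X; Y] <-> smooth_section B X /\ smooth_section B Y.
Proof.
split=> [h|[sX sY] [|[|i]]//].
by split; [exact: (h 0%N)|exact: (h 1%N)].
Qed.

Lemma smooth_sections0 B : smooth_sections B [::].
Proof. by case. Qed.

Arguments smooth_sections0 : clear implicits.

Lemma is_form_alt2 B T :
  (forall X Y, smooth_section B X -> smooth_section B Y -> smooth_fun (T X Y)) ->
  (forall Y, smooth_section B Y -> tensorial B (T^~ Y)) ->
  (forall X, smooth_section B X -> tensorial B (T X)) ->
  (forall X, smooth_section B X -> T X X = 0) ->
  is_form B 2 (alt2 T).
Proof.
move=> sT Tl Tr TX; split.
- by move=> [|X [|Y [|]]].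
- move=> [|X [|Y [|Z Xs]]] sXs; try by move=> x; exact: smooth_at_cst.
  by have [sX sY] := (smooth_sections2 _ _ _).1 sXs; exact: sT.
- move=> [|Z [|W Xs]] [|V [|U Ys]]//= X Y f _ sXs sYs sX sY sf.
  + by rewrite (Tl V)//; apply/smooth_sections1.
  + by rewrite (Tr Z)//; apply/smooth_sections1.
- move=> [|V Xs] [|W Ys] [|U Zs] X //= _ _ _ sX; first exact: TX.
  all: try by case: Xs => [|? [|? ?]].
  all: by case: Ys.
Qed.

Variables (B : vbundle M r) (w : altform M r).
Hypothesis fw : is_form B 2 w.

Lemma form2_tensoriall Y : smooth_section B Y -> tensorial B (fun X => w [:: X; Y]).
Proof.
move=> sY X X' f sX sX' sf.
by apply: (form_linear fw (Xs := [::]) (Ys := [:: Y])) => //;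
  try exact: smooth_sections0; exact/smooth_sections1.
Qed.

Lemma form2_tensorialr X : smooth_section B X -> tensorial B (fun Y => w [:: X; Y]).
Proof.
move=> sX Y Y' f sY sY' sf.
by apply: (form_linear fw (Xs := [:: X]) (Ys := [::])) => //;
  try exact: smooth_sections0; exact/smooth_sections1.
Qed.

Lemma form2_alt X : smooth_section B X -> w [:: X; X] = 0.
Proof.
move=> sX; apply: (form_alternating fw (Xs := [::]) (Ys := [::]) (Zs := [::])) => //;
  exact: smooth_sections0.
Qed.

Lemma form2_anti X Y : smooth_section B X -> smooth_section B Y ->
  w [:: X; Y] = - w [:: Y; X].
Proof.
move=> sX sY; have sXY := smooth_sectionD sX sY.
have := form2_alt sXY; rewrite (tensorialD (form2_tensoriall sXY) sX sY).
rewrite (tensorialD (form2_tensorialr sX) sX sY) (tensorialD (form2_tensorialr sY) sX sY).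
rewrite !form2_alt// => /funeqP h; apply/funext => x; have := h x.
rewrite !fctE add0r addr0 => /eqP.
by rewrite addr_eq0 => /eqP.
Qed.

Lemma form2_smooth X Y : smooth_section B X -> smooth_section B Y ->
  smooth_fun (w [:: X; Y]).
Proof. by move=> sX sY; apply: (form_smooth fw); apply/smooth_sections2. Qed.

(** Tensoriality in each slot makes the value at [p] depend on the arguments at [p] alone. This
    later allows time-dependent or non-exact arguments to be exchanged for simpler ones. *)
Lemma form2_point p X Y X' Y' : smooth_section B X -> smooth_section B Y ->
  smooth_section B X' -> smooth_section B Y' -> X p = X' p -> Y p = Y' p ->
  w [:: X; Y] p = w [:: X'; Y'] p.
Proof.
move=> sX sY sX' sY' XX YY.
rewrite (tensorial_point (form2_tensoriall sY) sX sX' XX).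
exact: (tensorial_point (form2_tensorialr sX') sY sY' YY).
Qed.

Lemma form2_ext w' : is_form B 2 w' ->
  (forall X Y, smooth_section B X -> smooth_section B Y -> w [:: X; Y] = w' [:: X; Y]) ->
  eq_form B w w'.
Proof.
move=> fw' ww [|X [|Y [|Z Xs]]] sXs; try by rewrite (form_degree fw)// (form_degree fw').
by have [sX sY] := (smooth_sections2 _ _ _).1 sXs; exact: ww.
Qed.

End alt2.

(** * Wedge products in low degree *)

Section wedge.
Context {R : realType} {n : nat} {M : manifold R n} {r : nat}.
Implicit Types (X Y Z a b : M -> 'rV[R]_r) (f : M -> R) (w : altform M r).

(** Peels off the first bit of a mask, so that the shuffles in a wedge product of low degree can be
    enumerated. *)
Lemma big_tuple_bool_rec (m : nat) (F : seq bool -> R) :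
  \sum_(t : m.+1.-tuple bool) F t =
  \sum_(t : m.-tuple bool) F (true :: t) + \sum_(t : m.-tuple bool) F (false :: t).
Proof.
rewrite (reindex (fun bt : bool * m.-tuple bool => [tuple of bt.1 :: bt.2])) /=.
  by rewrite -(pair_bigA _ (fun (c : bool) (t : m.-tuple bool) => F (c :: t))) big_bool.
exists (fun t => (thead t, [tuple of behead t])) => [[b t] _|t _] /=.
  by rewrite theadE; congr (_, _); apply/val_inj.
by case/tupleP: t => b t; apply/val_inj; rewrite /= theadE.
Qed.

Lemma big_tuple_bool0 (F : seq bool -> R) :
  \sum_(t : 0.-tuple bool) F t = F [::].
Proof.
rewrite (big_pred1 [tuple]) => [//|t].
by apply/esym/eqP; exact: tuple0.
Qed.

Lemma wedge0E f w : wedge (form0 f) w = fun Xs x => f x * w Xs x.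
Proof.
apply/funext => Xs; apply/funext => x; rewrite /wedge.
rewrite (bigD1 [tuple of nseq (size Xs) false])//= big1 ?addr0.
  rewrite map_nseq mask_true// mask_false /form0.
  rewrite (_ : shuffle_inv _ = 0%N) ?expr0 ?mul1r//.
  by rewrite /shuffle_inv big1// => j; rewrite nth_nseq; case: ifP.
move=> t tn; have : has id t.
  apply: contraR tn => /hasPn tF; apply/eqP/val_inj => /=.
  apply: (@eq_from_nth _ false); first by rewrite size_tuple size_nseq.
  move=> i; rewrite size_tuple => iS; rewrite nth_nseq iS.
  by apply/negbTE/tF/mem_nth; rewrite size_tuple.
rewrite has_count => ct.
have : size (mask t Xs) != 0%N by rewrite size_mask ?size_tuple// -lt0n.
by case: (mask t Xs) => //= *; rewrite mul0r mulr0.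
Qed.

(** Of the four masks of length two only those with exactly one bit set survive, with zero and one
    inversion respectively. For any other number of arguments some factor receives a list of the
    wrong length. *)
Lemma wedge11E a b : wedge (form1 a) (form1 b) =
  alt2 (fun X Y x => dotp (a x) (X x) * dotp (b x) (Y x) -
                     dotp (a x) (Y x) * dotp (b x) (X x)).
Proof.
apply/funext => Xs; apply/funext => x; rewrite /wedge.
have [S2|S2] := eqVneq (size Xs) 2; last first.
  rewrite big1.
    by case: Xs S2 => [|X [|Y [|]]].
  move=> t _.
  have : (size (mask t Xs) + size (mask (map negb t) Xs) = size Xs)%N.
    rewrite !size_mask ?size_map ?size_tuple// -[RHS](size_tuple t).
    rewrite -(count_predC id t); congr (_ + _)%N.
    by rewrite count_map.
  move=> ST.
  case: (mask t Xs) ST => [|V [|? ?]] /=; rewrite ?mul0r ?mulr0//.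
  case: (mask _ Xs) => [|U [|? ?]] /= ST; rewrite ?mulr0//.
  by rewrite -ST in S2.
case: Xs S2 => [|X [|Y [|]]]// _.
rewrite /alt2 (big_tuple_bool_rec 1 (fun m => (-1) ^+ shuffle_inv m *
  (form1 a (mask m [:: X; Y]) x * form1 b (mask [seq ~~ i | i <- m] [:: X; Y]) x))).
rewrite (big_tuple_bool_rec 0 (fun m => (-1) ^+ shuffle_inv (true :: m) *
  (form1 a (mask (true :: m) [:: X; Y]) x * form1 b (mask [seq ~~ i | i <- true :: m] [:: X; Y]) x))).
rewrite (big_tuple_bool_rec 0 (fun m => (-1) ^+ shuffle_inv (false :: m) *
  (form1 a (mask (false :: m) [:: X; Y]) x * form1 b (mask [seq ~~ i | i <- false :: m] [:: X; Y]) x))).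
rewrite (big_tuple_bool0 (fun m => (-1) ^+ shuffle_inv (true :: true :: m) *
  (form1 a (mask (true :: true :: m) [:: X; Y]) x * form1 b (mask [seq ~~ i | i <- true :: true :: m] [:: X; Y]) x))).
rewrite (big_tuple_bool0 (fun m => (-1) ^+ shuffle_inv (true :: false :: m) *
  (form1 a (mask (true :: false :: m) [:: X; Y]) x * form1 b (mask [seq ~~ i | i <- true :: false :: m] [:: X; Y]) x))).
rewrite (big_tuple_bool0 (fun m => (-1) ^+ shuffle_inv (false :: true :: m) *
  (form1 a (mask (false :: true :: m) [:: X; Y]) x * form1 b (mask [seq ~~ i | i <- false :: true :: m] [:: X; Y]) x))).
rewrite (big_tuple_bool0 (fun m => (-1) ^+ shuffle_inv (false :: false :: m) *
  (form1 a (mask (false :: false :: m) [:: X; Y]) x * form1 b (mask [seq ~~ i | i <- false :: false :: m] [:: X; Y]) x))).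
have -> : shuffle_inv [:: true; false] = 0%N.
  by rewrite /shuffle_inv big_mkcond /= !big_ord_recl big_ord0.
have -> : shuffle_inv [:: false; true] = 1%N.
  by rewrite /shuffle_inv big_mkcond /= !big_ord_recl big_ord0.
by rewrite /= mul0r mulr0 !mulr0 expr0 expr1 mul1r mulN1r add0r addr0.
Qed.

End wedge.

(** * Lie algebroids and Schouten brackets *)

Section lie_algebroid_theory.
Context {R : realType} {n : nat} {M : manifold R n} {r : nat}.
Variables (A : vbundle M r) (L : algebroid M r).
Hypothesis hL : is_lie_algebroid A L.
Implicit Types (X Y Z a b : M -> 'rV[R]_r) (f g : M -> R) (x y p : M).

Local Notation br := (bracket L).
Local Notation rho X := (vderiv (sanchor L X)).
Local Notation sec := (smooth_section A).
Local Notation dsec := (smooth_section (dual_bundle A)).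

Lemma anchor0 x : anchor L x 0 = 0.
Proof.
have := la_anchor_linear hL x 1 0 0.
by rewrite scaler0 add0r scale1r => /eqP; rewrite -subr_eq0 opprD addrA subrr add0r oppr_eq0 => /eqP.
Qed.

Lemma anchorD x (u v : 'rV[R]_r) : anchor L x (u + v) = anchor L x u + anchor L x v.
Proof. by rewrite -[u]scale1r (la_anchor_linear hL) !scale1r. Qed.

Lemma anchorZ x c (u : 'rV[R]_r) : anchor L x (c *: u) = c *: anchor L x u.
Proof. by rewrite -[c *: u]addr0 (la_anchor_linear hL) anchor0 addr0. Qed.

Lemma anchor_sum x (I : Type) (s : seq I) (F : I -> 'rV[R]_r) :
  anchor L x (\sum_(i <- s) F i) = \sum_(i <- s) anchor L x (F i).
Proof.
by elim: s => [|i s IH]; rewrite ?big_nil ?anchor0// !big_cons anchorD IH.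
Qed.

Lemma smooth_rho X f : sec X -> smooth_fun f -> smooth_fun (rho X f).
Proof.
move=> sX sf y; apply: (@smooth_at_vderiv _ _ _ _ _ y) => //.
  exact: mdom_mem.
have := la_anchor_smooth hL sX; apply; exact: mdom_mem.
Qed.

Lemma bracketDl X Y Z : sec X -> sec Y -> sec Z ->
  (br (fun x => X x + Y x) Z) = (fun x => br X Z x + br Y Z x).
Proof. by move=> sX sY sZ; have := la_linear hL 1 sX sY sZ; rewrite !scale1r. Qed.

Lemma bracketC X Y x : sec X -> sec Y -> br X Y x = - br Y X x.
Proof. by move=> sX sY; rewrite (la_antisym hL). Qed.

Lemma bracketDr X Y Z : sec X -> sec Y -> sec Z ->
  (br Z (fun x => X x + Y x)) = (fun x => br Z X x + br Z Y x).
Proof.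
move=> sX sY sZ; apply/funext => x.
rewrite bracketC//; last exact: smooth_sectionD.
by rewrite bracketDl// opprD -!bracketC.
Qed.

Lemma bracket0l Z : sec Z -> (br (fun=> 0) Z) = fun=> 0.
Proof.
move=> sZ; have s0 := smooth_section0 A.
have := bracketDl s0 s0 sZ; rewrite (_ : (fun x => _ + _) = fun=> 0).
  move=> /funeqP h; apply/funext => x; have := h x.
  by move=> /eqP; rewrite -subr_eq0 opprD addrA subrr add0r oppr_eq0 => /eqP.
by apply/funext => x; rewrite addr0.
Qed.

Lemma bracketZr X Y f x : sec X -> sec Y -> smooth_fun f ->
  br X (fun z => f z *: Y z) x = f x *: br X Y x + rho X f x *: Y x.
Proof. by move=> sX sY sf; rewrite (la_leibniz hL). Qed.

Lemma bracketZl X Y f x : sec X -> sec Y -> smooth_fun f ->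
  br (fun z => f z *: X z) Y x = f x *: br X Y x - rho Y f x *: X x.
Proof.
move=> sX sY sf; rewrite bracketC//; last exact: smooth_sectionZ.
by rewrite bracketZr// opprD -scalerN -bracketC.
Qed.

Lemma bracketNr X Y x : sec X -> sec Y -> br X (fun z => - Y z) x = - br X Y x.
Proof.
move=> sX sY; have := bracketDr sY (smooth_sectionN sY) sX.
rewrite (_ : (fun x => _ + _) = fun=> 0); last by apply/funext => z; rewrite subrr.
move=> /funeqP/(_ x); rewrite bracketC ?bracket0l//; last exact: smooth_section0.
by rewrite oppr0 => /esym/eqP; rewrite addrC addr_eq0 => /eqP.
Qed.

Lemma bracketBr X Y Z x : sec X -> sec Y -> sec Z ->
  br Z (fun x => X x - Y x) x = br Z X x - br Z Y x.
Proof.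
move=> sX sY sZ; rewrite bracketDr//; last exact: smooth_sectionN.
by rewrite bracketNr.
Qed.

Lemma bracket_suml (I : Type) (s : seq I) (F : I -> M -> 'rV[R]_r) Z x :
  (forall i, sec (F i)) -> sec Z ->
  br (fun x => \sum_(i <- s) F i x) Z x = \sum_(i <- s) (br (F i) Z) x.
Proof.
move=> sF sZ; elim: s => [|i s IH].
  rewrite (_ : (fun _ => _) = fun=> 0); last by apply/funext => z; rewrite big_nil.
  by rewrite bracket0l// big_nil.
rewrite (_ : (fun _ => _) = fun x => F i x + \sum_(j <- s) F j x); last first.
  by apply/funext => z; rewrite big_cons.
by rewrite bracketDl// ?IH ?big_cons//; exact: smooth_section_sum.
Qed.

(** A bump function [chi] makes [chi X] and [chi X'] equal everywhere. Expanding both brackets by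
    the Leibniz rule at [p], the terms that differentiate [chi] agree because [X p = X' p], and the
    others give the claim. *)
Lemma bracket_locall X X' Y p : sec X -> sec X' -> sec Y ->
  (\forall z \near p, X z = X' z) -> br X Y p = (br X' Y) p.
Proof.
move=> sX sX' sY XX.
have [chi [schi chi1 chi0]] := bump_function XX.
have c1 : chi p = 1 by exact: nbhs_singleton chi1.
have XXp : X p = X' p by exact: nbhs_singleton XX.
have E : (fun z => chi z *: X z) = (fun z => chi z *: X' z).
  apply/funext => z; case: (chi0 z) => [->//|/nbhs_singleton ->].
  by rewrite !scale0r.
have := bracketZl p sX sY schi; rewrite E (bracketZl p sX' sY schi) c1 !scale1r XXp.
by move=> /addIr.
Qed.

Lemma bracket_localr X X' Y p : sec X -> sec X' -> sec Y ->
  (\forall z \near p, X z = X' z) -> br Y X p = br Y X' p.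
Proof.
move=> sX sX' sY XX; rewrite bracketC// (bracket_locall sX sX' sY XX).
by rewrite -bracketC.
Qed.

Lemma smooth_dotpr a X : dsec a -> sec X -> smooth_fun (fun z => dotp (a z) (X z)).
Proof. exact: smooth_dotp. Qed.

(** Cartan's formula for the differential of the 1-form [a] on two sections. *)
Definition dform1 a X Y x : R :=
  rho X (fun z => dotp (a z) (Y z)) x - rho Y (fun z => dotp (a z) (X z)) x
  - dotp (a x) (br X Y x).

Lemma dform_form1E a : dform L (form1 a) = alt2 (dform1 a).
Proof.
have v0 (V : M -> 'rV[R]_n) x : vderiv V (0 : M -> R) x = 0 by exact: pderiv_cst.
apply/funext => Xs; apply/funext => x; rewrite /dform.
case: Xs => [|X [|Y [|Z Xs]]].
- by rewrite !big_ord0 addr0.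
- by rewrite !big_ord_recl !big_ord0 /= v0 mulr0 !addr0.
- rewrite /= !big_ord_recl !big_ord0 /= /rem_at /= /bump /=.
  by rewrite !addn0 !add0n !add0r !addr0 expr0 expr1 mul1r !mulN1r.
- rewrite !big1 ?addr0// => [j _|i _].
    rewrite big1// => i _; rewrite /rem_at.
    case E : (_ ++ _) => [|V Vs]; last by rewrite /= mulr0.
    move: E => /(congr1 size) /eqP; rewrite size_cat size_take size_drop /=.
    rewrite size_cat size_take size_drop /=; case: j i => j jS [i ij] /=.
    move: jS ij => /=; move: (size Xs) => s jS ij.
    by case: ifP; case: ifP; lia.
  rewrite (_ : form1 a _ = 0) ?v0 ?mulr0// /rem_at.
  case E : (_ ++ _) => [|V [|W Vs]] //.
  move: E => /(congr1 size) /eqP; rewrite size_cat size_take size_drop /=.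
  by case: i => i /=; move: (size Xs) => s iS; case: ifP; lia.
Qed.

Lemma dform1_tensorialr a X : dsec a -> sec X -> tensorial A (dform1 a X).
Proof.
move=> sa sX Y Y' f sY sY' sf; apply/funext => x; rewrite /dform1.
have s1 := smooth_dotpr sa sY; have s2 := smooth_dotpr sa sY'.
have s3 := smooth_dotpr sa sX.
have sfY := smooth_sectionZ sf sY.
rewrite (bracketDr sfY sY' sX) bracketZr// !dotpDr !dotpZr.
rewrite (_ : (fun z => dotp (a z) (f z *: Y z + Y' z)) =
  fun z => f z * dotp (a z) (Y z) + dotp (a z) (Y' z)); last first.
  by apply/funext => z; rewrite dotpDr dotpZr.
rewrite -![vderiv (sanchor L X) _ x]/(pderiv x (anchor L x (X x)) _).
rewrite pderivD//; last by apply: smooth_atM.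
rewrite pderivM// -![vderiv _ _ x]/(pderiv x _ _).
rewrite /sanchor anchorD anchorZ pderivDv// pderivZv//.
ring.
Qed.

Lemma dform1_anti a X Y x : sec X -> sec Y -> dform1 a X Y x = - dform1 a Y X x.
Proof. by move=> sX sY; rewrite /dform1 bracketC// dotpNr; ring. Qed.

Lemma dform1_smooth a X Y : dsec a -> sec X -> sec Y -> smooth_fun (dform1 a X Y).
Proof.
move=> sa sX sY x; apply: smooth_atB; first apply: smooth_atB.
- by apply: smooth_rho => //; exact: smooth_dotpr.
- by apply: smooth_rho => //; exact: smooth_dotpr.
- by apply: smooth_dotpr => //; exact: (la_closed hL).
Qed.

Lemma dform_form1_is_form a : dsec a -> is_form A 2 (dform L (form1 a)).
Proof.
move=> sa; rewrite dform_form1E; apply: is_form_alt2.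
- by move=> X Y; exact: dform1_smooth.
- move=> Y sY X X' f sX sX' sf; apply/funext => x.
  rewrite dform1_anti//; last by apply: smooth_sectionD => //; exact: smooth_sectionZ.
  rewrite (dform1_tensorialr sa sY)// (dform1_anti a x sX sY) (dform1_anti a x sX' sY).
  ring.
- by move=> X; exact: dform1_tensorialr.
- move=> X sX; apply/funext => x; have := dform1_anti a x sX sX.
  by move=> /eqP; rewrite -addr_eq0 -mulr2n mulrn_eq0 => /eqP.
Qed.

(** The right-hand side is function-linear in [Z]: the derivative of a coefficient produced by the
    product rule cancels the one produced by the Leibniz rule. It is therefore the pairing with a
    smooth section, the Lie derivative of [a] along [X]. *)
Lemma lie_derivative_exists X a : sec X -> dsec a -> exists la, dsec la /\
  forall Z, sec Z -> forall x, dotp (la x) (Z x) =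
    rho X (fun z => dotp (a z) (Z z)) x - dotp (a x) (br X Z x).
Proof.
move=> sX sa.
pose T Z x := rho X (fun z => dotp (a z) (Z z)) x - dotp (a x) (br X Z x).
have tT : tensorial A T.
  move=> Y Y' f sY sY' sf; apply/funext => x; rewrite /T.
  have s1 := smooth_dotpr sa sY; have s2 := smooth_dotpr sa sY'.
  have sfY := smooth_sectionZ sf sY.
  rewrite (bracketDr sfY sY' sX) bracketZr// !dotpDr !dotpZr.
  rewrite (_ : (fun z => dotp (a z) (f z *: Y z + Y' z)) =
    fun z => f z * dotp (a z) (Y z) + dotp (a z) (Y' z)); last first.
    by apply/funext => z; rewrite dotpDr dotpZr.
  rewrite -![vderiv (sanchor L X) _ x]/(pderiv x (anchor L x (X x)) _).
  rewrite pderivD//; last by apply: smooth_atM.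
  by rewrite pderivM//; ring.
have [|la [sla laE]] := tensorial_dual tT.
  move=> Z sZ x; apply: smooth_atB.
    by apply: smooth_rho => //; exact: smooth_dotpr.
  by apply: smooth_dotpr => //; exact: (la_closed hL).
by exists la; split => // Z sZ x; rewrite -[RHS]/(T Z x) laE.
Qed.

End lie_algebroid_theory.

(** * Closure properties of forms *)

Section form_ops.
Context {R : realType} {n : nat} {M : manifold R n} {r : nat}.
Implicit Types (B : vbundle M r) (X Y a b : M -> 'rV[R]_r) (f : M -> R) (v w : altform M r).

Lemma smooth_sections_cons B X Xs :
  smooth_sections B (X :: Xs) <-> smooth_section B X /\ smooth_sections B Xs.
Proof.
split=> [h|[sX sXs] [|i]//]; last exact: sXs.
by split=> [|i]; [exact: (h 0%N)|exact: (h i.+1)].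
Qed.

Lemma smooth_sections_mask B (m : seq bool) Xs :
  smooth_sections B Xs -> smooth_sections B (mask m Xs).
Proof.
elim: m Xs => [|c m IH] [|X Xs] //=; try by move=> _; exact: smooth_sections0.
move=> /smooth_sections_cons[sX /IH sXs]; case: c => //.
exact/smooth_sections_cons.
Qed.

Lemma wedge_ext B v v' w w' : eq_form B v v' -> eq_form B w w' ->
  eq_form B (wedge v w) (wedge v' w').
Proof.
move=> vv ww Xs sXs; apply/funext => x; rewrite /wedge; apply: eq_bigr => t _.
by rewrite vv ?ww//; exact: smooth_sections_mask.
Qed.

Lemma is_form_form0 B f : smooth_fun f -> is_form B 0 (form0 f).
Proof.
move=> sf; split => //.
- by case.
- by move=> [|X Xs] _ //= x; exact: smooth_at_cst.
- by move=> [|X Xs] [|Y Ys].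
Qed.

Lemma is_form_form1 B a : smooth_section (dual_bundle B) a -> is_form B 1 (form1 a).
Proof.
move=> sa; split.
- by move=> [|X [|Y Xs]].
- move=> [|X [|Y Xs]] sXs; try by move=> x; exact: smooth_at_cst.
  by have [sX _] := (smooth_sections_cons _ _ _).1 sXs; exact: (smooth_dotp sa sX).
- move=> [|Z Xs] [|Y Ys] // X Y f _ _ _ sX sY sf; apply/funext => x /=.
  by rewrite dotpDr dotpZr.
- by move=> [|V [|? ?]] [|W Ys].
Qed.

Lemma is_formZ B k f w : smooth_fun f -> is_form B k w ->
  is_form B k (wedge (form0 f) w).
Proof.
rewrite wedge0E => sf fw; split.
- by move=> Xs sX; rewrite (form_degree fw sX); apply/funext => x; rewrite mulr0.
- by move=> Xs sXs x; apply: smooth_atM; [exact: sf|exact: (form_smooth fw sXs)].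
- move=> Xs Ys X Y g sk sXs sYs sX sY sg; apply/funext => x.
  by rewrite (form_linear fw)// mulrDr mulrCA.
- move=> Xs Ys Zs X sXs sYs sZs sX; apply/funext => x.
  by rewrite (form_alternating fw)// mulr0.
Qed.

Lemma is_formD B k v w : is_form B k v -> is_form B k w -> is_form B k (v + w).
Proof.
move=> fv fw; split.
- by move=> Xs sX; apply/funext => x; rewrite !fctE (form_degree fv sX) (form_degree fw sX); exact: addr0.
- by move=> Xs sXs x; apply: smooth_atD; [exact: (form_smooth fv sXs)|exact: (form_smooth fw sXs)].
- move=> Xs Ys X Y g sk sXs sYs sX sY sg; apply/funext => x.
  by rewrite !fctE (form_linear fw)// (form_linear fv)// mulrDr addrACA.
- move=> Xs Ys Zs X sXs sYs sZs sX.
  by apply/funext => x; rewrite !fctE (form_alternating fw)// (form_alternating fv)//; exact: addr0.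
Qed.

Lemma is_form0 B k : is_form B k (0 : altform M r).
Proof.
split => //; first by move=> Xs _ x; exact: smooth_at_cst.
by move=> *; apply/funext => x; rewrite /= mulr0; exact/esym/addr0.
Qed.

Lemma is_formN B k w : is_form B k w -> is_form B k (- w).
Proof.
move=> /(is_formZ (smooth_fun_cst (-1))); rewrite wedge0E.
suff -> : (fun Xs x => cst (-1) x * w Xs x) = - w by [].
by apply/funext => Xs; apply/funext => x; rewrite mulN1r.
Qed.

Lemma is_form_wedge11 B a b : smooth_section (dual_bundle B) a ->
  smooth_section (dual_bundle B) b -> is_form B 2 (wedge (form1 a) (form1 b)).
Proof.
move=> sa sb; rewrite wedge11E; apply: is_form_alt2.
- move=> X Y sX sY x; apply: smooth_atB; apply: smooth_atM;
    apply: (smooth_dotp (B := B)) => //.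
- move=> Y sY X X' f sX sX' sf; apply/funext => x; rewrite !dotpDr !dotpZr; ring.
- move=> X sX Y Y' f sY sY' sf; apply/funext => x; rewrite !dotpDr !dotpZr; ring.
- by move=> X sX; apply/funext => x; rewrite mulrC subrr.
Qed.

End form_ops.

(** * The Schouten bracket of a section with a bivector *)

Section schouten.
Context {R : realType} {n : nat} {M : manifold R n} {r : nat}.
Variables (A : vbundle M r) (L : algebroid M r).
Variable S : nat -> nat -> altform M r -> altform M r -> altform M r.
Hypothesis hS : is_schouten A L S.
Implicit Types (X Y Z a b : M -> 'rV[R]_r) (f g : M -> R) (x y p : M) (P : altform M r).

Local Notation rho X := (vderiv (sanchor L X)).
Local Notation sec := (smooth_section A).
Local Notation dsec := (smooth_section (dual_bundle A)).
Local Notation multi := (multisection A).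

Lemma multi_form1 X : sec X -> multi 1 (form1 X).
Proof. by move=> sX; apply: is_form_form1; apply/smooth_section_dual2. Qed.

Lemma multi_wedge11 X Y : sec X -> sec Y -> multi 2 (wedge (form1 X) (form1 Y)).
Proof. by move=> sX sY; apply: is_form_wedge11; apply/smooth_section_dual2. Qed.

Lemma eq_multi_at P Q a b x : eq_multisection A P Q -> dsec a -> dsec b ->
  P [:: a; b] x = Q [:: a; b] x.
Proof. by move=> PQ sa sb; rewrite PQ//; apply/smooth_sections2. Qed.

Section fix_X.
Variables (X a b la lb : M -> 'rV[R]_r) (p : M).
Hypotheses (sX : sec X) (sa : dsec a) (sb : dsec b) (sla : dsec la) (slb : dsec lb).
Hypothesis laE : forall Z, sec Z -> forall x, dotp (la x) (Z x) =
  rho X (fun z => dotp (a z) (Z z)) x - dotp (a x) (bracket L X Z x).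
Hypothesis lbE : forall Z, sec Z -> forall x, dotp (lb x) (Z x) =
  rho X (fun z => dotp (b z) (Z z)) x - dotp (b x) (bracket L X Z x).

(** The error in the expected formula for [[X, P](a, b)] at [p]. It is additive and function-linear
    in [P] and vanishes on products of two sections; bivectors are locally combinations of such
    products, so it vanishes identically. *)
Let defect P : R := S 1 2 (form1 X) P [:: a; b] p -
  (rho X (P [:: a; b]) p - P [:: la; b] p - P [:: a; lb] p).

Let defect_ext P Q : multi 2 P -> multi 2 Q -> eq_multisection A P Q ->
  defect P = defect Q.
Proof.
move=> mP mQ PQ; rewrite /defect !(PQ [:: _; _])//; try by apply/smooth_sections2.
have mX := multi_form1 sX.
by rewrite (eq_multi_at p (sch_ext hS mX mX mP mQ _ PQ) sa sb).
Qed.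

Let defectD P Q : multi 2 P -> multi 2 Q -> defect (P + Q) = defect P + defect Q.
Proof.
move=> mP mQ; have mX := multi_form1 sX.
(* Linearity is an axiom in the first slot only. In degrees 1 and 2 graded symmetry has sign
   [(-1) ^+ 2], so the arguments may be exchanged freely. *)
have sym P' : multi 2 P' ->
    S 1 2 (form1 X) P' [:: a; b] p = S 2 1 P' (form1 X) [:: a; b] p.
  move=> mP'; rewrite (eq_multi_at p (sch_sym hS mX mP') sa sb).
  by rewrite (_ : (1 * 2)%N = 2%N)// sqrrN expr1n scale1r.
rewrite /defect !sym//; last exact: is_formD.
have := eq_multi_at p (sch_linear hS 1 mP mQ mX) sa sb.
rewrite !scale1r => ->.
rewrite -![vderiv _ _ p]/(pderiv p _ _) pderivD; first by rewrite !fctE; ring.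
- exact: (form2_smooth mP sa sb).
- exact: (form2_smooth mQ sa sb).
Qed.

Let defect0 : defect 0 = 0.
Proof.
have := defectD (is_form0 _ 2) (is_form0 _ 2); rewrite addr0.
by move=> /eqP; rewrite -subr_eq0 opprD addrA subrr add0r oppr_eq0 => /eqP.
Qed.

(** The wedge axiom produces the extra term [rho(X)(f) P], which is the one that the product rule
    gives for the derivative of [f P(a, b)] along [rho(X)]. *)
Let defectZ f P : smooth_fun f -> multi 2 P ->
  defect (wedge (form0 f) P) = f p * defect P.
Proof.
move=> sf mP; have mX := multi_form1 sX.
have mf := is_form_form0 (dual_bundle A) sf.
rewrite /defect (eq_multi_at p (sch_wedge hS (k'' := 2) mX mf mP) sa sb).
have e1 : eq_multisection A (S 1 0 (form1 X) (form0 f)) (form0 (rho X f)).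
  exact: sch_sec_fun.
have e2 : eq_multisection A P P by [].
rewrite mul0n expr0 scale1r !fctE.
rewrite (eq_multi_at p (wedge_ext e1 e2) sa sb) !wedge0E.
rewrite -![vderiv _ _ p]/(pderiv p _ _) pderivM//; first by ring.
exact: (form2_smooth mP sa sb).
Qed.

(** The properties of [la] and [lb] convert the pairings with [[X, Y]] and [[X, Z]] into derivatives
    of pairings; what remains is the product rule for a two-by-two determinant. *)
Let defect_wedge Y Z : sec Y -> sec Z -> defect (wedge (form1 Y) (form1 Z)) = 0.
Proof.
move=> sY sZ; have mX := multi_form1 sX.
have mY := multi_form1 sY; have mZ := multi_form1 sZ.
rewrite /defect (eq_multi_at p (sch_wedge hS (k' := 1) (k'' := 1) mX mY mZ) sa sb).
have eY : eq_multisection A (S 1 1 (form1 X) (form1 Y)) (form1 (bracket L X Y)).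
  exact: sch_sec_sec.
have eZ : eq_multisection A (S 1 1 (form1 X) (form1 Z)) (form1 (bracket L X Z)).
  exact: sch_sec_sec.
have eY' : eq_multisection A (form1 Y) (form1 Y) by [].
have eZ' : eq_multisection A (form1 Z) (form1 Z) by [].
rewrite (_ : (1 * (1 + 1))%N = 2%N)// sqrrN expr1n scale1r !fctE.
rewrite (eq_multi_at p (wedge_ext eY eZ') sa sb) (eq_multi_at p (wedge_ext eY' eZ) sa sb).
rewrite !wedge11E /alt2 -![vderiv _ _ p]/(pderiv p _ _).
have s1 := smooth_dotp sa sY; have s2 := smooth_dotp sa sZ.
have s3 := smooth_dotp sb sY; have s4 := smooth_dotp sb sZ.
have sw c d : dsec c -> sec d -> (fun x => dotp (d x) (c x)) = (fun x => dotp (c x) (d x)).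
  by move=> *; apply/funext => x; rewrite dotpC.
rewrite (_ : (fun x => _ - _) = fun x => dotp (a x) (Y x) * dotp (b x) (Z x) -
  dotp (b x) (Y x) * dotp (a x) (Z x)); last first.
  by apply/funext => x; rewrite !(dotpC (Y x)) !(dotpC (Z x)).
rewrite pderivB; [|by apply: smooth_atM|by apply: smooth_atM].
rewrite !pderivM//.
rewrite !(dotpC (Y p)) !(dotpC (Z p)) !(dotpC (bracket _ _ _ p)) !laE// !lbE//.
rewrite -![vderiv _ _ p]/(pderiv p _ _).
ring.
Qed.

Lemma schouten_sec2 P : multi 2 P -> S 1 2 (form1 X) P [:: a; b] p =
  rho X (P [:: a; b]) p - P [:: la; b] p - P [:: a; lb] p.
Proof.
move=> mP; apply/eqP; rewrite -subr_eq0; apply/eqP; rewrite -[LHS]/(defect P).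
have [e [es fr]] := frame_exists A p; have [se ses h1 h2] := fr.
(* The bump function is taken on the set of points around which the frame is still a frame, so that
   [P] can be expanded at every point where [chi] does not vanish locally. *)
have Np : \forall z \near p, frame A z e es.
  have h1' := near_join h1; have h2' := near_join h2.
  by near=> z; split => //; near: z.
have [chi [schi chi1 chi0]] := bump_function Np.
have c1 : chi p = 1 by exact: nbhs_singleton chi1.
(* The division by 2 compensates for summing over all ordered pairs: [P = 1/2 \sum_(i, j) P(es_i,
   es_j) e_i /\ e_j]. *)
pose c i j : M -> R := fun x => chi x * (P [:: es i; es j] x / 2).
have sc i j : smooth_fun (c i j).
  move=> x; apply: smooth_atM; first exact: schi.
  by apply: smooth_atM; [exact: (form2_smooth mP (ses i) (ses j))|exact: smooth_at_cst].
pose Q i j := wedge (form0 (c i j)) (wedge (form1 (e i)) (form1 (e j))).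
have mQ i j : multi 2 (Q i j) by apply: is_formZ => //; exact: multi_wedge11.
have multi_sum (I : Type) (s : seq I) (F : I -> altform M r) :
    (forall i, multi 2 (F i)) -> multi 2 (\sum_(i <- s) F i).
  by move=> mF; elim/big_ind : _ => // [|v w]; [exact: is_form0|exact: is_formD].
have dsum (I : Type) (s : seq I) (F : I -> altform M r) :
    (forall i, multi 2 (F i)) -> (forall i, defect (F i) = 0) ->
    defect (\sum_(i <- s) F i) = 0.
  move=> mF dF; elim: s => [|i s IH]; first by rewrite big_nil defect0.
  by rewrite big_cons defectD ?dF ?IH ?addr0//; exact: multi_sum.
have mS : multi 2 (\sum_i \sum_j Q i j) by apply: (multi_sum _ _ (fun i => \sum_j Q i j)) => i; exact: (multi_sum _ _ (Q i) (mQ i)).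
have mchi : multi 2 (wedge (form0 chi) P) by exact: is_formZ.
(* Since [chi p = 1], function-linearity of the defect replaces [P] by [chi P], which is globally a
   combination of wedge products. *)
rewrite -[LHS]mul1r -c1 -defectZ// (defect_ext mchi mS).
  apply: (dsum _ _ (fun i => \sum_j Q i j)) => [i|i]; first exact: (multi_sum _ _ (Q i) (mQ i)).
  apply: (dsum _ _ (Q i)) => // j; rewrite defectZ//; last exact: multi_wedge11.
  by rewrite defect_wedge// mulr0.
apply: (form2_ext mchi mS) => u v su sv; apply/funext => x.
rewrite wedge0E !fct_sumE; under eq_bigr do rewrite !fct_sumE.
rewrite /Q; under eq_bigr do under eq_bigr do rewrite wedge0E wedge11E /alt2 /c.
case: (chi0 x) => [frx|/nbhs_singleton ->]; last first.
  by rewrite mul0r big1// => i _; rewrite big1// => j _; rewrite !mul0r.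
have frx' := frame_dual frx.
have PE u' v' : dsec u' -> dsec v' -> P [:: u'; v'] x =
    \sum_i \sum_j dotp (u' x) (e i x) * dotp (v' x) (e j x) * P [:: es i; es j] x.
  move=> su' sv'; rewrite (tensorial_frame (form2_tensoriall mP sv') frx' su').
  apply: eq_bigr => i _.
  rewrite (tensorial_frame (form2_tensorialr mP (ses i)) frx' sv') mulr_sumr.
  by apply: eq_bigr => j _; rewrite mulrA.
have half : P [:: u; v] x = (P [:: u; v] x - P [:: v; u] x) / 2.
  by rewrite (form2_anti mP sv su) !fctE opprK; move: (P [:: u; v] x) => t; lra.
rewrite half !PE// -sumrB mulr_suml mulr_sumr; apply: eq_bigr => i _.
rewrite -sumrB mulr_suml mulr_sumr; apply: eq_bigr => j _.
rewrite !(dotpC (e _ x)); ring.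
Unshelve. all: by end_near.
Qed.

End fix_X.

End schouten.

(** * Time-dependent sections *)

Section time_calculus.
Context {R : realType} {n : nat} {M : manifold R n}.
Let MR := time_manifold M.
Implicit Types (f g : MR -> R) (p q : MR) (x : M) (t s : R).

Definition slice (W : Type) t (f : MR -> W) : M -> W := fun y => f (y, t).

Definition dt (W : normedModType R) (f : MR -> W) : MR -> W :=
  fun p => derive1 (fun s : R => f (p.1, s)) p.2.

Lemma smooth_at_slice (f : MR -> R) x t : smooth_at f (x, t) ->
  smooth_at (slice t f) x.
Proof.
have xx : mdom x x by exact: mdom_mem.
have pp : @mdom _ _ MR (x, t) (x, t) by exact: mdom_mem.
move=> /(smooth_atP _ pp)[U [oU UD Uy sU]].
pose V := (fun u : 'rV[R]_n => row_mx u t%:M) @^-1` U.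
have kr k (W : set 'rV[R]_n) : open W ->
    Ck_on k W (fun u : 'rV[R]_n => row_mx u (t%:M : 'rV[R]_1)).
  move=> oW; apply: Ck_on_row_mx => //; last exact: (Ck_on_cst k W (t%:M : 'rV[R]_1)).
  by apply: (@Ck_on_linear _ _ _ _ _ idfun) => ?.
have oV : open V.
  apply: open_comp => // u _.
  exact: (kr 0%N setT openT u).
exists x, V; split => // k.
rewrite (_ : slice t f \o mparam x =
  (f \o @mparam _ _ MR (x, t)) \o (fun u : 'rV[R]_n => row_mx u t%:M)).
  by apply: (@Ck_on_comp _ _ _ _ V U) => //; exact: kr.
apply/funext => u; rewrite /= /time_param /slice row_mxKl row_mxKr.
by rewrite mxE eqxx mulr1n.
Qed.

Lemma smooth_at_time (h : R -> R) p : smooth_on setT h ->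
  smooth_at (fun q : MR => h q.2) p.
Proof.
move=> sh; apply: smooth_at_comp_real => //.
exists p, setT; split => //; [exact: mdom_mem|exact: openT|] => k.
rewrite (_ : _ \o _ = fun u : 'rV[R]_(n + 1) => u 0 (rshift n 0)).
  apply: (Ck_on_entry (f := id)); first exact: openT.
  by apply: (@Ck_on_linear _ _ _ _ _ idfun) => ?.
by apply/funext => u; rewrite /= /time_param /= mxE.
Qed.

Lemma row_mx_dt (h : R) (u : 'rV[R]_n) (s : R) :
  h *: row_mx 0 1%:M + row_mx u s%:M = row_mx u (h + s)%:M :> 'rV[R]_(n + 1).
Proof. by rewrite scale_row_mx scaler0 add_row_mx add0r scale_scalar_mx mulr1 raddfD. Qed.

Lemma line_row_mx (u : 'rV[R]_n) (s : R) :
  row_mx u 0 + s *: row_mx 0 1%:M = row_mx u s%:M :> 'rV[R]_(n + 1).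
Proof. by rewrite scale_row_mx add_row_mx scaler0 addr0 add0r scale_scalar_mx mulr1. Qed.

Lemma derive_row_mx_dt (W : normedModType R) (F : 'rV[R]_(n + 1) -> W) u s :
  'D_(row_mx 0 1%:M) F (row_mx u s%:M) = 'D_1 (fun s' : R => F (row_mx u s'%:M)) s.
Proof.
rewrite /derive /=; under eq_fun do rewrite row_mx_dt.
by under [in RHS]eq_fun do rewrite [_%:A]mulr1.
Qed.

Lemma derive_row_mxl (W : normedModType R) (F : 'rV[R]_(n + 1) -> W) (u v : 'rV[R]_n) s :
  'D_(row_mx v 0) F (row_mx u s%:M) = 'D_v (fun u' : 'rV[R]_n => F (row_mx u' s%:M)) u.
Proof.
rewrite /derive /=.
by under eq_fun do rewrite scale_row_mx scaler0 add_row_mx add0r.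
Qed.

(* [f] read in the chart of the product at [(x, t)], which does not depend on [t]. *)
Definition time_rep (W : Type) x (f : MR -> W) (w : 'rV[R]_(n + 1)) : W :=
  f (mparam x (lsubmx w), rsubmx w 0 0).

Lemma time_repE (W : Type) p (f : MR -> W) : f \o mparam p = time_rep p.1 f.
Proof. by []. Qed.

Lemma time_chartE p q : mchart p q = row_mx (mchart p.1 q.1) q.2%:M.
Proof. by []. Qed.

Lemma time_rep_row_mx (W : Type) x (f : MR -> W) u s :
  time_rep x f (row_mx u s%:M) = f (mparam x u, s).
Proof. by rewrite /time_rep row_mxKl row_mxKr mxE eqxx mulr1n. Qed.

Lemma pderiv_timeE p v f :
  pderiv p v f = 'D_v (time_rep p.1 f) (row_mx (mchart p.1 p.1) p.2%:M).
Proof. by []. Qed.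

Lemma row_mx_hsub (w : 'rV[R]_(n + 1)) : w = row_mx (lsubmx w) (rsubmx w 0 0)%:M.
Proof. by rewrite rV1_scalar hsubmxK. Qed.

Lemma time_rep_dt (W : normedModType R) x (f : MR -> W) :
  time_rep x (dt f) = 'D_(row_mx 0 1%:M) (time_rep x f).
Proof.
apply/funext => w; rewrite (row_mx_hsub w); move: (lsubmx w) (rsubmx w 0 0) => u t.
rewrite derive_row_mx_dt time_rep_row_mx.
have -> : (fun s => time_rep x f (row_mx u s%:M)) = (fun s => f (mparam x u, s)).
  by apply/funext => s; rewrite time_rep_row_mx.
exact: derive1E.
Qed.

Lemma time_rep_pderiv x f v s :
  pderiv x v (slice s f) = 'D_(row_mx v 0) (time_rep x f) (row_mx (mchart x x) s%:M).
Proof.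
rewrite derive_row_mxl /pderiv.
have -> : (fun u => time_rep x f (row_mx u s%:M)) = slice s f \o mparam x.
  by apply/funext => u; rewrite time_rep_row_mx.
by [].
Qed.

Lemma smooth_at_dt (W : normedModType R) (f : MR -> W) p : smooth_at f p -> smooth_at (dt f) p.
Proof.
move=> [x [U [xy oU Uy sU]]]; exists x, U; split => // k.
by rewrite time_repE time_rep_dt; exact: (sU k.+1).2.
Qed.

Lemma smooth_at_derivable_time f x t : smooth_at f (x, t) ->
  derivable (fun s : R => f (x, s)) t 1.
Proof.
move=> /smooth_at_diff; rewrite time_repE time_chartE /= => df.
have -> : (fun s : R => f (x, s)) =
    (fun s : R => time_rep x f (row_mx (mchart x x) 0 + s *: row_mx 0 1%:M)).
  by apply/funext => s; rewrite line_row_mx time_rep_row_mx (mchartK (mdom_mem x)).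
rewrite -line_row_mx in df; exact: (@ex_derive _ _ _ _ _ _ _ (is_derive_line df)).
Qed.

Lemma pderiv_time f x t v (c : R) : smooth_at f (x, t) ->
  @pderiv _ _ MR (x, t) (row_mx v c%:M) f = pderiv x v (slice t f) + c * dt f (x, t).
Proof.
move=> sf; have -> : row_mx v c%:M = row_mx v 0 + c *: row_mx 0 1%:M :> 'rV[R]_(n + 1).
  by rewrite line_row_mx.
rewrite pderivDv// pderivZv// time_rep_pderiv pderiv_timeE /=; congr (_ + _ * _).
have <- : time_rep x (dt f) (row_mx (mchart x x) t%:M) = dt f (x, t).
  by rewrite time_rep_row_mx (mchartK (mdom_mem x)).
by rewrite time_rep_dt pderiv_timeE.
Qed.

(** In the product chart both derivatives are partial derivatives of one smooth function, so this is
    the symmetry of its second derivatives. *)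
Lemma derive1_pderiv f x t v : smooth_at f (x, t) ->
  is_derive t 1 (fun s => pderiv x v (slice s f)) (pderiv x v (slice t (dt f))).
Proof.
move=> sf; have pp : @mdom _ _ MR (x, t) (x, t) by exact: mdom_mem.
move/(smooth_atP _ pp) : (sf) => [U [oU _]]; rewrite time_repE time_chartE /= => Uy sU.
rewrite time_rep_pderiv time_rep_dt (schwarz _ _ oU Uy (sU 2%N)).
have dG : differentiable ('D_(row_mx v 0) (time_rep x f)) (row_mx (mchart x x) t%:M).
  exact: ((sU 2%N).2 (row_mx v 0)).1.
have -> : (fun s => pderiv x v (slice s f)) =
    (fun s => 'D_(row_mx v 0) (time_rep x f) (row_mx (mchart x x) 0 + s *: row_mx 0 1%:M)).
  by apply/funext => s; rewrite time_rep_pderiv line_row_mx.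
by rewrite -line_row_mx in dG *; exact: (is_derive_line dG).
Qed.

(** The transition maps of the product are [(u, s) |-> (g u, s)] with [g] a transition map of [M],
    so their Jacobians are block diagonal with last block 1. *)
Lemma tangent_triv_time p q v (c : R) : mdom p q ->
  row_mx v c%:M *m @tangent_triv _ _ MR p q = row_mx (v *m tangent_triv p.1 q.1) c%:M.
Proof.
move=> pq; rewrite /tangent_triv.
have dG : differentiable (mchart p \o mparam q) (@mchart _ _ MR q q).
  by apply: transition_differentiable => //; exact: mdom_mem.
have dg : differentiable (mchart p.1 \o mparam q.1) (mchart q.1 q.1).
  by apply: transition_differentiable => //; exact: mdom_mem.
rewrite -(deriveEjacobian _ dG) -(deriveEjacobian _ dg).
have -> : row_mx v c%:M = row_mx v 0 + c *: row_mx 0 1%:M :> 'rV[R]_(n + 1).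
  by rewrite line_row_mx.
rewrite (deriveE _ dG) linearD linearZ /= -!deriveE//.
set G := _ \o _; have GE u s : G (row_mx u s%:M) = row_mx ((mchart p.1 \o mparam q.1) u) s%:M.
  by rewrite /G /= /time_param /time_chart /= row_mxKl row_mxKr mxE eqxx mulr1n.
rewrite /time_chart derive_row_mx_dt derive_row_mxl.
have -> : 'D_1 (fun s' : R => G (row_mx (mchart q.1 q.1) s'%:M)) q.2 = row_mx 0 1%:M.
  rewrite (_ : (fun s' : R => _) = fun s' : R =>
     row_mx ((mchart p.1 \o mparam q.1) (mchart q.1 q.1)) 0 + s' *: row_mx 0 1%:M); last first.
    apply/funext => s; rewrite GE.
    by rewrite line_row_mx.
  set c0 := row_mx _ 0; set w := row_mx 0 1%:M.
  have di : differentiable (id : 'rV[R]_(n + 1) -> _) (c0 + q.2 *: w) by [].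
  apply: etrans (@derive_val _ _ _ _ _ _ _ (is_derive_line di)) _.
  exact: derive_id.
have -> : 'D_v (fun u' : 'rV[R]_n => G (row_mx u' q.2%:M)) (mchart q.1 q.1) =
    row_mx ('D_v (mchart p.1 \o mparam q.1) (mchart q.1 q.1)) 0.
  rewrite (_ : (fun u' : 'rV[R]_n => _) =
    (mulmxr (row_mx 1%:M 0) \o (mchart p.1 \o mparam q.1)) + cst (row_mx 0 q.2%:M)); last first.
    apply/funext => u; rewrite GE !fctE /= mul_mx_row mulmx1 mulmx0 add_row_mx addr0 add0r.
    by [].
  have dl : differentiable (mulmxr (row_mx 1%:M 0) : 'rV[R]_n -> 'rV[R]_(n + 1))
      ((mchart p.1 \o mparam q.1) (mchart q.1 q.1)).
    by apply: linear_differentiable; exact: mulmxr_continuous.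
  rewrite deriveD; [|apply/diff_derivable/differentiable_comp => //|exact: derivable_cst].
  rewrite derive_cst addr0 derive_comp// deriveE// diff_lin; last exact: mulmxr_continuous.
  by rewrite /= mul_mx_row mulmx1 mulmx0.
by rewrite line_row_mx.
Qed.

End time_calculus.

(** * Derivatives of curves of row vectors *)

Section derive_linear.
Context {R : realType}.

Lemma is_derive_mulmxr m k (g : R -> 'rV[R]_m) dg (t : R) (B : 'M[R]_(m, k)) :
  is_derive t 1 g dg -> is_derive t 1 (fun s : R => g s *m B) (dg *m B).
Proof.
move=> [/derivable1_diffP dif <-].
have dl : differentiable (mulmxr B : 'rV[R]_m -> 'rV[R]_k) (g t).
  by apply: linear_differentiable; exact: mulmxr_continuous.
apply: DeriveDef; first exact/derivable1_diffP/(differentiable_comp dif dl).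
rewrite (derive_comp (f := mulmxr B) _ dif dl) deriveE// diff_lin//.
exact: mulmxr_continuous.
Qed.

Lemma is_derive_dotp m (g : R -> 'rV[R]_m) dg (t : R) (a : 'rV[R]_m) :
  is_derive t 1 g dg -> is_derive t 1 (fun s : R => dotp a (g s)) (dotp a dg).
Proof.
move=> /(is_derive_mulmxr a^T)[d1 d2].
have E v : dotp a v = (v *m a^T) 0 0 by rewrite dotpC.
rewrite (_ : (fun s => _) = fun s => (g s *m a^T) 0 0); last first.
  by apply/funext => s; rewrite E.
rewrite E -d2 derive_mx// mxE; apply: derivableP.
exact: ((derivable_mxP _ _ _).1 d1).
Qed.

Lemma is_deriveZv (m : nat) (f : R -> R) df (t : R) (v : 'rV[R]_m) :
  is_derive t 1 f df -> is_derive t 1 (fun s : R => f s *: v) (df *: v).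
Proof.
move=> [/derivable1_diffP dif <-].
have dd : is_diff (f t) ( *:%R ^~ v : R -> _) ( *:%R ^~ v) by exact: is_diff_scalel.
have dl : differentiable ( *:%R ^~ v : R -> 'rV[R]_m) (f t) by exact: ex_diff.
apply: DeriveDef; first exact/derivable1_diffP/(differentiable_comp dif dl).
by rewrite (derive_comp _ dif dl) deriveE// diff_val.
Qed.

Lemma is_derive_scale (m : nat) (f : R -> R) (g : R -> 'rV[R]_m) df dg (t : R) :
  is_derive t 1 f df -> is_derive t 1 g dg ->
  is_derive t 1 (fun s : R => f s *: g s) (df *: g t + f t *: dg).
Proof.
move=> df' [dg' dgE].
have dj j : is_derive t 1 (fun s => g s 0 j) (dg 0 j).
  rewrite -dgE derive_mx// mxE; apply: derivableP.
  exact: ((derivable_mxP _ _ _).1 dg').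
have E : (fun s : R => f s *: g s) =
    \sum_j (fun s : R => (f s * g s 0 j) *: (delta_mx 0 j : 'rV[R]_m)).
  apply/funext => s; rewrite fct_sumE [g s in LHS]matrix_sum_delta big_ord1 scaler_sumr.
  by apply: eq_bigr => j _; rewrite scalerA.
rewrite E; apply: (is_derive_eq (is_derive_sum (fun j =>
  is_deriveZv (delta_mx 0 j) (is_deriveM df' (dj j))))).
rewrite [g t in RHS]matrix_sum_delta [dg in RHS]matrix_sum_delta !big_ord1 !scaler_sumr -big_split /=.
apply: eq_bigr => j _; rewrite !scalerA -scalerDl; congr (_ *: _).
by rewrite addrC; congr (_ + _); exact: mulrC.
Qed.

End derive_linear.

Lemma smooth_at_row_mx (R : realType) (n : nat) (M : manifold R n) (m k : nat)
    (F : M -> 'rV[R]_m) (G : M -> 'rV[R]_k) y :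
  smooth_at F y -> smooth_at G y -> smooth_at (fun x => row_mx (F x) (G x)) y.
Proof.
move=> /smooth_at_mxP sF /smooth_at_mxP sG; apply/smooth_at_mxP => i j.
case: (split_ordP j) => l ->.
  by apply: smooth_at_ext (sF i l); near=> z; rewrite row_mxEl.
by apply: smooth_at_ext (sG i l); near=> z; rewrite row_mxEr.
Unshelve. all: by end_near.
Qed.

(** * Slices and time derivatives of time-dependent sections *)

Section time_sections.
Context {R : realType} {n : nat} {M : manifold R n} {r : nat}.
Variable A : vbundle M r.
Let MR := time_manifold M.
Local Notation MA := (time_bundle A).
Implicit Types (X Y : MR -> 'rV[R]_r) (f g : MR -> R) (p q : MR) (x : M) (t s : R).

Lemma section_slice X t : smooth_section MA X -> smooth_section A (tslice t X).
Proof.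
move=> sX x y xy; apply/smooth_at_mxP => i j.
have /smooth_at_mxP/(_ i j) := sX (x, t) (y, t) xy.
exact: smooth_at_slice.
Qed.

Lemma section_fst (Y : M -> 'rV[R]_r) : smooth_section A Y ->
  smooth_section MA (fun q : MR => Y q.1).
Proof. by move=> sY p q pq; exact: (smooth_at_fst (sY _ _ pq)). Qed.

Lemma near_fst (P : M -> Prop) x t : (\forall y \near x, P y) ->
  \forall q \near ((x, t) : MR), P q.1.
Proof. by move=> nP; apply: (@cvg_fst M R (nbhs x) (nbhs t)). Qed.

Lemma frame_time x t e es : frame A x e es ->
  frame MA (x, t) (fun i (q : MR) => e i q.1) (fun i (q : MR) => es i q.1).
Proof.
move=> [se ses h1 h2]; split.
- by move=> i; exact: section_fst.
- by move=> i p q pq; exact: (smooth_at_fst (ses i _ _ pq)).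
- exact: (near_fst t h1).
- exact: (near_fst t h2).
Qed.

(** Smoothness is known only after trivialization. At a fixed [x] the trivialization is a constant
    invertible matrix, which can be undone after differentiating. *)
Lemma section_derive X x t : smooth_section MA X ->
  is_derive t 1 (fun s : R => X (x, s)) (tderiv X (x, t)).
Proof.
move=> sX; apply: DeriveDef; last by rewrite /tderiv derive1E.
have xx : vdom A x x by exact: vdom_mem.
have sT := sX ((x, t) : MR) (x, t) xx.
have dT : derivable (fun s : R => X (x, s) *m vtriv A x x) t 1.
  apply/derivable_mxP => i j.
  apply: (@smooth_at_derivable_time _ _ _ (fun q : MR => (X q *m vtriv A x q.1) i j)).
  by move/smooth_at_mxP : sT; apply.
have [+ _] := is_derive_mulmxr (invmx (vtriv A x x)) (derivableP dT).
rewrite (_ : (fun s => _) = fun s => X (x, s))//.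
by apply/funext => s; rewrite mulmxK ?vtriv_unit.
Qed.

Lemma tderiv_section X : smooth_section MA X -> smooth_section MA (tderiv X).
Proof.
move=> sX p q pq; have sT := smooth_at_dt (sX p q pq).
rewrite (_ : (fun z => _) = dt (fun z : MR => X z *m vtriv MA p z))//.
apply/funext => -[z s]; rewrite /dt derive1E; apply/esym.
exact: (@derive_val _ _ _ _ _ _ _ (is_derive_mulmxr (vtriv A p.1 z) (section_derive z s sX))).
Qed.

Lemma dt_dotp (a : M -> 'rV[R]_r) X p : smooth_section MA X ->
  dt (fun q : MR => dotp (a q.1) (X q)) p = dotp (a p.1) (tderiv X p).
Proof.
move=> sX; case: p => x t; rewrite /dt derive1E.
exact: (@derive_val _ _ _ _ _ _ _ (is_derive_dotp (a x) (section_derive x t sX))).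
Qed.

Lemma fun_derive f x t : smooth_fun f -> is_derive t 1 (fun s => f (x, s)) (dt f (x, t)).
Proof.
move=> sf; apply: DeriveDef; last by rewrite /dt derive1E.
exact: smooth_at_derivable_time.
Qed.

Lemma smooth_fun_fst (h : M -> R) : smooth_fun h -> smooth_fun (fun q : MR => h q.1).
Proof. by move=> sh p; exact: smooth_at_fst. Qed.

Lemma smooth_fun_slice f t : smooth_fun f -> smooth_fun (slice t f).
Proof. by move=> sf x; exact: smooth_at_slice. Qed.

Lemma smooth_fun_dt f : smooth_fun f -> smooth_fun (dt f).
Proof. by move=> sf p; exact: smooth_at_dt. Qed.

End time_sections.

(** * The slicewise bracket and its time derivative *)

Section time_bracket.
Context {R : realType} {n : nat} {M : manifold R n} {r : nat}.
Variables (A : vbundle M r) (L : algebroid M r).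
Hypothesis hL : is_lie_algebroid A L.
Let MR := time_manifold M.
Local Notation MA := (time_bundle A).
Local Notation tsec := (smooth_section MA).
Implicit Types (X Y : MR -> 'rV[R]_r) (f g : MR -> R) (p q : MR) (x : M) (t s : R).

Lemma anchor_mxE x : exists B, forall v, anchor L x v = v *m B.
Proof.
exists (\matrix_i anchor L x (delta_mx 0 i)) => v.
rewrite [in LHS](matrix_sum_delta v) big_ord1 (anchor_sum hL) mulmx_sum_row.
by apply: eq_bigr => i _; rewrite (anchorZ hL) rowK.
Qed.

Lemma is_derive_anchor x t (g : R -> 'rV[R]_r) dg :
  is_derive t 1 g dg -> is_derive t 1 (fun s => anchor L x (g s)) (anchor L x dg).
Proof.
have [B BE] := anchor_mxE x => dgg; rewrite BE.
rewrite (_ : (fun s => _) = fun s => g s *m B); last by apply/funext => s; rewrite BE.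
exact: is_derive_mulmxr.
Qed.

(** The anchor is known to be smooth on global sections of [A] only, so [X] is expanded in a
    time-independent frame and the anchor is applied to the frame. *)
Lemma anchor_time_smooth X y x t : tsec X -> mdom y x ->
  smooth_at (fun q : MR => anchor L q.1 (X q) *m tangent_triv y q.1) (x, t).
Proof.
move=> sX yx; have [e [es fr]] := frame_exists A x.
have [se ses h1 h2] := frame_time t fr; have [se' _ _ _] := fr.
apply: (@smooth_at_ext _ _ _ _ (fun q : MR => \sum_i dotp (es i q.1) (X q) *:
  (sanchor L (e i) q.1 *m tangent_triv y q.1))).
  apply: filterS h1 => q /(_ (X q)) h1.
  rewrite [in RHS]h1 (anchor_sum hL) mulmx_suml; apply: eq_bigr => i _.
  by rewrite (anchorZ hL) -scalemxAl dotpC.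
apply/smooth_at_mxP => i j.
apply: (@smooth_at_ext _ _ _ _ (fun q : MR => \sum_k dotp (es k q.1) (X q) *
  (sanchor L (e k) q.1 *m tangent_triv y q.1) i j)).
  by near=> q; rewrite summxE; apply: eq_bigr => k _; rewrite [RHS]mxE.
apply: smooth_at_sum => k _; apply: smooth_atM.
  exact: (smooth_dotp (ses k)).
apply: (@smooth_at_fst _ _ _ _ (fun z => (sanchor L (e k) z *m tangent_triv y z) i j) (x, t)).
have := la_anchor_smooth hL (se' k) yx.
by move/smooth_at_mxP; apply.
Unshelve. all: by end_near.
Qed.

(** The derivative along [rho(X)] within each time slice: the action of the bar anchor without its
    [d/dt] component. *)
Definition trho X g p : R := pderiv p.1 (anchor L p.1 (X p)) (slice p.2 g).

Lemma trho_smooth X g : tsec X -> smooth_fun g -> smooth_fun (trho X g).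
Proof.
move=> sX sg [x t].
pose V (q : MR) : 'rV[R]_(n + 1) := row_mx (anchor L q.1 (X q)) (0 : R)%:M.
rewrite (_ : trho X g = vderiv V g); last first.
  apply/funext => -[y s]; apply: etrans (esym (pderiv_time _ 0 (sg (y, s)))).
  by rewrite mul0r addr0.
apply: (@smooth_at_vderiv _ _ _ _ _ ((x, t) : MR)) => //; first exact: mdom_mem.
apply: (@smooth_at_ext _ _ _ _ (fun q : MR =>
   row_mx (anchor L q.1 (X q) *m tangent_triv x q.1) (0 : R)%:M)).
  near=> q; apply/esym; apply: tangent_triv_time.
  by near: q; apply: nbhs_mdom; exact: mdom_mem.
apply: smooth_at_row_mx.
  by apply: anchor_time_smooth => //; exact: mdom_mem.
apply/smooth_at_mxP => i j; exact: smooth_at_cst.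
Unshelve. all: by end_near.
Qed.

(** In coordinates [trho X g] is a sum of products of a coefficient of [rho(X)] with a partial
    derivative of the slice of [g]. The product rule applies, and [d/dt] commutes with the partial
    derivatives. *)
Lemma trho_derive X g x t : tsec X -> smooth_fun g ->
  is_derive t 1 (fun s => trho X g (x, s)) (trho (tderiv X) g (x, t) + trho X (dt g) (x, t)).
Proof.
move=> sX sg.
have pE (h : MR -> R) (v : 'rV[R]_n) s : smooth_fun h ->
    pderiv x v (slice s h) = \sum_k v 0 k * pderiv x (delta_mx 0 k) (slice s h).
  move=> sh; have shs : smooth_at (slice s h) x by exact: smooth_at_slice.
  rewrite [in LHS](matrix_sum_delta v) big_ord1 pderiv_sumv//.
  by apply: eq_bigr => k _; rewrite pderivZv.
have da := is_derive_anchor x (section_derive x t sX).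
have dk k : is_derive t 1 (fun s => (anchor L x (X (x, s))) 0 k) (anchor L x (tderiv X (x, t)) 0 k).
  have -> : (fun s => (anchor L x (X (x, s))) 0 k) =
      (fun s => dotp (delta_mx 0 k) (anchor L x (X (x, s)))).
    by apply/funext => s; rewrite dotpC dotp_delta.
  by rewrite -(dotp_delta _ k) dotpC; exact: is_derive_dotp.
have dp k := derive1_pderiv (delta_mx 0 k) (sg (x, t)).
rewrite (_ : (fun s => _) = \sum_k ((fun s => (anchor L x (X (x, s))) 0 k) *
  (fun s => pderiv x (delta_mx 0 k) (slice s g)))); last first.
  by apply/funext => s; rewrite fct_sumE /trho /= pE.
apply: (is_derive_eq (is_derive_sum (fun k => is_deriveM (dk k) (dp k)))).
have sdg := smooth_fun_dt sg.
rewrite /trho /= !pE//.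
rewrite -big_split /=; apply: eq_bigr => k _.
by rewrite addrC; congr (_ + _); exact: mulrC.
Qed.

Lemma dt_trho X g p : tsec X -> smooth_fun g ->
  dt (trho X g) p = trho (tderiv X) g p + trho X (dt g) p.
Proof.
case: p => x t sX sg; rewrite /dt derive1E.
exact: (@derive_val _ _ _ _ _ _ _ (trho_derive x t sX sg)).
Qed.

(** The coefficients of [X] in a time-independent frame carry all the time dependence, and the
    Leibniz rule moves them out of the bracket. One neighbourhood of [x0] serves for every [t]
    because the frame does not move; this is what permits differentiation in [t]. *)
Lemma bracket_slice_frame x0 e es X (Y0 : M -> 'rV[R]_r) : frame A x0 e es -> tsec X ->
  smooth_section A Y0 ->
  \forall x \near x0, forall t, bracket L (tslice t X) Y0 x =
    \sum_i (dotp (es i x) (X (x, t)) *: bracket L (e i) Y0 x -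
      pderiv x (anchor L x (Y0 x)) (slice t (fun q : MR => dotp (es i q.1) (X q))) *: e i x).
Proof.
move=> fr sX sY0; have [se ses h1 h2] := fr.
have nh1 := near_join h1.
near=> x => t.
have sXt := section_slice t sX.
have sf i : smooth_fun (fun y => dotp (es i y) (X (y, t))).
  exact: (smooth_dotp (ses i) sXt).
have sF i : smooth_section A (fun y => dotp (es i y) (X (y, t)) *: e i y).
  exact: smooth_sectionZ.
rewrite (@bracket_locall _ _ _ _ _ _ hL _ (fun y => \sum_i dotp (es i y) (X (y, t)) *: e i y))//.
- rewrite (bracket_suml hL)//; apply: eq_bigr => i _.
  by rewrite (bracketZl hL).
- exact: smooth_section_sum.
- have : \forall z \near x, forall v, v = \sum_i dotp v (es i z) *: e i z by near: x.
  apply: filterS => z /(_ (X (z, t))); rewrite /tslice => {1}->.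
  by apply: eq_bigr => i _; rewrite dotpC.
Unshelve. all: by end_near.
Qed.

Lemma bracket_slice_section X (Y0 : M -> 'rV[R]_r) : tsec X -> smooth_section A Y0 ->
  tsec (fun q : MR => bracket L (tslice q.2 X) Y0 q.1).
Proof.
move=> sX sY0; apply/smooth_sectionP => -[x0 t0].
have [e [es fr]] := frame_exists A x0; have [se ses _ _] := fr.
have [tse tses _ _] := frame_time t0 fr.
apply: (@section_at_ext _ _ _ _ _ (fun q : MR =>
  \sum_i (dotp (es i q.1) (X q) *: bracket L (e i) Y0 q.1 -
    trho (fun q => Y0 q.1) (fun q : MR => dotp (es i q.1) (X q)) q *: e i q.1))).
  have := near_fst t0 (bracket_slice_frame fr sX sY0).
  by apply: filterS => -[x t] /(_ t) /= ->.
apply: section_at_sum => i.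
have sf : smooth_fun (fun q : MR => dotp (es i q.1) (X q)) by exact: (smooth_dotp (tses i)).
apply: section_atD; first apply: section_atZ => //.
  apply: (smooth_sectionP _ _).1; apply: (@section_fst _ _ _ _ _ (bracket L (e i) Y0)).
  exact: (la_closed hL).
apply: (@section_at_ext _ _ _ _ _ (fun q : MR => (- trho (fun q => Y0 q.1)
    (fun q : MR => dotp (es i q.1) (X q)) q) *: e i q.1)).
  by near=> q; rewrite scaleNr.
apply: section_atZ; last exact: ((smooth_sectionP _ _).1 (tse i)).
by apply: smooth_atN; apply: trho_smooth => //; exact: section_fst.
Unshelve. all: by end_near.
Qed.

Lemma bracket_slice_derive X (Y0 : M -> 'rV[R]_r) p : tsec X -> smooth_section A Y0 ->
  tderiv (fun q : MR => bracket L (tslice q.2 X) Y0 q.1) p =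
  bracket L (tslice p.2 (tderiv X)) Y0 p.1.
Proof.
case: p => x t sX sY0 /=.
have [e [es fr]] := frame_exists A x; have [se ses _ _] := fr.
have [tse tses _ _] := frame_time t fr.
have E := nbhs_singleton (bracket_slice_frame fr sX sY0).
rewrite (nbhs_singleton (bracket_slice_frame fr (tderiv_section sX) sY0)).
rewrite /tderiv derive1E /= (_ : (fun s : R => _) = \sum_i ((fun s : R =>
    dotp (es i x) (X (x, s)) *: bracket L (e i) Y0 x) -
    (fun s : R => pderiv x (anchor L x (Y0 x))
       (slice s (fun q : MR => dotp (es i q.1) (X q))) *: e i x))); last first.
  by apply/funext => s; rewrite E fct_sumE.
apply: (@derive_val _ _ _ _ _ _ _ _).
apply: is_derive_sum => i; apply: is_deriveB; apply: is_deriveZv.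
  exact: (is_derive_dotp _ (section_derive x t sX)).
have sf : smooth_fun (fun q : MR => dotp (es i q.1) (X q)) by exact: (smooth_dotp (tses i)).
have -> : (fun q : MR => dotp (es i q.1) (tderiv X q)) = dt (fun q : MR => dotp (es i q.1) (X q)).
  by apply/funext => q; rewrite (dt_dotp _ _ sX).
exact: derive1_pderiv.
Qed.

(** Only [Y] is expanded: the brackets of [X] with a fixed section of the frame are covered by the
    previous lemmas. *)
Lemma tbracket_frame x0 e es X Y : frame A x0 e es -> tsec X -> tsec Y ->
  \forall x \near x0, forall t, tbracket L X Y (x, t) =
    \sum_i (dotp (es i x) (Y (x, t)) *: bracket L (tslice t X) (e i) x +
      trho X (fun q : MR => dotp (es i q.1) (Y q)) (x, t) *: e i x).
Proof.
move=> fr sX sY; have [se ses h1 h2] := fr.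
have nh1 := near_join h1.
near=> x => t.
have sXt := section_slice t sX; have sYt := section_slice t sY.
have sf i : smooth_fun (fun y => dotp (es i y) (Y (y, t))).
  exact: (smooth_dotp (ses i) sYt).
have sF i : smooth_section A (fun y => dotp (es i y) (Y (y, t)) *: e i y).
  exact: smooth_sectionZ.
rewrite /tbracket /= (@bracket_localr _ _ _ _ _ _ hL _ (fun y => \sum_i dotp (es i y) (Y (y, t)) *: e i y))//.
- rewrite (bracketC hL)//; last exact: smooth_section_sum.
  rewrite (bracket_suml hL)// -sumrN; apply: eq_bigr => i _.
  by rewrite -(bracketC hL)// (bracketZr hL).
- exact: smooth_section_sum.
- have : \forall z \near x, forall v, v = \sum_i dotp v (es i z) *: e i z by near: x.
  apply: filterS => z /(_ (Y (z, t))); rewrite /tslice => {1}->.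
  by apply: eq_bigr => i _; rewrite dotpC.
Unshelve. all: by end_near.
Qed.

Lemma tbracket_section X Y : tsec X -> tsec Y -> tsec (tbracket L X Y).
Proof.
move=> sX sY; apply/smooth_sectionP => -[x0 t0].
have [e [es fr]] := frame_exists A x0; have [se ses _ _] := fr.
have [tse tses _ _] := frame_time t0 fr.
apply: (@section_at_ext _ _ _ _ _ (fun q : MR =>
  \sum_i (dotp (es i q.1) (Y q) *: bracket L (tslice q.2 X) (e i) q.1 +
      trho X (fun q : MR => dotp (es i q.1) (Y q)) q *: e i q.1))).
  have := near_fst t0 (tbracket_frame fr sX sY).
  by apply: filterS => -[x t] /(_ t) /= ->.
apply: section_at_sum => i.
have sf : smooth_fun (fun q : MR => dotp (es i q.1) (Y q)) by exact: (smooth_dotp (tses i)).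
apply: section_atD; apply: section_atZ => //.
- exact: ((smooth_sectionP _ _).1 (bracket_slice_section sX (se i))).
- exact: trho_smooth.
- exact: ((smooth_sectionP _ _).1 (tse i)).
Qed.

(** Differentiating the expansion of the bracket term by term, the derivatives that fall on the
    coefficients of [Y] reassemble into the bracket with [dY/dt], and those that fall on [X] into
    the bracket of [dX/dt], by the same expansion. *)
Lemma tbracket_tderiv X Y p : tsec X -> tsec Y ->
  tderiv (tbracket L X Y) p = tbracket L (tderiv X) Y p + tbracket L X (tderiv Y) p.
Proof.
case: p => x t sX sY.
have [e [es fr]] := frame_exists A x; have [se ses _ _] := fr.
have [tse tses _ _] := frame_time t fr.
have E := nbhs_singleton (tbracket_frame fr sX sY).
rewrite (nbhs_singleton (tbracket_frame fr (tderiv_section sX) sY)).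
rewrite (nbhs_singleton (tbracket_frame fr sX (tderiv_section sY))).
have sf i : smooth_fun (fun q : MR => dotp (es i q.1) (Y q)) by exact: (smooth_dotp (tses i)).
rewrite {1}/tderiv derive1E (_ : (fun s : R => _) = \sum_i ((fun s : R =>
    dotp (es i x) (Y (x, s)) *: bracket L (tslice s X) (e i) x) +
    (fun s : R => trho X (fun q : MR => dotp (es i q.1) (Y q)) (x, s) *: e i x))); last first.
  by apply/funext => s; rewrite E fct_sumE.
have dB i : is_derive t 1 (fun s : R => bracket L (tslice s X) (e i) x)
    (bracket L (tslice t (tderiv X)) (e i) x).
  have := section_derive x t (bracket_slice_section sX (se i)).
  by rewrite (bracket_slice_derive (x, t) sX (se i)).
have dY i := is_derive_dotp (es i x) (section_derive x t sY).
have dT i := is_deriveZv (e i x) (trho_derive x t sX (sf i)).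
apply: etrans (@derive_val _ _ _ _ _ _ _
  (is_derive_sum (fun i => is_deriveD (is_derive_scale (dY i) (dB i)) (dT i)))) _.
rewrite -big_split /=; apply: eq_bigr => i _.
have -> : (fun q : MR => dotp (es i q.1) (tderiv Y q)) = dt (fun q : MR => dotp (es i q.1) (Y q)).
  by apply/funext => q; rewrite (dt_dotp _ _ sY).
by rewrite scalerDl [X in X + _]addrC addrACA.
Qed.

End time_bracket.

(** * The Lie algebroid structures on the product with the line *)

Section bar.
Context {R : realType} {n : nat} {M : manifold R n} {r : nat}.
Variables (A : vbundle M r) (L : algebroid M r).
Hypothesis hL : is_lie_algebroid A L.
Let MR := time_manifold M.
Local Notation MA := (time_bundle A).
Local Notation tsec := (smooth_section MA).
Implicit Types (X Y Z : MR -> 'rV[R]_r) (f g : MR -> R) (p q : MR) (x : M) (t s : R).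

Lemma tbracketC X Y p : tsec X -> tsec Y -> tbracket L X Y p = - tbracket L Y X p.
Proof. by move=> sX sY; apply: (bracketC hL); exact: section_slice. Qed.

Lemma tbracketDr X Y Z p : tsec X -> tsec Y -> tsec Z ->
  tbracket L X (fun q => Y q + Z q) p = tbracket L X Y p + tbracket L X Z p.
Proof.
move=> sX sY sZ; rewrite /tbracket.
have sl (W : MR -> 'rV[R]_r) : tsec W -> smooth_section A (tslice p.2 W) by move=> sW; exact: section_slice.
by have /funeqP/(_ p.1) := bracketDr hL (sl _ sY) (sl _ sZ) (sl _ sX).
Qed.

Lemma tbracketBr X Y Z p : tsec X -> tsec Y -> tsec Z ->
  tbracket L X (fun q => Y q - Z q) p = tbracket L X Y p - tbracket L X Z p.
Proof.
move=> sX sY sZ; have sl (W : MR -> 'rV[R]_r) : tsec W -> smooth_section A (tslice p.2 W) by move=> sW; exact: section_slice.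
exact: (bracketBr hL p.1 (sl _ sY) (sl _ sZ) (sl _ sX)).
Qed.

Lemma tbracketZr X Y f p : tsec X -> tsec Y -> smooth_fun f ->
  tbracket L X (fun q => f q *: Y q) p = f p *: tbracket L X Y p + trho L X f p *: Y p.
Proof.
case: p => x t sX sY sf; have sl (W : MR -> 'rV[R]_r) : tsec W -> smooth_section A (tslice t W) by move=> sW; exact: section_slice.
exact: (bracketZr hL x (sl _ sX) (sl _ sY) (smooth_fun_slice t sf)).
Qed.

Lemma tbracket_jacobi X Y Z p : tsec X -> tsec Y -> tsec Z ->
  tbracket L X (tbracket L Y Z) p + tbracket L Y (tbracket L Z X) p +
  tbracket L Z (tbracket L X Y) p = 0.
Proof.
move=> sX sY sZ; have sl (W : MR -> 'rV[R]_r) : tsec W -> smooth_section A (tslice p.2 W) by move=> sW; exact: section_slice.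
by have /funeqP/(_ p.1) := la_jacobi hL (sl _ sX) (sl _ sY) (sl _ sZ).
Qed.

Lemma tderivD X Y p : tsec X -> tsec Y ->
  tderiv (fun q => X q + Y q) p = tderiv X p + tderiv Y p.
Proof.
case: p => x t sX sY; rewrite {1}/tderiv derive1E.
exact: (@derive_val _ _ _ _ _ _ _
  (is_deriveD (section_derive x t sX) (section_derive x t sY))).
Qed.

Lemma tderivZ f X p : smooth_fun f -> tsec X ->
  tderiv (fun q => f q *: X q) p = dt f p *: X p + f p *: tderiv X p.
Proof.
case: p => x t sf sX; rewrite {1}/tderiv derive1E.
exact: (@derive_val _ _ _ _ _ _ _
  (is_derive_scale (fun_derive x t sf) (section_derive x t sX))).
Qed.

Lemma tderivB X Y p : tsec X -> tsec Y ->
  tderiv (fun q => X q - Y q) p = tderiv X p - tderiv Y p.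
Proof.
case: p => x t sX sY; rewrite {1}/tderiv derive1E.
exact: (@derive_val _ _ _ _ _ _ _
  (is_deriveB (section_derive x t sX) (section_derive x t sY))).
Qed.

Lemma trhoM X f g p : smooth_fun f -> smooth_fun g ->
  trho L X (fun q => f q * g q) p = f p * trho L X g p + trho L X f p * g p.
Proof.
case: p => x t sf sg.
exact: (pderivM _ (smooth_fun_slice t sf x) (smooth_fun_slice t sg x)).
Qed.

Variable phi : M -> 'rV[R]_r.
Hypothesis sphi : smooth_section (dual_bundle A) phi.
Hypothesis cphi : eq_form A (dform L (form1 phi)) 0.
Local Notation bar := (bar_algebroid L phi).

Lemma cocycleE (X Y : M -> 'rV[R]_r) x : smooth_section A X -> smooth_section A Y ->
  dotp (phi x) (bracket L X Y x) =
  vderiv (sanchor L X) (fun z => dotp (phi z) (Y z)) x -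
  vderiv (sanchor L Y) (fun z => dotp (phi z) (X z)) x.
Proof.
move=> sX sY; have sXY : smooth_sections A [:: X; Y] by apply/smooth_sections2.
have /funeqP/(_ x) := cphi sXY; rewrite dform_form1E /alt2 /dform1.
by move=> /eqP; rewrite subr_eq0 => /eqP.
Qed.

Lemma tpair_smooth X : tsec X -> smooth_fun (tpair phi X).
Proof.
move=> sX; apply: (@smooth_dotp _ _ _ _ MA (fun q : MR => phi q.1)) => //.
exact: (@section_fst _ _ _ _ (dual_bundle A)).
Qed.

Lemma dt_tpair X p : tsec X -> dt (tpair phi X) p = tpair phi (tderiv X) p.
Proof. exact: dt_dotp. Qed.

Lemma tpair_tbracket X Y p : tsec X -> tsec Y -> tpair phi (tbracket L X Y) p =
  trho L X (tpair phi Y) p - trho L Y (tpair phi X) p.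
Proof.
case: p => x t sX sY; have sl (W : MR -> 'rV[R]_r) : tsec W -> smooth_section A (tslice t W) by move=> sW; exact: section_slice.
exact: (cocycleE x (sl _ sX) (sl _ sY)).
Qed.

Lemma bar_vderiv X f p : smooth_at f p -> vderiv (sanchor bar X) f p =
  trho L X f p + tpair phi X p * dt f p.
Proof. by case: p => x t; exact: pderiv_time. Qed.

Lemma bar_bracket_section X Y : tsec X -> tsec Y -> tsec (bracket bar X Y).
Proof.
move=> sX sY; apply: smooth_sectionB; first apply: smooth_sectionD.
- exact: tbracket_section.
- by apply: smooth_sectionZ; [exact: tpair_smooth|exact: tderiv_section].
- by apply: smooth_sectionZ; [exact: tpair_smooth|exact: tderiv_section].
Qed.

Lemma bar_bracketE X Y p : bracket bar X Y p = tbracket L X Y p +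
  tpair phi X p *: tderiv Y p - tpair phi Y p *: tderiv X p.
Proof. by []. Qed.

Lemma tbracket_bar X Y Z p : tsec X -> tsec Y -> tsec Z ->
  tbracket L X (bracket bar Y Z) p = tbracket L X (tbracket L Y Z) p +
    (tpair phi Y p *: tbracket L X (tderiv Z) p + trho L X (tpair phi Y) p *: tderiv Z p) -
    (tpair phi Z p *: tbracket L X (tderiv Y) p + trho L X (tpair phi Z) p *: tderiv Y p).
Proof.
move=> sX sY sZ.
have sYZ := tbracket_section hL sY sZ.
have s1 := smooth_sectionZ (tpair_smooth sY) (tderiv_section sZ).
have s2 := smooth_sectionZ (tpair_smooth sZ) (tderiv_section sY).
rewrite (tbracketBr _ sX (smooth_sectionD sYZ s1) s2) (tbracketDr _ sX sYZ s1).
rewrite (tbracketZr _ sX (tderiv_section sZ) (tpair_smooth sY)).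
by rewrite (tbracketZr _ sX (tderiv_section sY) (tpair_smooth sZ)).
Qed.

Lemma tderiv_bar Y Z p : tsec Y -> tsec Z ->
  tderiv (bracket bar Y Z) p = tbracket L (tderiv Y) Z p + tbracket L Y (tderiv Z) p +
    (tpair phi (tderiv Y) p *: tderiv Z p + tpair phi Y p *: tderiv (tderiv Z) p) -
    (tpair phi (tderiv Z) p *: tderiv Y p + tpair phi Z p *: tderiv (tderiv Y) p).
Proof.
move=> sY sZ.
have sYZ := tbracket_section hL sY sZ.
have s1 := smooth_sectionZ (tpair_smooth sY) (tderiv_section sZ).
have s2 := smooth_sectionZ (tpair_smooth sZ) (tderiv_section sY).
rewrite (tderivB _ (smooth_sectionD sYZ s1) s2) (tderivD _ sYZ s1).
rewrite (tderivZ _ (tpair_smooth sY) (tderiv_section sZ)).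
rewrite (tderivZ _ (tpair_smooth sZ) (tderiv_section sY)).
by rewrite (tbracket_tderiv hL _ sY sZ) !dt_tpair.
Qed.

Lemma tpair_bar Y Z p : tsec Y -> tsec Z ->
  tpair phi (bracket bar Y Z) p =
    trho L Y (tpair phi Z) p - trho L Z (tpair phi Y) p +
    tpair phi Y p * tpair phi (tderiv Z) p - tpair phi Z p * tpair phi (tderiv Y) p.
Proof.
move=> sY sZ; rewrite -(tpair_tbracket _ sY sZ) {1}/tpair bar_bracketE.
by rewrite dotpBr dotpDr !dotpZr.
Qed.

Lemma bar_bar X Y Z p : tsec X -> tsec Y -> tsec Z ->
  bracket bar X (bracket bar Y Z) p =
  tbracket L X (tbracket L Y Z) p +
    (tpair phi Y p *: tbracket L X (tderiv Z) p + trho L X (tpair phi Y) p *: tderiv Z p) -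
    (tpair phi Z p *: tbracket L X (tderiv Y) p + trho L X (tpair phi Z) p *: tderiv Y p) +
  tpair phi X p *: (tbracket L (tderiv Y) Z p + tbracket L Y (tderiv Z) p +
    (tpair phi (tderiv Y) p *: tderiv Z p + tpair phi Y p *: tderiv (tderiv Z) p) -
    (tpair phi (tderiv Z) p *: tderiv Y p + tpair phi Z p *: tderiv (tderiv Y) p)) -
  (trho L Y (tpair phi Z) p - trho L Z (tpair phi Y) p +
    tpair phi Y p * tpair phi (tderiv Z) p - tpair phi Z p * tpair phi (tderiv Y) p) *:
  tderiv X p.
Proof.
move=> sX sY sZ; rewrite {1}bar_bracketE (tbracket_bar p sX sY sZ) (tderiv_bar p sY sZ).
by rewrite (tpair_bar p sY sZ).
Qed.

(** The nested slicewise brackets cancel by the Jacobi identity of [L]. The cocycle condition has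
    already expanded the terms [phi([Y, Z])], so once the brackets with a time derivative on the
    left are turned around, the rest cancels coordinate by coordinate. *)
Lemma bar_jacobi X Y Z p : tsec X -> tsec Y -> tsec Z ->
  bracket bar X (bracket bar Y Z) p + bracket bar Y (bracket bar Z X) p +
  bracket bar Z (bracket bar X Y) p = 0.
Proof.
move=> sX sY sZ; have sX' := tderiv_section sX; have sY' := tderiv_section sY.
have sZ' := tderiv_section sZ.
rewrite (bar_bar p sX sY sZ) (bar_bar p sY sZ sX) (bar_bar p sZ sX sY).
have := tbracket_jacobi p sX sY sZ.
rewrite (tbracketC p sX' sY) (tbracketC p sY' sZ) (tbracketC p sZ' sX).
move: (tbracket L X (tbracket L Y Z) p) (tbracket L Y (tbracket L Z X) p)
  (tbracket L Z (tbracket L X Y) p) => a b c abc.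
have -> : a = - (b + c) by apply/eqP; rewrite -addr_eq0 addrA abc.
move: (tpair phi X p) (tpair phi Y p) (tpair phi Z p).
move: (tpair phi (tderiv X) p) (tpair phi (tderiv Y) p) (tpair phi (tderiv Z) p).
move: (tderiv (tderiv X) p) (tderiv (tderiv Y) p) (tderiv (tderiv Z) p).
move: (tderiv X p) (tderiv Y p) (tderiv Z p).
move: (trho L X (tpair phi Y) p) (trho L X (tpair phi Z) p) (trho L Y (tpair phi X) p).
move: (trho L Y (tpair phi Z) p) (trho L Z (tpair phi Y) p) (trho L Z (tpair phi X) p).
move: (tbracket L X (tderiv Y) p) (tbracket L X (tderiv Z) p).
move: (tbracket L Y (tderiv X) p) (tbracket L Y (tderiv Z) p).
move: (tbracket L Z (tderiv X) p) (tbracket L Z (tderiv Y) p).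
move=> *; apply/rowP => j; rewrite !mxE; ring.
Qed.

End bar.

(** * Chart coordinates as test functions *)

Section coordinates.
Context {R : realType} {n : nat} {M : manifold R n}.

Lemma pderiv_coord (x : M) v j : pderiv x v (fun y => mchart x y 0 j) = v 0 j.
Proof.
have xx := mdom_mem x.
have [U [oU Ux UP]] := chart_nbhs xx (nbhs_mdom xx).
have Un : nbhs (mchart x x) U by exact: open_nbhs_nbhs.
rewrite /pderiv (@near_eq_derive _ _ _ _ (fun u : 'rV[R]_n => u 0 j)); last first.
  by apply: filterS Un => u /UP[w [xw _] ->] /=; rewrite (mchartK xw).
have did : derivable (id : 'rV[R]_n -> 'rV[R]_n) (mchart x x) v by exact: derivable_id.
have := derive_mx did.
by rewrite derive_id => /matrixP/(_ 0 j); rewrite mxE => <-.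
Qed.

Lemma smooth_at_coord (x : M) j : smooth_at (fun y => mchart x y 0 j) x.
Proof.
have xx := mdom_mem x.
exists x, (mchart x @` mdom x); split => //; first exact: mimage_open.
move=> k; apply: (@Ck_on_ext _ _ _ _ _ (fun u : 'rV[R]_n => u 0 j)).
- exact: mimage_open.
- by move=> _ [w xw <-] /=; rewrite (mchartK xw).
apply: (Ck_on_entry (f := id)); first exact: mimage_open.
by apply: (@Ck_on_linear _ _ _ _ _ idfun) => ?.
Qed.

Lemma smooth_extension (f : M -> R) (x : M) : smooth_at f x ->
  exists g, smooth_fun g /\ \forall y \near x, g y = f y.
Proof.
move=> /smooth_at_near nf.
have [chi [schi chi1 chi0]] := bump_function nf.
exists (fun y => chi y * f y); split.
  move=> y; case: (chi0 y) => [sf|y0]; first exact: smooth_atM.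
  apply: (@smooth_at_ext _ _ _ _ (cst 0)); last exact: smooth_at_cst.
  by apply: filterS y0 => z ->; rewrite mul0r.
by apply: filterS chi1 => y ->; rewrite mul1r.
Qed.

(** The bracket of vector fields is defined through chart coordinates, which are smooth only
    locally. A function agreeing with them near [x] gives the same derivatives, so a globally smooth
    one may be used. *)
Lemma vf_bracketE (V W : M -> 'rV[R]_n) (x : M) j (c : M -> R) :
  (\forall y \near x, c y = mchart x y 0 j) ->
  vf_bracket V W x 0 j = vderiv V (vderiv W c) x - vderiv W (vderiv V c) x.
Proof.
move=> cE; have E U : \forall y \near x, vderiv U (fun y => mchart x y 0 j) y = vderiv U c y.
  apply: filterS (near_join cE) => y cEy; apply: pderiv_ext.
  by apply: filterS cEy => z ->.
have e1 : vderiv V (vderiv W (fun y => mchart x y 0 j)) x = vderiv V (vderiv W c) x.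
  exact: (pderiv_ext (V x) (E W)).
have e2 : vderiv W (vderiv V (fun y => mchart x y 0 j)) x = vderiv W (vderiv V c) x.
  exact: (pderiv_ext (W x) (E V)).
by rewrite /vf_bracket [LHS]mxE e1 e2.
Qed.

End coordinates.

(** * The bar structure is a Lie algebroid *)

Section bar_lie_algebroid.
Context {R : realType} {n : nat} {M : manifold R n} {r : nat}.
Variables (A : vbundle M r) (L : algebroid M r).
Hypothesis hL : is_lie_algebroid A L.
Let MR := time_manifold M.
Local Notation MA := (time_bundle A).
Local Notation tsec := (smooth_section MA).
Implicit Types (X Y Z : MR -> 'rV[R]_r) (f g : MR -> R) (p q : MR) (x : M) (t s : R).
Variable phi : M -> 'rV[R]_r.
Hypothesis sphi : smooth_section (dual_bundle A) phi.
Hypothesis cphi : eq_form A (dform L (form1 phi)) 0.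
Local Notation bar := (bar_algebroid L phi).

Lemma trho_cst X (c : R) p : trho L X (cst c) p = 0.
Proof. exact: pderiv_cst. Qed.

Lemma dt_fst (c : M -> R) p : dt (fun q : MR => c q.1) p = 0.
Proof. exact: (derive1_cst (c p.1) p.2). Qed.

Lemma dt_snd p : dt (fun q : MR => q.2) p = 1.
Proof. exact: (derive1_id p.2). Qed.

Lemma trho_snd X p : trho L X (fun q : MR => q.2) p = 0.
Proof. exact: pderiv_cst. Qed.

Lemma smooth_fun_snd : smooth_fun (fun q : MR => q.2).
Proof.
move=> p; apply: (@smooth_at_time _ _ _ id) => k.
by apply: (@Ck_on_linear _ _ _ _ _ idfun) => ?.
Qed.

Lemma bar_vderiv_fst X (c : M -> R) : tsec X -> smooth_fun c ->
  vderiv (sanchor bar X) (fun q : MR => c q.1) = trho L X (fun q : MR => c q.1).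
Proof.
move=> sX sc; apply/funext => p; rewrite bar_vderiv; last exact: smooth_fun_fst.
by rewrite dt_fst mulr0 addr0.
Qed.

Lemma bar_vderiv_snd X : tsec X ->
  vderiv (sanchor bar X) (fun q : MR => q.2) = tpair phi X.
Proof.
move=> sX; apply/funext => p; rewrite bar_vderiv; last exact: smooth_fun_snd.
by rewrite trho_snd add0r dt_snd mulr1.
Qed.

Lemma bar_vderiv2_fst X Y (c : M -> R) p : tsec X -> tsec Y -> smooth_fun c ->
  vderiv (sanchor bar X) (vderiv (sanchor bar Y) (fun q : MR => c q.1)) p =
  trho L X (trho L Y (fun q : MR => c q.1)) p +
  tpair phi X p * trho L (tderiv Y) (fun q : MR => c q.1) p.
Proof.
move=> sX sY sc; rewrite bar_vderiv_fst//.
have sc' := smooth_fun_fst sc.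
rewrite bar_vderiv; last exact: (trho_smooth hL).
rewrite (dt_trho hL)//; congr (_ + _ * _).
rewrite (_ : dt _ = cst 0) ?trho_cst ?addr0//.
by apply/funext => q; exact: dt_fst.
Qed.

(** A vector field is determined by its action on coordinates. On a coordinate of [M] the claim is
    the same property of [L] combined with product rules. On [t], on which the anchor of [X] acts as
    [phi(X)], it is the cocycle condition. *)
Lemma bar_anchor_bracket X Y : tsec X -> tsec Y ->
  sanchor bar (bracket bar X Y) = vf_bracket (sanchor bar X) (sanchor bar Y).
Proof.
move=> sX sY; apply/funext => p0; case: p0 => x t; set p : MR := (x, t); apply/rowP => j.
rewrite /sanchor [anchor bar]/=; case: (split_ordP j) => k ->.
  rewrite row_mxEl.
  have [c [sc cE]] := smooth_extension (smooth_at_coord x k).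
  have nc : \forall q \near p, c q.1 = mchart p q 0 (lshift 1 k).
    have := near_fst t cE.
    by apply: filterS => q ->; rewrite time_chartE row_mxEl.
  rewrite (vf_bracketE _ _ nc) !bar_vderiv2_fst//.
  have sl (W : MR -> 'rV[R]_r) : tsec W -> smooth_section A (tslice t W) by move=> sW; exact: section_slice.
  have /funeqP/(_ x) := la_anchor_bracket hL (sl _ sX) (sl _ sY).
  move=> /rowP/(_ k); rewrite (vf_bracketE _ _ cE) => E.
  have E0 (W : MR -> 'rV[R]_r) : slice t (trho L W (fun q : MR => c q.1)) =
      vderiv (sanchor L (tslice t W)) c by apply/funext => y; rewrite /slice /trho.
  have E1 (U W : MR -> 'rV[R]_r) : trho L U (trho L W (fun q : MR => c q.1)) p =
      vderiv (sanchor L (tslice t U)) (vderiv (sanchor L (tslice t W)) c) x.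
    by rewrite {1}/trho E0.
  have E2 (W : MR -> 'rV[R]_r) : trho L W (fun q : MR => c q.1) p = anchor L x (W p) 0 k.
    exact: etrans (pderiv_ext _ cE) (pderiv_coord _ _ _).
  rewrite !{}E1 !{}E2 bar_bracketE -scaleNr !(anchorD hL) !(anchorZ hL).
  have {}E : anchor L x (tbracket L X Y p) 0 k = _ := E.
  move: (anchor L x (tbracket L X Y p)) (anchor L x (tderiv X p)) (anchor L x (tderiv Y p)) E.
  move: (vderiv _ _ _) (vderiv _ _ _) => d1 d2 a b e E.
  move: (tpair phi X p) (tpair phi Y p) => u v.
  by rewrite !mxE E; ring.
rewrite row_mxEr ord1 mxE eqxx mulr1n.
have nc : \forall q \near p, (fun q : MR => q.2) q = mchart p q 0 (rshift n 0).
  by near=> q; rewrite time_chartE row_mxEr mxE eqxx mulr1n.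
rewrite (vf_bracketE _ _ nc) !bar_vderiv_snd// -/(tpair phi _ p) (tpair_bar cphi)//.
rewrite (bar_vderiv _ _ _ (tpair_smooth sphi sY p)) (bar_vderiv _ _ _ (tpair_smooth sphi sX p)).
rewrite (dt_tpair phi p sX) (dt_tpair phi p sY).
move: (trho _ _ _ _) (trho _ _ _ _) (tpair _ _ _) (tpair _ _ _) (tpair _ _ _) (tpair _ _ _) => *.
ring.
Unshelve. all: by end_near.
Qed.

Lemma bar_anchor_smooth X : tsec X -> smooth_section (tangent_bundle MR) (sanchor bar X).
Proof.
move=> sX p q pq; case: q pq => y s pq.
apply: (@smooth_at_ext _ _ _ _ (fun z : MR =>
   row_mx (anchor L z.1 (X z) *m tangent_triv p.1 z.1) (tpair phi X z)%:M)).
  near=> z; apply/esym; apply: tangent_triv_time.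
  by near: z; apply: nbhs_mdom.
apply: smooth_at_row_mx; first exact: (anchor_time_smooth hL).
apply/smooth_at_mxP => i j; apply: smooth_at_ext (tpair_smooth sphi sX (y, s)).
by near=> z; rewrite !ord1 mxE eqxx mulr1n.
Unshelve. all: by end_near.
Qed.

Lemma bar_is_lie_algebroid : is_lie_algebroid MA bar.
Proof.
split.
- by move=> X Y sX sY; exact: (bar_bracket_section hL).
- move=> c X Y Z sX sY sZ; apply/funext => p.
  have sl (W : MR -> 'rV[R]_r) : tsec W -> smooth_section A (tslice p.2 W) by move=> sW; exact: section_slice.
  have sc := smooth_sectionZ (smooth_fun_cst c) sX.
  have E1 : tbracket L (c *: X + Y) Z p = c *: tbracket L X Z p + tbracket L Y Z p.
    by have /funeqP/(_ p.1) := la_linear hL c (sl _ sX) (sl _ sY) (sl _ sZ).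
  have E2 : tpair phi (c *: X + Y) p = c * tpair phi X p + tpair phi Y p.
    by rewrite /tpair dotpDr dotpZr.
  have E3 : tderiv (c *: X + Y) p = c *: tderiv X p + tderiv Y p.
    rewrite (tderivD _ sc sY) (tderivZ _ (smooth_fun_cst c) sX).
    by rewrite (_ : dt (cst c) p = 0) ?scale0r ?add0r//; exact: derive1_cst.
  rewrite -[RHS]/(c *: bracket bar X Z p + bracket bar Y Z p) !bar_bracketE E1 E2 E3.
  move: (tbracket L X Z p) (tbracket L Y Z p) (tderiv X p) (tderiv Y p) (tderiv Z p).
  move: (tpair phi X p) (tpair phi Y p) (tpair phi Z p) => *.
  by apply/rowP => j; rewrite !mxE; ring.
- move=> X Y sX sY; apply/funext => p; rewrite -[RHS]/(- bracket bar Y X p).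
  by rewrite !bar_bracketE (tbracketC hL p sX sY) !opprD opprK addrAC.
- by move=> X Y Z sX sY sZ; apply/funext => p; exact: (bar_jacobi hL).
- move=> p c u v; rewrite /= (la_anchor_linear hL) dotpDr dotpZr.
  by rewrite scale_row_mx add_row_mx scale_scalar_mx raddfD.
- exact: bar_anchor_smooth.
- exact: bar_anchor_bracket.
- move=> X Y f sX sY sf; apply/funext => p.
  rewrite !bar_bracketE (tbracketZr hL p sX sY sf) (tderivZ p sf sY) (bar_vderiv _ _ _ (sf p)).
  have -> : tpair phi (fun q => f q *: Y q) p = f p * tpair phi Y p by rewrite /tpair dotpZr.
  move: (tbracket L X Y p) (tderiv X p) (tderiv Y p) (Y p) => a b c d.
  move: (trho L X f p) (dt f p) (tpair phi X p) (tpair phi Y p) (f p) => *.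
  by apply/rowP => j; rewrite !mxE; ring.
Qed.

End bar_lie_algebroid.

(** * Rescaling the fibres of a Lie algebroid *)

Section conj.
Context {R : realType} {n : nat} {M : manifold R n} {r : nat}.
Variables (A : vbundle M r) (L : algebroid M r).
Hypothesis hL : is_lie_algebroid A L.
Implicit Types (X Y Z : M -> 'rV[R]_r) (f g : M -> R).
Variables (h k : M -> R).
Hypotheses (sh : smooth_fun h) (sk : smooth_fun k) (hk : forall x, h x * k x = 1).
Local Notation sec := (smooth_section A).
Local Notation "k .* X" := (fun x => k x *: X x) (at level 40).

(* Transport of [L] along the bundle automorphism [X |-> h X], whose inverse is [X |-> k X]. *)
Lemma transport_lie_algebroid L' :
  (forall X Y, sec X -> sec Y -> bracket L' X Y = h .* bracket L (k .* X) (k .* Y)) ->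
  (forall x v, anchor L' x v = k x *: anchor L x v) ->
  is_lie_algebroid A L'.
Proof.
move=> brE anE.
have skX X : sec X -> sec (k .* X) by move=> sX; exact: smooth_sectionZ.
have cl X Y : sec X -> sec Y -> sec (bracket L' X Y).
  by move=> sX sY; rewrite brE//; apply: smooth_sectionZ => //; apply: (la_closed hL); exact: skX.
have kh X : k .* (h .* X) = X.
  by apply/funext => x; rewrite scalerA mulrC hk scale1r.
have sanE X : sanchor L' X = sanchor L (k .* X).
  by apply/funext => x; rewrite /sanchor anE (anchorZ hL).
split => //.
- move=> c X Y Z sX sY sZ.
  have sXY : sec (c *: X + Y).
    exact: (smooth_sectionD (smooth_sectionZ (smooth_fun_cst c) sX) sY).
  rewrite !brE// (_ : k .* (c *: X + Y) = c *: (k .* X) + k .* Y); last first.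
    by apply/funext => x; rewrite !fctE scalerDr !scalerA mulrC.
  rewrite (la_linear hL) //; try exact: skX.
  by apply/funext => x; rewrite !fctE scalerDr !scalerA mulrC.
- move=> X Y sX sY; rewrite !brE// (la_antisym hL); try exact: skX.
  by apply/funext => x; rewrite !fctE scalerN.
- move=> X Y Z sX sY sZ.
  rewrite !(brE _ (bracket L' _ _))//; try exact: cl.
  rewrite !brE// !kh.
  have /funeqP J := la_jacobi hL (skX _ sX) (skX _ sY) (skX _ sZ).
  apply/funext => x; have := J x; rewrite !fctE => Jx.
  by rewrite -!scalerDr Jx scaler0.
- by move=> x c u v; rewrite !anE (la_anchor_linear hL) scalerDr !scalerA mulrC.
- by move=> X sX; rewrite sanE; apply: (la_anchor_smooth hL); exact: skX.
- move=> X Y sX sY; rewrite !sanE brE// kh.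
  by apply: (la_anchor_bracket hL); exact: skX.
- move=> X Y f sX sY sf; have sfY := smooth_sectionZ sf sY.
  rewrite !brE// sanE (_ : k .* (f .* Y) = f .* (k .* Y)); last first.
    by apply/funext => x; rewrite !scalerA mulrC.
  rewrite (la_leibniz hL)//; try exact: skX.
  apply/funext => x; rewrite scalerDr !scalerA; congr (_ *: _ + _ *: _); first exact: mulrC.
  by rewrite -[RHS]mul1r -(hk x); move: (vderiv _ _ _) => d; ring.
Qed.

End conj.

(** * The hat structure is a Lie algebroid *)

Section hat.
Context {R : realType} {n : nat} {M : manifold R n} {r : nat}.
Variables (B : vbundle M r) (L : algebroid M r).
Hypothesis hL : is_lie_algebroid B L.
Let MR := time_manifold M.
Variable phi : M -> 'rV[R]_r.
Hypothesis sphi : smooth_section (dual_bundle B) phi.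
Hypothesis cphi : eq_form B (dform L (form1 phi)) 0.

Lemma smooth_expR_time (c : R) : smooth_fun (fun q : MR => expR (c * q.2)).
Proof.
move=> q; apply: (@smooth_at_time _ _ _ (fun t => expR (c * t))) => k.
apply: (@Ck_on_real_comp _ _ _ _ expR ( *%R c)) => //; [exact: openT|exact: Ck_on_expR|].
apply: (@Ck_onM _ _ _ _ (cst c) id); [exact: openT|exact: Ck_on_cst|].
by apply: (@Ck_on_linear _ _ _ _ _ idfun) => ?.
Qed.

Lemma smooth_expRN : smooth_fun (fun q : MR => expR (- q.2)).
Proof. by under eq_fun do rewrite -mulN1r; exact: smooth_expR_time. Qed.

Lemma dt_expRN (q : MR) : dt (fun q : MR => expR (- q.2)) q = - expR (- q.2).
Proof.
rewrite /dt derive1E.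
have dN : is_derive q.2 1 (fun s : R => - s) (-1) by exact: is_deriveNid.
apply: etrans (@derive_val _ _ _ _ _ _ _ (@is_derive1_comp R expR (fun s => - s) q.2 _ _ (is_derive_expR _) dN)) _.
by rewrite mulrN1.
Qed.

(** The time derivative of [e^-t X] is [e^-t (dX/dt - X)], which is the origin of the corrections
    [- X] in the hat bracket. One factor [e^t] against two factors [e^-t] leaves the overall
    [e^-t]. *)
Lemma hat_is_lie_algebroid : is_lie_algebroid (time_bundle B) (hat_algebroid L phi).
Proof.
have hbar := bar_is_lie_algebroid hL sphi cphi.
have sE : smooth_fun (fun q : MR => expR q.2).
  by under eq_fun do rewrite -[_.2]mul1r; exact: smooth_expR_time.
have sN := smooth_expRN.
apply: (transport_lie_algebroid hbar sE sN) => [q|X Y sX sY|q v].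
- by rewrite -expRD subrr expR0.
- apply/funext => q; rewrite bar_bracketE (tderivZ q sN sX) (tderivZ q sN sY) !dt_expRN.
  have E1 : tbracket L (fun q : MR => expR (- q.2) *: X q) (fun q : MR => expR (- q.2) *: Y q) q =
    (expR (- q.2) * expR (- q.2)) *: tbracket L X Y q.
    have sl (W : MR -> 'rV[R]_r) : smooth_section (time_bundle B) W -> smooth_section B (tslice q.2 W) by move=> sW; exact: section_slice.
    have c0 : smooth_fun (cst (expR (- q.2)) : M -> R) by exact: smooth_fun_cst.
    have := bracketZl hL q.1 (sl _ sX) (smooth_sectionZ c0 (sl _ sY)) c0.
    rewrite (bracketZr hL q.1 (sl _ sX) (sl _ sY) c0) /= => h.
    apply: etrans h _; rewrite -![vderiv _ _ _]/(pderiv _ _ _) !pderiv_cst.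
    by rewrite !scale0r addr0 subr0 scalerA.
  rewrite E1; have tZ (Z : MR -> 'rV[R]_r) :
    tpair phi (fun q : MR => expR (- q.2) *: Z q) q = expR (- q.2) * tpair phi Z q.
    by rewrite /tpair dotpZr.
  rewrite !tZ [LHS]/=.
  have : expR q.2 * expR (- q.2) = 1 by rewrite -expRD subrr expR0.
  move: (tbracket L X Y q) (tderiv X q) (tderiv Y q) (X q) (Y q) => a b c u v.
  move: (tpair phi X q) (tpair phi Y q) (expR q.2) (expR (- q.2)) => w z h k hk.
  by apply/rowP => j; rewrite !mxE -[LHS]mul1r -hk; ring.
- by [].
Qed.

End hat.

Lemma is_derive_dotp2 (R : realType) (m : nat) (g h : R -> 'rV[R]_m) dg dh (t : R) :
  is_derive t 1 g dg -> is_derive t 1 h dh ->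
  is_derive t 1 (fun s => dotp (g s) (h s)) (dotp dg (h t) + dotp (g t) dh).
Proof.
move=> [dg' dgE] [dh' dhE].
have ej (k : R -> 'rV[R]_m) (dk' : derivable k t 1) j :
    is_derive t 1 (fun s => k s 0 j) ('D_1 k t 0 j).
  rewrite derive_mx// mxE; apply: derivableP.
  exact: ((derivable_mxP _ _ _).1 dk').
rewrite (_ : (fun s => _) = \sum_j ((fun s => g s 0 j) * (fun s => h s 0 j))); last first.
  by apply/funext => s; rewrite fct_sumE dotpE.
apply: (is_derive_eq (is_derive_sum (fun j => is_deriveM (ej _ dg' j) (ej _ dh' j)))).
rewrite !dotpE -big_split; apply: eq_bigr => j _.
by rewrite dgE dhE addrC; congr (_ + _); exact: mulrC.
Qed.

(** * The differential of the hat structure on sections *)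

Section hat_differential.
Context {R : realType} {n : nat} {M : manifold R n} {r : nat}.
Variables (B : vbundle M r) (L : algebroid M r).
Hypothesis hL : is_lie_algebroid B L.
Let MR := time_manifold M.
Variable phi : M -> 'rV[R]_r.
Local Notation sec := (smooth_section B).
Local Notation dsec := (smooth_section (dual_bundle B)).
Local Notation tsec := (smooth_section (time_bundle B)).
Local Notation tdsec := (smooth_section (time_bundle (dual_bundle B))).
Local Notation hat := (hat_algebroid L phi).
Implicit Types (a b Z : MR -> 'rV[R]_r) (f : MR -> R) (p q : MR) (x : M) (t : R).

Lemma dt_dotp2 Z a p : tdsec Z -> tsec a ->
  dt (fun q => dotp (Z q) (a q)) p = dotp (tderiv Z p) (a p) + dotp (Z p) (tderiv a p).
Proof.
case: p => x t sZ sa; rewrite /dt derive1E.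
exact: (@derive_val _ _ _ _ _ _ _ (is_derive_dotp2 (section_derive x t sZ) (section_derive x t sa))).
Qed.

Lemma tsmooth_dotp Z a : tdsec Z -> tsec a -> smooth_fun (fun q => dotp (Z q) (a q)).
Proof. by move=> sZ sa; apply: (@smooth_dotp _ _ _ _ (time_bundle B)). Qed.

Lemma hat_vderiv a f p : smooth_at f p -> vderiv (sanchor hat a) f p =
  expR (- p.2) * (trho L a f p + tpair phi a p * dt f p).
Proof.
move=> sf; apply: etrans (pderivZv _ _ sf) _; congr (_ * _).
by case: p sf => x t; exact: pderiv_time.
Qed.

(** The terms [phi(a) Z(b) - phi(b) Z(a)] come from the corrections [- b] and [- a] in the hat
    bracket. For [phi = X0] they are the wedge with [X0] that turns [d_*] into [d_{*X0}]. *)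
Lemma hat_dform1 Z a b p : tdsec Z -> tsec a -> tsec b ->
  dform1 hat Z a b p = expR (- p.2) *
    (dform1 L (tslice p.2 Z) (tslice p.2 a) (tslice p.2 b) p.1 +
     tpair phi a p * (dotp (Z p) (b p) + dotp (tderiv Z p) (b p)) -
     tpair phi b p * (dotp (Z p) (a p) + dotp (tderiv Z p) (a p))).
Proof.
move=> sZ sa sb; rewrite {1}/dform1.
rewrite (hat_vderiv _ (tsmooth_dotp sZ sb p)) (hat_vderiv _ (tsmooth_dotp sZ sa p)).
rewrite (dt_dotp2 p sZ sa) (dt_dotp2 p sZ sb).
have -> : dform1 L (tslice p.2 Z) (tslice p.2 a) (tslice p.2 b) p.1 =
    trho L a (fun q => dotp (Z q) (b q)) p - trho L b (fun q => dotp (Z q) (a q)) p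
    - dotp (Z p) (tbracket L a b p).
  by case: p.
have -> : dotp (Z p) (bracket hat a b p) = expR (- p.2) * (dotp (Z p) (tbracket L a b p) +
    tpair phi a p * (dotp (Z p) (tderiv b p) - dotp (Z p) (b p)) -
    tpair phi b p * (dotp (Z p) (tderiv a p) - dotp (Z p) (a p))).
  by rewrite dotpZr dotpBr dotpDr !dotpZr !dotpBr.
move: (trho _ _ _ _) (trho _ _ _ _) (dotp _ _) (dotp _ _) (dotp _ _) (dotp _ _) => *.
move: (dotp _ _) (dotp _ _) (dotp _ _) (tpair _ _ _) (tpair _ _ _) (expR _) => *.
ring.
Qed.

Lemma dform1D (Z W a b : M -> 'rV[R]_r) x : dsec Z -> dsec W -> sec a -> sec b ->
  dform1 L (fun y => Z y + W y) a b x = dform1 L Z a b x + dform1 L W a b x.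
Proof.
move=> sZ sW sa sb; rewrite /dform1 dotpDl.
have E c : (fun z => dotp (Z z + W z) (c z)) = fun z => dotp (Z z) (c z) + dotp (W z) (c z).
  by apply/funext => z; rewrite dotpDl.
rewrite !E -![vderiv _ _ x]/(pderiv x _ _).
have s1 := smooth_dotp sZ sa; have s2 := smooth_dotp sZ sb.
have s3 := smooth_dotp sW sa; have s4 := smooth_dotp sW sb.
rewrite !pderivD//; ring.
Qed.

Lemma dform1Z (f : M -> R) (Z a b : M -> 'rV[R]_r) x : smooth_fun f -> dsec Z ->
  sec a -> sec b ->
  dform1 L (fun y => f y *: Z y) a b x = f x * dform1 L Z a b x +
    vderiv (sanchor L a) f x * dotp (Z x) (b x) - vderiv (sanchor L b) f x * dotp (Z x) (a x).
Proof.
move=> sf sZ sa sb; rewrite /dform1 dotpZl.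
have E c : (fun z => dotp (f z *: Z z) (c z)) = fun z => f z * dotp (Z z) (c z).
  by apply/funext => z; rewrite dotpZl.
rewrite !E -![vderiv _ _ x]/(pderiv x _ _).
have s1 := smooth_dotp sZ sa; have s2 := smooth_dotp sZ sb.
rewrite !pderivM//; ring.
Qed.

(** For time-independent [a] and [b] neither the anchors nor the bracket involve [t], so [d/dt]
    passes through every term of Cartan's formula. *)
Lemma dt_dform1 Z (a b : M -> 'rV[R]_r) p : tdsec Z -> sec a -> sec b ->
  dt (fun q : MR => dform1 L (tslice q.2 Z) a b q.1) p =
  dform1 L (tslice p.2 (tderiv Z)) a b p.1.
Proof.
move=> sZ sa sb.
have sa' := section_fst sa; have sb' := section_fst sb.
have a0 (c : M -> 'rV[R]_r) : tderiv (fun q : MR => c q.1) = fun=> 0.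
  by apply/funext => q; exact: (derive1_cst (c q.1) q.2).
have s1 := tsmooth_dotp sZ sb'; have s2 := tsmooth_dotp sZ sa'.
have s12 := trho_smooth hL sa' s1; have s21 := trho_smooth hL sb' s2.
have E W q : dform1 L (tslice q.2 W) a b q.1 =
    trho L (fun q : MR => a q.1) (fun q : MR => dotp (W q) (b q.1)) q -
    trho L (fun q : MR => b q.1) (fun q : MR => dotp (W q) (a q.1)) q -
    dotp (W q) (bracket L a b q.1).
  by case: q.
rewrite (E (tderiv Z) p).
have dE (c : M -> 'rV[R]_r) : sec c -> dt (fun q => dotp (Z q) (c q.1)) =
    (fun q => dotp (tderiv Z q) (c q.1)).
  move=> sc; apply/funext => q; rewrite dt_dotp2//; last exact: section_fst.
  by rewrite a0 dotp0r addr0.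
have t0 (c : M -> 'rV[R]_r) g q : sec c -> smooth_fun g ->
    dt (trho L (fun q : MR => c q.1) g) q = trho L (fun q : MR => c q.1) (dt g) q.
  move=> sc sg; rewrite (dt_trho hL)//; last exact: section_fst.
  rewrite a0 {1}/trho (anchor0 hL) pderiv0v.
  exact: add0r.
have sab : sec (bracket L a b) by exact: (la_closed hL).
rewrite -(dE b sb) -(dE a sa) -[dotp (tderiv Z p) _](congr1 (@^~ p) (dE _ sab)).
rewrite -!t0//; case: p => x t.
have dd (f : MR -> R) : smooth_fun f -> is_derive t 1 (fun s => f (x, s)) (dt f (x, t)).
  exact: fun_derive.
rewrite {1}/dt derive1E.
rewrite (_ : (fun s : R => _) = (fun s => trho L (fun q : MR => a q.1) (fun q : MR => dotp (Z q) (b q.1)) (x, s)) -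
    (fun s => trho L (fun q : MR => b q.1) (fun q : MR => dotp (Z q) (a q.1)) (x, s)) -
    (fun s => dotp (Z (x, s)) (bracket L a b x))); last first.
  by apply/funext => s; rewrite (E Z (x, s)).
apply: (@derive_val _ _ _ _ _ _ _ (is_deriveB (is_deriveB (dd _ s12) (dd _ s21))
  (dd _ (tsmooth_dotp sZ (section_fst sab))))).
Qed.

End hat_differential.

(** * Compatibility of the two structures *)

Section bialgebroid.
Context {R : realType} {n : nat} {M : manifold R n} {r : nat}.
Variables (A : vbundle M r) (L Ls : algebroid M r) (phi0 X0 : M -> 'rV[R]_r).
Local Notation sec := (smooth_section A).
Local Notation dsec := (smooth_section (dual_bundle A)).
Hypothesis hLs : is_lie_algebroid (dual_bundle A) Ls.
Hypothesis sX0 : sec X0.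
Implicit Types (X Y Z W a b c : M -> 'rV[R]_r) (x : M).

(** The value of [d_{*X0} Z] on [(a, b)] as an explicit function, free of lists and masks. *)
Definition d2X0 Z a b x : R := dform1 Ls Z a b x +
  (dotp (X0 x) (a x) * dotp (Z x) (b x) - dotp (X0 x) (b x) * dotp (Z x) (a x)).

Lemma dphi_form1E Z a b x : dphi Ls X0 (form1 Z) [:: a; b] x = d2X0 Z a b x.
Proof. by rewrite /dphi !fctE dform_form1E wedge11E. Qed.

Lemma multi_dphi Z : sec Z -> multisection A 2 (dphi Ls X0 (form1 Z)).
Proof.
move=> sZ; apply: is_formD; last by apply: is_form_wedge11; exact/smooth_section_dual2.
by apply: dform_form1_is_form => //; exact/smooth_section_dual2.
Qed.

Lemma contr_form1 X Z : contr X (form1 Z) = form0 (fun x => dotp (Z x) (X x)).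
Proof. by apply/funext => -[|? ?]. Qed.

Lemma wedge10E a (f : M -> R) c x :
  wedge (form1 a) (form0 f) [:: c] x = dotp (a x) (c x) * f x.
Proof.
rewrite /wedge (big_tuple_bool_rec 0 (fun m => (-1) ^+ shuffle_inv m *
  (form1 a (mask m [:: c]) x * form0 f (mask [seq ~~ i | i <- m] [:: c]) x))).
rewrite (big_tuple_bool0 (fun m => (-1) ^+ shuffle_inv (true :: m) *
  (form1 a (mask (true :: m) [:: c]) x * form0 f (mask [seq ~~ i | i <- true :: m] [:: c]) x))).
rewrite (big_tuple_bool0 (fun m => (-1) ^+ shuffle_inv (false :: m) *
  (form1 a (mask (false :: m) [:: c]) x * form0 f (mask [seq ~~ i | i <- false :: m] [:: c]) x))).
have -> : shuffle_inv [:: true] = 0%N.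
  by rewrite /shuffle_inv big_mkcond /= !big_ord_recl big_ord0.
by rewrite /= mul0r mulr0 addr0 expr0 mul1r.
Qed.

Lemma dform_form0E (f : M -> R) c x : dform Ls (form0 f) [:: c] x = vderiv (sanchor Ls c) f x.
Proof.
by rewrite /dform !big_ord_recl !big_ord0 expr0 mul1r !addr0.
Qed.

(** A relation rather than a function, because the Lie derivative is available only through an
    existence statement. *)
Definition lie_derivative_of X a la := dsec la /\ forall Z, sec Z -> forall x,
  dotp (la x) (Z x) = vderiv (sanchor L X) (fun z => dotp (a z) (Z z)) x
                      - dotp (a x) (bracket L X Z x).

Variable S : nat -> nat -> altform M r -> altform M r -> altform M r.
Hypothesis hS : is_schouten A L S.
Hypothesis compat : forall X Y, sec X -> sec Y ->
    eq_multisection A (dphi Ls X0 (form1 (bracket L X Y)))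
      (schouten_phi S phi0 1 2 (form1 X) (dphi Ls X0 (form1 Y)) -
       schouten_phi S phi0 1 2 (form1 Y) (dphi Ls X0 (form1 X))).
Hypothesis lie : forall P, multisection A 1 P ->
    eq_multisection A (lie_phi Ls X0 phi0 P + schouten_phi S phi0 1 1 (form1 X0) P) 0.

(** The condition on Lie derivatives for the section [W], evaluated at [c]. In degrees 1 and 1 both
    corrections in the [phi0]-Schouten bracket have coefficient 0, so that only [[X0, W]] is left of
    it. *)
Lemma lieE W c x : sec W -> dsec c ->
  d2X0 W phi0 c x + vderiv (sanchor Ls c) (fun z => dotp (W z) (phi0 z)) x +
  dotp (X0 x) (c x) * dotp (W x) (phi0 x) + dotp (bracket L X0 W x) (c x) = 0.
Proof.
move=> sW sc; have mW := multi_form1 sW.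
have sc1 : smooth_sections (dual_bundle A) [:: c] by apply/smooth_sections1.
have /funeqP/(_ x) := lie mW sc1; rewrite /lie_phi contr_form1.
rewrite /schouten_phi subrr mulr0 !scale0r addr0 subr0.
have := sch_sec_sec hS sX0 sW sc1 => SE.
rewrite -[LHS]/(dphi Ls X0 (form0 (fun x => dotp (W x) (phi0 x))) [:: c] x +
  dphi Ls X0 (form1 W) [:: phi0; c] x + S 1 1 (form1 X0) (form1 W) [:: c] x) SE.
rewrite dphi_form1E -[dphi _ _ (form0 _) _ _]/(dform Ls (form0 _) [:: c] x +
  wedge (form1 X0) (form0 _) [:: c] x) dform_form0E wedge10E => h.
by apply: etrans h; rewrite /=; ring.
Qed.

(** In degrees 1 and 2 the corrections have coefficients [k - 1 = 0] and [k' - 1 = 1], and the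
    contraction of [X] with [phi0] is a function. *)
Lemma schouten_phi12E X P a b x : sec X -> multisection A 2 P ->
  schouten_phi S phi0 1 2 (form1 X) P [:: a; b] x =
  S 1 2 (form1 X) P [:: a; b] x - dotp (X x) (phi0 x) * P [:: a; b] x.
Proof.
move=> sX mP; rewrite /schouten_phi contr_form1 wedge0E subrr mulr0 scale0r addr0.
rewrite (_ : (2%:R - 1 : R) = 1) ?scale1r//.
by rewrite -[2%:R]/(1 + 1 : R) addrK.
Qed.

(** Here the Schouten bracket is eliminated from the hypothesis: the compatibility condition becomes
    an identity between derivatives and values of [d_{*X0}]. *)
Lemma compatE X Y a b la lb ma mb x : sec X -> sec Y -> dsec a -> dsec b ->
  lie_derivative_of X a la -> lie_derivative_of X b lb ->
  lie_derivative_of Y a ma -> lie_derivative_of Y b mb ->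
  d2X0 (bracket L X Y) a b x =
  (vderiv (sanchor L X) (d2X0 Y a b) x - d2X0 Y la b x - d2X0 Y a lb x -
     dotp (X x) (phi0 x) * d2X0 Y a b x) -
  (vderiv (sanchor L Y) (d2X0 X a b) x - d2X0 X ma b x - d2X0 X a mb x -
     dotp (Y x) (phi0 x) * d2X0 X a b x).
Proof.
move=> sX sY sa sb [sla laE] [slb lbE] [sma maE] [smb mbE].
have mX := multi_dphi sX; have mY := multi_dphi sY.
have E Z : dphi Ls X0 (form1 Z) [:: a; b] = d2X0 Z a b.
  by apply/funext => z; exact: dphi_form1E.
rewrite -dphi_form1E (eq_multi_at x (compat sX sY) sa sb).
rewrite -[LHS]/(schouten_phi S phi0 1 2 (form1 X) (dphi Ls X0 (form1 Y)) [:: a; b] x -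
  schouten_phi S phi0 1 2 (form1 Y) (dphi Ls X0 (form1 X)) [:: a; b] x).
rewrite !schouten_phi12E//.
rewrite (schouten_sec2 hS x sX sa sb sla slb laE lbE mY).
rewrite (schouten_sec2 hS x sY sa sb sma smb maE mbE mX).
by rewrite !E !dphi_form1E.
Qed.

End bialgebroid.

(** * Rules for the time derivative of functions *)

Section dt_rules.
Context {R : realType} {n : nat} {M : manifold R n}.
Let MR := time_manifold M.
Implicit Types (f g : MR -> R) (p : MR).

Lemma dtD f g p : smooth_fun f -> smooth_fun g ->
  dt (fun q => f q + g q) p = dt f p + dt g p.
Proof.
case: p => x t sf sg; rewrite {1}/dt derive1E.
exact: (@derive_val _ _ _ _ _ _ _ (is_deriveD (fun_derive x t sf) (fun_derive x t sg))).
Qed.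

Lemma dtB f g p : smooth_fun f -> smooth_fun g ->
  dt (fun q => f q - g q) p = dt f p - dt g p.
Proof.
case: p => x t sf sg; rewrite {1}/dt derive1E.
exact: (@derive_val _ _ _ _ _ _ _ (is_deriveB (fun_derive x t sf) (fun_derive x t sg))).
Qed.

Lemma dtM f g p : smooth_fun f -> smooth_fun g ->
  dt (fun q => f q * g q) p = dt f p * g p + f p * dt g p.
Proof.
case: p => x t sf sg; rewrite {1}/dt derive1E.
apply: etrans (@derive_val _ _ _ _ _ _ _ (is_deriveM (fun_derive x t sf) (fun_derive x t sg))) _.
by rewrite addrC; congr (_ + _); exact: mulrC.
Qed.

Lemma smooth_funM f g : smooth_fun f -> smooth_fun g -> smooth_fun (fun q => f q * g q).
Proof. by move=> sf sg p; apply: smooth_atM. Qed.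

Lemma smooth_funD f g : smooth_fun f -> smooth_fun g -> smooth_fun (fun q => f q + g q).
Proof. by move=> sf sg p; apply: smooth_atD. Qed.

Lemma smooth_funB f g : smooth_fun f -> smooth_fun g -> smooth_fun (fun q => f q - g q).
Proof. by move=> sf sg p; apply: smooth_atB. Qed.

Lemma dtM_fst (c : M -> R) g p : smooth_fun c -> smooth_fun g ->
  dt (fun q => c q.1 * g q) p = c p.1 * dt g p.
Proof.
move=> sc sg; rewrite (dtM p (smooth_fun_fst sc) sg) (dt_fst c p) mul0r.
exact: add0r.
Qed.

End dt_rules.

(** * Lie derivatives for the bar structure *)

Section time_lie_derivative.
Context {R : realType} {n : nat} {M : manifold R n} {r : nat}.
Variables (A : vbundle M r) (L : algebroid M r) (phi0 : M -> 'rV[R]_r).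
Let MR := time_manifold M.
Local Notation MA := (time_bundle A).
Local Notation tsec := (smooth_section MA).
Local Notation bar := (bar_algebroid L phi0).
Hypothesis sphi : smooth_section (dual_bundle A) phi0.

Lemma tderiv_fst (Z : M -> 'rV[R]_r) p : tderiv (fun q : MR => Z q.1) p = 0.
Proof. exact: (derive1_cst (Z p.1) p.2). Qed.

(** On a time-independent [Z] the bar bracket of [X] with [Z] is the slicewise one minus
    [phi0(Z) dX/dt]. Hence the bar Lie derivative of [a] exceeds the slicewise one by
    [a(dX/dt) phi0]. *)
Lemma bar_lie_derivative (X : MR -> 'rV[R]_r) (a : M -> 'rV[R]_r) la t : tsec X ->
  smooth_section (dual_bundle A) a ->
  lie_derivative_of MA bar X (fun q : MR => a q.1) la ->
  lie_derivative_of A L (tslice t X) a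
    (fun y => la (y, t) - dotp (a y) (tderiv X (y, t)) *: phi0 y).
Proof.
move=> sX sa [sla laE]; have sX' := tderiv_section sX.
split.
  apply: smooth_sectionB; first exact: (@section_slice _ _ _ _ (dual_bundle A) la t).
  apply: smooth_sectionZ => //.
  exact: (smooth_dotp sa (section_slice t sX')).
move=> Z sZ y; have sZt := section_fst sZ.
rewrite dotpBl dotpZl (laE _ sZt (y, t)) bar_bracketE tderiv_fst scaler0 addr0.
have saZ := smooth_dotp sa sZ.
rewrite (bar_vderiv _ _ _ (smooth_fun_fst saZ (y, t))) (dt_fst (fun z => dotp (a z) (Z z))) mulr0 addr0.
rewrite dotpBr dotpZr /tpair.
rewrite -[trho _ _ _ _]/(vderiv (sanchor L (tslice t X)) (fun z => dotp (a z) (Z z)) y).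
rewrite -[tbracket _ _ _ _]/(bracket L (tslice t X) Z y).
move: (vderiv _ _ _) (dotp (a y) (bracket _ _ _ _)) (dotp (phi0 y) _) (dotp (a y) (tderiv _ _)) => *.
by rewrite /=; ring.
Qed.

End time_lie_derivative.

(** * The Schouten bracket of a section with a hat differential *)

Section time_bialgebroid.
Context {R : realType} {n : nat} {M : manifold R n} {r : nat}.
Variables (A : vbundle M r) (L Ls : algebroid M r) (phi0 X0 : M -> 'rV[R]_r).
Let MR := time_manifold M.
Local Notation MA := (time_bundle A).
Local Notation sec := (smooth_section A).
Local Notation dsec := (smooth_section (dual_bundle A)).
Local Notation tsec := (smooth_section MA).
Local Notation bar := (bar_algebroid L phi0).
Local Notation hat := (hat_algebroid Ls X0).
Local Notation Q := (d2X0 Ls X0).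
Hypothesis hLs : is_lie_algebroid (dual_bundle A) Ls.
Hypothesis sphi : dsec phi0.
Hypothesis sX0 : sec X0.
Hypothesis cX0 : eq_form (dual_bundle A) (dform Ls (form1 X0)) 0.
Hypothesis phX0 : forall x, dotp (phi0 x) (X0 x) = 0.
Implicit Types (X Y Z : MR -> 'rV[R]_r) (a b c : M -> 'rV[R]_r) (p q : MR) (x : M) (t : R).

Lemma hat_dual_lie_algebroid : is_lie_algebroid (dual_bundle MA) hat.
Proof.
have sX0' : smooth_section (dual_bundle (dual_bundle A)) X0 by exact/smooth_section_dual2.
(* [time_bundle (dual_bundle A)] and [dual_bundle (time_bundle A)] have the same domains and
   trivializations but different proofs of the bundle laws. They are not convertible as records,
   although each clause of the definition is. *)
by case: (hat_is_lie_algebroid hLs sX0' cX0) => *; split.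
Qed.

Lemma dual2_tsec X : tsec X -> smooth_section (time_bundle (dual_bundle (dual_bundle A))) X.
Proof.
move=> sX; have : smooth_section (dual_bundle (dual_bundle MA)) X by exact/smooth_section_dual2.
by [].
Qed.

(* The function [expR t * (d^ Y)(a, b)] for time-independent [a] and [b]. *)
Let K Y a b (q : MR) : R := Q (tslice q.2 Y) a b q.1 +
  (dotp (X0 q.1) (a q.1) * dotp (b q.1) (tderiv Y q) -
   dotp (X0 q.1) (b q.1) * dotp (a q.1) (tderiv Y q)).

Lemma hat_form1E Y (a b : MR -> 'rV[R]_r) p : tsec Y ->
  smooth_section (dual_bundle MA) a -> smooth_section (dual_bundle MA) b ->
  dform hat (form1 Y) [:: a; b] p = expR (- p.2) *
  (Q (tslice p.2 Y) (tslice p.2 a) (tslice p.2 b) p.1 +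
    (dotp (X0 p.1) (a p) * dotp (b p) (tderiv Y p) -
     dotp (X0 p.1) (b p) * dotp (a p) (tderiv Y p))).
Proof.
case: p => x t sY sa sb; rewrite dform_form1E /alt2.
rewrite (hat_dform1 _ _ _ (dual2_tsec sY) sa sb); congr (_ * _).
rewrite /d2X0 /tpair /tslice [LHS]/= [RHS]/= !(dotpC _ (tderiv Y _)).
move: (dform1 _ _ _ _ _) (dotp _ _) (dotp _ _) (dotp _ _) (dotp _ _) (dotp _ _) (dotp _ _) => *.
ring.
Qed.

Lemma trho_expRN X p : trho L X (fun q : MR => expR (- q.2)) p = 0.
Proof. exact: (pderiv_cst (expR (- p.2)) p.1 (anchor L p.1 (X p))). Qed.

Lemma bar_vderiv_expRN X (f : MR -> R) p : smooth_fun f ->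
  vderiv (sanchor bar X) (fun q => expR (- q.2) * f q) p =
  expR (- p.2) * (trho L X f p + tpair phi0 X p * (dt f p - f p)).
Proof.
move=> sf; have sE := @smooth_expRN R n M.
rewrite (bar_vderiv _ _ _ (smooth_funM sE sf p)) (trhoM L X p sE sf) (dtM p sE sf).
rewrite trho_expRN dt_expRN.
move: (trho _ _ _ _) (dt f p) (f p) (tpair _ _ _) (expR _) => *; ring.
Qed.

Lemma dform1_time_smooth Y a b : tsec Y -> dsec a -> dsec b ->
  smooth_fun (fun q : MR => dform1 Ls (tslice q.2 Y) a b q.1).
Proof.
move=> sY sa sb; have sY2 := dual2_tsec sY.
have sa' := section_fst sa; have sb' := section_fst sb.
rewrite (_ : (fun q => _) = fun q =>
    trho Ls (fun q : MR => a q.1) (fun q : MR => dotp (Y q) (b q.1)) q -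
    trho Ls (fun q : MR => b q.1) (fun q : MR => dotp (Y q) (a q.1)) q -
    dotp (Y q) (bracket Ls a b q.1)); last by apply/funext => -[].
have sab : dsec (bracket Ls a b) by exact: (la_closed hLs).
apply: smooth_funB; first apply: smooth_funB.
- by apply: (trho_smooth hLs sa'); exact: (tsmooth_dotp sY2 sb').
- by apply: (trho_smooth hLs sb'); exact: (tsmooth_dotp sY2 sa').
- exact: (tsmooth_dotp sY2 (section_fst sab)).
Qed.

Lemma smooth_pair_fst Y a : tsec Y -> dsec a -> smooth_fun (fun q : MR => dotp (a q.1) (Y q)).
Proof. by move=> sY sa; exact: (@smooth_dotp _ _ _ _ MA (fun q : MR => a q.1) Y (section_fst sa) sY). Qed.

Lemma smooth_X0_pair a : dsec a -> smooth_fun (fun y => dotp (X0 y) (a y)).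
Proof. by move=> sa; under eq_fun do rewrite dotpC; exact: smooth_dotp sX0. Qed.

Lemma d2X0_time_smooth Y a b : tsec Y -> dsec a -> dsec b ->
  smooth_fun (fun q : MR => Q (tslice q.2 Y) a b q.1).
Proof.
move=> sY sa sb; apply: smooth_funD; first exact: dform1_time_smooth.
rewrite (_ : (fun q => _) = fun q : MR => dotp (X0 q.1) (a q.1) * dotp (b q.1) (Y q) -
  dotp (X0 q.1) (b q.1) * dotp (a q.1) (Y q)); last first.
  by apply/funext => -[x t]; rewrite /tslice !(dotpC (Y _)).
exact: (smooth_funB (smooth_funM (smooth_fun_fst (smooth_X0_pair sa)) (smooth_pair_fst sY sb))
  (smooth_funM (smooth_fun_fst (smooth_X0_pair sb)) (smooth_pair_fst sY sa))).
Qed.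

Lemma dt_d2X0 Y a b p : tsec Y -> dsec a -> dsec b ->
  dt (fun q : MR => Q (tslice q.2 Y) a b q.1) p = Q (tslice p.2 (tderiv Y)) a b p.1.
Proof.
move=> sY sa sb; have s1 := smooth_pair_fst sY sa; have s2 := smooth_pair_fst sY sb.
have sx := smooth_X0_pair sa; have sy := smooth_X0_pair sb.
have s3 := smooth_funM (smooth_fun_fst sx) s2.
have s4 := smooth_funM (smooth_fun_fst sy) s1.
rewrite (_ : (fun q => _) = fun q : MR => dform1 Ls (tslice q.2 Y) a b q.1 +
  (dotp (X0 q.1) (a q.1) * dotp (b q.1) (Y q) -
  dotp (X0 q.1) (b q.1) * dotp (a q.1) (Y q))); last first.
  by apply/funext => -[x t]; rewrite /d2X0 /tslice !(dotpC (Y _)).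
rewrite (dtD p (dform1_time_smooth sY sa sb) (smooth_funB s3 s4)) (dtB p s3 s4).
rewrite (dtM_fst p sx s2) (dtM_fst p sy s1).
rewrite (dt_dotp b p sY) (dt_dotp a p sY) (dt_dform1 hLs p (dual2_tsec sY) sa sb).
by case: p => x t; rewrite /d2X0 /tslice !(dotpC (tderiv Y _)).
Qed.

Lemma K_smooth Y a b : tsec Y -> dsec a -> dsec b -> smooth_fun (K Y a b).
Proof.
move=> sY sa sb; have sY' := tderiv_section sY.
have s1 := smooth_pair_fst sY' sa; have s2 := smooth_pair_fst sY' sb.
have sx := smooth_X0_pair sa; have sy := smooth_X0_pair sb.
apply: smooth_funD; first exact: d2X0_time_smooth.
apply: smooth_funB; [exact: (smooth_funM (smooth_fun_fst sx) s2)|].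
exact: (smooth_funM (smooth_fun_fst sy) s1).
Qed.

Lemma dt_K Y a b p : tsec Y -> dsec a -> dsec b ->
  dt (K Y a b) p = Q (tslice p.2 (tderiv Y)) a b p.1 +
  (dotp (X0 p.1) (a p.1) * dotp (b p.1) (tderiv (tderiv Y) p) -
   dotp (X0 p.1) (b p.1) * dotp (a p.1) (tderiv (tderiv Y) p)).
Proof.
move=> sY sa sb; have sY' := tderiv_section sY.
have s1 := smooth_pair_fst sY' sa; have s2 := smooth_pair_fst sY' sb.
have sx := smooth_X0_pair sa; have sy := smooth_X0_pair sb.
have s3 := smooth_funM (smooth_fun_fst sx) s2.
have s4 := smooth_funM (smooth_fun_fst sy) s1.
rewrite (dtD p (d2X0_time_smooth sY sa sb) (smooth_funB s3 s4)) (dtB p s3 s4).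
rewrite (dtM_fst p sx s2) (dtM_fst p sy s1) (dt_d2X0 p sY sa sb).
by rewrite (dt_dotp b p sY') (dt_dotp a p sY').
Qed.

Lemma trhoD X (f g : MR -> R) p : smooth_fun f -> smooth_fun g ->
  trho L X (fun q => f q + g q) p = trho L X f p + trho L X g p.
Proof.
case: p => x t sf sg.
exact: (pderivD _ (smooth_fun_slice t sf x) (smooth_fun_slice t sg x)).
Qed.

Lemma trhoB X (f g : MR -> R) p : smooth_fun f -> smooth_fun g ->
  trho L X (fun q => f q - g q) p = trho L X f p - trho L X g p.
Proof.
case: p => x t sf sg.
exact: (pderivB _ (smooth_fun_slice t sf x) (smooth_fun_slice t sg x)).
Qed.

(** The product rule, after which the defining property of the Lie derivatives replaces the
    derivatives of the pairings of [a] and [b] with [X0] and with [dY/dt]. *)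
Lemma trho_K X Y a b la lb x t : tsec X -> tsec Y -> dsec a -> dsec b ->
  lie_derivative_of A L (tslice t X) a la ->
  lie_derivative_of A L (tslice t X) b lb ->
  trho L X (K Y a b) (x, t) = vderiv (sanchor L (tslice t X)) (Q (tslice t Y) a b) x +
   (dotp (X0 x) (a x) * (dotp (lb x) (tderiv Y (x, t)) +
      dotp (b x) (tbracket L X (tderiv Y) (x, t))) +
    (dotp (la x) (X0 x) + dotp (a x) (bracket L (tslice t X) X0 x)) * dotp (b x) (tderiv Y (x, t)) -
    (dotp (X0 x) (b x) * (dotp (la x) (tderiv Y (x, t)) +
      dotp (a x) (tbracket L X (tderiv Y) (x, t))) +
    (dotp (lb x) (X0 x) + dotp (b x) (bracket L (tslice t X) X0 x)) * dotp (a x) (tderiv Y (x, t)))).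
Proof.
move=> sX sY sa sb [sla laE] [slb lbE]; have sY' := tderiv_section sY.
have s1 := smooth_pair_fst sY' sa; have s2 := smooth_pair_fst sY' sb.
have sx := smooth_X0_pair sa; have sy := smooth_X0_pair sb.
have s3 := smooth_funM (smooth_fun_fst sx) s2.
have s4 := smooth_funM (smooth_fun_fst sy) s1.
rewrite (trhoD X (x, t) (d2X0_time_smooth sY sa sb) (smooth_funB s3 s4)) (trhoB X (x, t) s3 s4).
rewrite (trhoM L X (x, t) (smooth_fun_fst sx) s2) (trhoM L X (x, t) (smooth_fun_fst sy) s1).
have eX (c lc : M -> 'rV[R]_r) : (forall Z : M -> 'rV[R]_r, smooth_section A Z -> forall x, dotp (lc x) (Z x) =
    vderiv (sanchor L (tslice t X)) (fun z => dotp (c z) (Z z)) x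
    - dotp (c x) (bracket L (tslice t X) Z x)) ->
    trho L X (fun q : MR => dotp (X0 q.1) (c q.1)) (x, t) =
    dotp (lc x) (X0 x) + dotp (c x) (bracket L (tslice t X) X0 x).
  move=> /(_ X0 sX0 x) ->; rewrite subrK /trho.
  rewrite -[RHS]/(pderiv x (anchor L x (X (x, t))) (fun z => dotp (c z) (X0 z))).
  by congr (pderiv _ _ _); apply/funext => y; rewrite dotpC.
have eY (c lc : M -> 'rV[R]_r) : (forall Z : M -> 'rV[R]_r, smooth_section A Z -> forall x, dotp (lc x) (Z x) =
    vderiv (sanchor L (tslice t X)) (fun z => dotp (c z) (Z z)) x
    - dotp (c x) (bracket L (tslice t X) Z x)) ->
    trho L X (fun q : MR => dotp (c q.1) (tderiv Y q)) (x, t) =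
    dotp (lc x) (tderiv Y (x, t)) + dotp (c x) (tbracket L X (tderiv Y) (x, t)).
  move=> /(_ _ (section_slice t sY') x) => E.
  by rewrite -[dotp (lc x) _]/(dotp (lc x) (tslice t (tderiv Y) x)) E subrK.
by rewrite (eX _ _ laE) (eX _ _ lbE) (eY _ _ laE) (eY _ _ lbE).
Qed.

Lemma d2X0_linl (Z a a' b : M -> 'rV[R]_r) (f : M -> R) x : sec Z -> dsec a -> dsec a' ->
  dsec b -> smooth_fun f ->
  Q Z (fun y => a y - f y *: a' y) b x = Q Z a b x - f x * Q Z a' b x.
Proof.
move=> sZ sa sa' sb sf; have mZ := multi_dphi hLs sX0 sZ.
rewrite (_ : (fun y => a y - f y *: a' y) = fun y => (- f y) *: a' y + a y); last first.
  by apply/funext => y; rewrite scaleNr addrC.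
have sNf : smooth_fun (fun y => - f y) by move=> y; exact: smooth_atN.
rewrite -!dphi_form1E; have /funeqP/(_ x) := form2_tensoriall mZ sb sa' sa sNf.
by move=> ->; rewrite mulNr addrC.
Qed.

Lemma d2X0_anti (Z a b : M -> 'rV[R]_r) x : sec Z -> dsec a -> dsec b ->
  Q Z a b x = - Q Z b a x.
Proof.
move=> sZ sa sb; have mZ := multi_dphi hLs sX0 sZ.
by rewrite -!dphi_form1E (form2_anti mZ sa sb).
Qed.

Lemma hat_form1_fstE Y a b : tsec Y -> dsec a -> dsec b ->
  dform hat (form1 Y) [:: (fun q : MR => a q.1); (fun q : MR => b q.1)] =
  fun q => expR (- q.2) * K Y a b q.
Proof.
move=> sY sa sb; apply/funext => q.
by rewrite (hat_form1E q sY (section_fst sa) (section_fst sb)).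
Qed.

Variable St : nat -> nat -> altform MR r -> altform MR r -> altform MR r.
Hypothesis hSt : is_schouten MA bar St.

(** The bar Lie derivatives [La] and [Lb] split into the slicewise ones and multiples of [phi0]. The
    multiples produce the values of [d_{*X0} Y] on [phi0], and drop out when paired with [X0]
    because [phi0(X0) = 0]. The negative terms under the factor [phi0(X)] come from differentiating
    [e^-t]. *)
Lemma St_valueE X Y a b La Lb x t : tsec X -> tsec Y -> dsec a -> dsec b ->
  lie_derivative_of MA bar X (fun q : MR => a q.1) La ->
  lie_derivative_of MA bar X (fun q : MR => b q.1) Lb ->
  let la y := La (y, t) - dotp (a y) (tderiv X (y, t)) *: phi0 y in
  let lb y := Lb (y, t) - dotp (b y) (tderiv X (y, t)) *: phi0 y in
  St 1 2 (form1 X) (dform hat (form1 Y)) [:: (fun q : MR => a q.1); (fun q : MR => b q.1)] (x, t) =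
  expR (- t) * (vderiv (sanchor L (tslice t X)) (Q (tslice t Y) a b) x
    - Q (tslice t Y) la b x - Q (tslice t Y) a lb x
    - dotp (a x) (tderiv X (x, t)) * Q (tslice t Y) phi0 b x
    + dotp (b x) (tderiv X (x, t)) * Q (tslice t Y) phi0 a x
    + dotp (X0 x) (a x) * (dotp (b x) (tbracket L X (tderiv Y) (x, t)) -
        dotp (b x) (tderiv X (x, t)) * dotp (phi0 x) (tderiv Y (x, t)))
    - dotp (X0 x) (b x) * (dotp (a x) (tbracket L X (tderiv Y) (x, t)) -
        dotp (a x) (tderiv X (x, t)) * dotp (phi0 x) (tderiv Y (x, t)))
    + dotp (a x) (bracket L (tslice t X) X0 x) * dotp (b x) (tderiv Y (x, t))
    - dotp (b x) (bracket L (tslice t X) X0 x) * dotp (a x) (tderiv Y (x, t))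
    + tpair phi0 X (x, t) * (Q (tslice t (tderiv Y)) a b x
       + dotp (X0 x) (a x) * dotp (b x) (tderiv (tderiv Y) (x, t))
       - dotp (X0 x) (b x) * dotp (a x) (tderiv (tderiv Y) (x, t))
       - Q (tslice t Y) a b x
       - dotp (X0 x) (a x) * dotp (b x) (tderiv Y (x, t))
       + dotp (X0 x) (b x) * dotp (a x) (tderiv Y (x, t)))).
Proof.
move=> sX sY sa sb lLa lLb la lb; have sX' := tderiv_section sX.
have lla : lie_derivative_of A L (tslice t X) a la by exact: bar_lie_derivative.
have llb : lie_derivative_of A L (tslice t X) b lb by exact: bar_lie_derivative.
have [sLa LaE] := lLa; have [sLb LbE] := lLb.
have [sla _] := lla; have [slb _] := llb.
have saf := section_fst sa; have sbf := section_fst sb.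
have mY : multisection MA 2 (dform hat (form1 Y)).
  by apply: (dform_form1_is_form hat_dual_lie_algebroid); apply/smooth_section_dual2.
rewrite (schouten_sec2 hSt (x, t) sX saf sbf sLa sLb LaE LbE mY).
rewrite (hat_form1_fstE sY sa sb) (bar_vderiv_expRN X (x, t) (K_smooth sY sa sb)).
rewrite (trho_K x sX sY sa sb lla llb) (dt_K (x, t) sY sa sb).
rewrite (hat_form1E (x, t) sY sLa sbf) (hat_form1E (x, t) sY saf sLb).
have sLat : dsec (tslice t La) by exact: (@section_slice _ _ _ _ (dual_bundle A) La t).
have sLbt : dsec (tslice t Lb) by exact: (@section_slice _ _ _ _ (dual_bundle A) Lb t).
have sYt := section_slice t sY; have sXt' := section_slice t sX'.
have ga : smooth_fun (fun y => dotp (a y) (tderiv X (y, t))) by exact: (smooth_dotp sa sXt').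
have gb : smooth_fun (fun y => dotp (b y) (tderiv X (y, t))) by exact: (smooth_dotp sb sXt').
have Qa := d2X0_linl x sYt sLat sphi sb ga.
have Qb := d2X0_linl x sYt sLbt sphi sa gb.
have {}Qa : Q (tslice t Y) (tslice t La) b x =
    Q (tslice t Y) la b x + dotp (a x) (tderiv X (x, t)) * Q (tslice t Y) phi0 b x.
  by rewrite [Q _ la _ _]Qa subrK.
have {}Qb : Q (tslice t Y) a (tslice t Lb) x =
    Q (tslice t Y) a lb x - dotp (b x) (tderiv X (x, t)) * Q (tslice t Y) phi0 a x.
  rewrite (d2X0_anti _ sYt sa sLbt) (d2X0_anti _ sYt sa slb) [Q _ lb _ _]Qb.
  by rewrite opprB addrAC subrr add0r.
rewrite -[tslice (x, t).2 (fun q => b q.1)]/b -[tslice (x, t).2 (fun q => a q.1)]/a.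
rewrite -[(x, t).2]/t -[(x, t).1]/x Qa Qb.
have laE : La (x, t) = la x + dotp (a x) (tderiv X (x, t)) *: phi0 x by rewrite subrK.
have lbE : Lb (x, t) = lb x + dotp (b x) (tderiv X (x, t)) *: phi0 x by rewrite subrK.
have e1 : dotp (X0 x) (La (x, t)) = dotp (la x) (X0 x).
  by rewrite laE dotpDr dotpZr !(dotpC (X0 x)) phX0 mulr0 addr0.
have e2 : dotp (X0 x) (Lb (x, t)) = dotp (lb x) (X0 x).
  by rewrite lbE dotpDr dotpZr !(dotpC (X0 x)) phX0 mulr0 addr0.
have e3 : dotp (La (x, t)) (tderiv Y (x, t)) = dotp (la x) (tderiv Y (x, t)) +
    dotp (a x) (tderiv X (x, t)) * dotp (phi0 x) (tderiv Y (x, t)).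
  by rewrite laE dotpDl dotpZl.
have e4 : dotp (Lb (x, t)) (tderiv Y (x, t)) = dotp (lb x) (tderiv Y (x, t)) +
    dotp (b x) (tderiv X (x, t)) * dotp (phi0 x) (tderiv Y (x, t)).
  by rewrite lbE dotpDl dotpZl.
rewrite e1 e2 e3 e4 /K {e1 e2 e3 e4}.
rewrite -[(x, t).2]/t -[(x, t).1]/x.
move: (vderiv _ _ _) (tpair phi0 X (x, t)) (expR (- t)) => d w e.
move: (Q (tslice t Y) la b x) (Q (tslice t Y) a lb x) (Q (tslice t Y) phi0 b x)
  (Q (tslice t Y) phi0 a x) (Q (tslice t Y) a b x) (Q (tslice t (tderiv Y)) a b x) => *.
move: (dotp (a x) (tbracket L X (tderiv Y) (x, t))) (dotp (b x) (tbracket L X (tderiv Y) (x, t)))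
  (dotp (a x) (bracket L (tslice t X) X0 x)) (dotp (b x) (bracket L (tslice t X) X0 x)) => *.
move: (dotp (a x) (tderiv X (x, t))) (dotp (b x) (tderiv X (x, t)))
  (dotp (a x) (tderiv Y (x, t))) (dotp (b x) (tderiv Y (x, t)))
  (dotp (a x) (tderiv (tderiv Y) (x, t))) (dotp (b x) (tderiv (tderiv Y) (x, t)))
  (dotp (X0 x) (a x)) (dotp (X0 x) (b x)) (dotp (phi0 x) (tderiv Y (x, t)))
  (dotp (la x) (tderiv Y (x, t))) (dotp (lb x) (tderiv Y (x, t)))
  (dotp (la x) (X0 x)) (dotp (lb x) (X0 x)) => *.
ring.
Qed.

End time_bialgebroid.

(** * The compatibility condition on the product *)

Section time_compatibility.
Context {R : realType} {n : nat} {M : manifold R n} {r : nat}.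
Variables (A : vbundle M r) (L Ls : algebroid M r) (phi0 X0 : M -> 'rV[R]_r).
Let MR := time_manifold M.
Local Notation MA := (time_bundle A).
Local Notation sec := (smooth_section A).
Local Notation dsec := (smooth_section (dual_bundle A)).
Local Notation tsec := (smooth_section MA).
Local Notation bar := (bar_algebroid L phi0).
Local Notation hat := (hat_algebroid Ls X0).
Local Notation Q := (d2X0 Ls X0).
Hypothesis hL : is_lie_algebroid A L.
Hypothesis hLs : is_lie_algebroid (dual_bundle A) Ls.
Hypothesis sphi : dsec phi0.
Hypothesis cphi : eq_form A (dform L (form1 phi0)) 0.
Hypothesis sX0 : sec X0.
Hypothesis cX0 : eq_form (dual_bundle A) (dform Ls (form1 X0)) 0.
Hypothesis phX0 : forall x, dotp (phi0 x) (X0 x) = 0.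
Implicit Types (X Y : MR -> 'rV[R]_r) (a b c : M -> 'rV[R]_r) (p q : MR) (x : M) (t : R).

Lemma d2X0_D (Z W : M -> 'rV[R]_r) a b x : sec Z -> sec W -> dsec a -> dsec b ->
  Q (fun y => Z y + W y) a b x = Q Z a b x + Q W a b x.
Proof.
move=> /smooth_section_dual2 sZ /smooth_section_dual2 sW sa sb.
rewrite /d2X0 (dform1D Ls x sZ sW sa sb) !(dotpDl (Z x)).
by move: (dform1 _ _ _ _ _) (dform1 _ _ _ _ _) => *; ring.
Qed.

Lemma d2X0_Z (f : M -> R) (Z : M -> 'rV[R]_r) a b x : smooth_fun f -> sec Z ->
  dsec a -> dsec b ->
  Q (fun y => f y *: Z y) a b x = f x * Q Z a b x +
    vderiv (sanchor Ls a) f x * dotp (Z x) (b x) - vderiv (sanchor Ls b) f x * dotp (Z x) (a x).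
Proof.
move=> sf /smooth_section_dual2 sZ sa sb.
rewrite /d2X0 (dform1Z Ls x sf sZ sa sb) !(dotpZl _ (Z x)).
by move: (dform1 _ _ _ _ _) (vderiv _ _ _) (vderiv _ _ _) => *; ring.
Qed.

Lemma d2X0_N (Z : M -> 'rV[R]_r) a b x : sec Z -> dsec a -> dsec b ->
  Q (fun y => - Z y) a b x = - Q Z a b x.
Proof.
move=> sZ sa sb; rewrite (_ : (fun y => - Z y) = fun y => cst (-1) y *: Z y); last first.
  by apply/funext => y; rewrite scaleN1r.
rewrite (d2X0_Z x (smooth_fun_cst (-1)) sZ sa sb) -![vderiv _ (cst _) _]/(pderiv _ _ _) !pderiv_cst.
by rewrite !mul0r subr0 addr0 mulN1r.
Qed.

(** The coefficients [phi0(X)] and [phi0(Y)] of the bar bracket are functions, so [d_*] leaves their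
    derivatives along the anchors of [a] and [b]. The same derivatives appear in [lie_sliceE],
    through which they will cancel. *)
Lemma d2X0_bar X Y a b x t : tsec X -> tsec Y -> dsec a -> dsec b ->
  let f := fun y => dotp (phi0 y) (X (y, t)) in
  let g := fun y => dotp (phi0 y) (Y (y, t)) in
  Q (tslice t (bracket bar X Y)) a b x = Q (bracket L (tslice t X) (tslice t Y)) a b x +
   (f x * Q (tslice t (tderiv Y)) a b x +
      vderiv (sanchor Ls a) f x * dotp (b x) (tderiv Y (x, t)) -
      vderiv (sanchor Ls b) f x * dotp (a x) (tderiv Y (x, t))) -
   (g x * Q (tslice t (tderiv X)) a b x +
      vderiv (sanchor Ls a) g x * dotp (b x) (tderiv X (x, t)) -
      vderiv (sanchor Ls b) g x * dotp (a x) (tderiv X (x, t))).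
Proof.
move=> sX sY sa sb f g.
have sXt := section_slice t sX; have sYt := section_slice t sY.
have sX' := section_slice t (tderiv_section sX); have sY' := section_slice t (tderiv_section sY).
have sf : smooth_fun f := smooth_dotp sphi sXt.
have sg : smooth_fun g := smooth_dotp sphi sYt.
have sXY : sec (bracket L (tslice t X) (tslice t Y)) by exact: (la_closed hL).
have s1 := smooth_sectionZ sf sY'; have s2 := smooth_sectionZ sg sX'.
rewrite (_ : tslice t (bracket bar X Y) = fun y => (bracket L (tslice t X) (tslice t Y) y +
  f y *: tslice t (tderiv Y) y) + - (g y *: tslice t (tderiv X) y)); last by [].
rewrite (d2X0_D x (smooth_sectionD sXY s1) (smooth_sectionN s2) sa sb).
rewrite (d2X0_D x sXY s1 sa sb) (d2X0_N x s2 sa sb) (d2X0_Z x sf sY' sa sb) (d2X0_Z x sg sX' sa sb).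
by rewrite !(dotpC (tslice t _ x)).
Qed.

Variable S : nat -> nat -> altform M r -> altform M r -> altform M r.
Hypothesis hS : is_schouten A L S.
Hypothesis compat : forall X Y : M -> 'rV[R]_r, sec X -> sec Y ->
    eq_multisection A (dphi Ls X0 (form1 (bracket L X Y)))
      (schouten_phi S phi0 1 2 (form1 X) (dphi Ls X0 (form1 Y)) -
       schouten_phi S phi0 1 2 (form1 Y) (dphi Ls X0 (form1 X))).
Hypothesis lie : forall P, multisection A 1 P ->
    eq_multisection A (lie_phi Ls X0 phi0 P + schouten_phi S phi0 1 1 (form1 X0) P) 0.

(** The condition on Lie derivatives, solved for [d_{*X0} X] on [(phi0, c)] in order to eliminate
    such values from [St_valueE]. *)
Lemma lie_sliceE X c x t : tsec X -> dsec c ->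
  Q (tslice t X) phi0 c x = dotp (c x) (bracket L (tslice t X) X0 x) -
    vderiv (sanchor Ls c) (fun y => dotp (phi0 y) (X (y, t))) x -
    dotp (X0 x) (c x) * tpair phi0 X (x, t).
Proof.
move=> sX sc; have sXt := section_slice t sX.
have := lieE sX0 hS lie x sXt sc.
rewrite (bracketC hL x sX0 sXt) dotpNl (dotpC (bracket _ _ _ _)) (dotpC (tslice t X x)).
rewrite (_ : (fun z => dotp (tslice t X z) (phi0 z)) = fun y => dotp (phi0 y) (X (y, t))); last first.
  by apply/funext => y; rewrite dotpC.
rewrite -[dotp (phi0 x) (tslice t X x)]/(tpair phi0 X (x, t)).
move: (Q _ _ _ _) (vderiv _ _ _) (dotp _ _) (tpair _ _ _) (dotp _ _) => q v d w u h.
by rewrite -[LHS]subr0 -[in LHS]h; ring.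
Qed.

(** Stated for arbitrary vectors so that the pairing distributes without touching the sums hidden
    inside the brackets. *)
Lemma dotp_lincomb (c u1 u2 u3 u4 u5 u6 : 'rV[R]_r) (k3 k4 k5 k6 : R) :
  dotp c (- u1 + u2 + (k3 *: u3 + k4 *: u4) - (k5 *: u5 + k6 *: u6)) =
  - dotp c u1 + dotp c u2 + (k3 * dotp c u3 + k4 * dotp c u4) - (k5 * dotp c u5 + k6 * dotp c u6).
Proof. by rewrite dotpBr !dotpDr dotpNr !dotpZr. Qed.

Lemma dotp_tderiv_bar X Y c x t : tsec X -> tsec Y ->
  dotp (c x) (tderiv (bracket bar X Y) (x, t)) =
  - dotp (c x) (tbracket L Y (tderiv X) (x, t)) + dotp (c x) (tbracket L X (tderiv Y) (x, t)) +
  (tpair phi0 (tderiv X) (x, t) * dotp (c x) (tderiv Y (x, t)) +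
   tpair phi0 X (x, t) * dotp (c x) (tderiv (tderiv Y) (x, t))) -
  (tpair phi0 (tderiv Y) (x, t) * dotp (c x) (tderiv X (x, t)) +
   tpair phi0 Y (x, t) * dotp (c x) (tderiv (tderiv X) (x, t))).
Proof.
move=> sX sY; rewrite (tderiv_bar hL sphi (x, t) sX sY).
rewrite (tbracketC hL (x, t) (tderiv_section sX) sY).
exact: dotp_lincomb.
Qed.

Lemma hat_form1_barE X Y a b x t : tsec X -> tsec Y -> dsec a -> dsec b ->
  let X' := tderiv X (x, t) in let Y' := tderiv Y (x, t) in
  let fX := tpair phi0 X (x, t) in let fY := tpair phi0 Y (x, t) in
  let pair c := - dotp (c x) (tbracket L Y (tderiv X) (x, t)) +
    dotp (c x) (tbracket L X (tderiv Y) (x, t)) +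
    (tpair phi0 (tderiv X) (x, t) * dotp (c x) Y' + fX * dotp (c x) (tderiv (tderiv Y) (x, t))) -
    (tpair phi0 (tderiv Y) (x, t) * dotp (c x) X' + fY * dotp (c x) (tderiv (tderiv X) (x, t))) in
  dform hat (form1 (bracket bar X Y)) [:: (fun q : MR => a q.1); (fun q : MR => b q.1)] (x, t) =
  expR (- t) * (Q (bracket L (tslice t X) (tslice t Y)) a b x +
   (fX * Q (tslice t (tderiv Y)) a b x +
      vderiv (sanchor Ls a) (fun y => dotp (phi0 y) (X (y, t))) x * dotp (b x) Y' -
      vderiv (sanchor Ls b) (fun y => dotp (phi0 y) (X (y, t))) x * dotp (a x) Y') -
   (fY * Q (tslice t (tderiv X)) a b x +
      vderiv (sanchor Ls a) (fun y => dotp (phi0 y) (Y (y, t))) x * dotp (b x) X' -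
      vderiv (sanchor Ls b) (fun y => dotp (phi0 y) (Y (y, t))) x * dotp (a x) X') +
   (dotp (X0 x) (a x) * pair b - dotp (X0 x) (b x) * pair a)).
Proof.
move=> sX sY sa sb X' Y' fX fY pair.
have sXY : tsec (bracket bar X Y).
  exact: (la_closed (bar_is_lie_algebroid hL sphi cphi)).
apply: etrans (hat_form1E Ls X0 (x, t) sXY (section_fst sa) (section_fst sb)) _.
congr (_ * (_ + (_ * _ - _ * _))).
- exact: d2X0_bar.
- exact: dotp_tderiv_bar.
- exact: dotp_tderiv_bar.
Qed.

Lemma time_compat St : is_schouten MA bar St -> forall X Y, tsec X -> tsec Y ->
  eq_multisection MA (dform hat (form1 (bracket bar X Y)))
    (St 1 2 (form1 X) (dform hat (form1 Y)) - St 1 2 (form1 Y) (dform hat (form1 X))).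
Proof.
move=> hSt X Y sX sY.
have hhat := hat_dual_lie_algebroid hLs sX0 cX0.
have hbar := bar_is_lie_algebroid hL sphi cphi.
have multi_d Z : tsec Z -> multisection MA 2 (dform hat (form1 Z)).
  by move=> sZ; apply: (dform_form1_is_form hhat); apply/smooth_section_dual2.
have sXY : tsec (bracket bar X Y) by exact: (la_closed hbar).
have mL := multi_d _ sXY.
have mR : multisection MA 2 (St 1 2 (form1 X) (dform hat (form1 Y)) - St 1 2 (form1 Y) (dform hat (form1 X))).
  apply: is_formD; first exact: (sch_closed hSt (multi_form1 sX) (multi_d _ sY)).
  by apply: is_formN; exact: (sch_closed hSt (multi_form1 sY) (multi_d _ sX)).
(* Both sides are bivectors, so they are compared on two covector fields at one point [(x, t)].
   There each field may be replaced by its own slice at time [t], extended independently of time. *)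
apply: (form2_ext mL mR) => at' bt sat sbt; apply/funext => -[x t].
have sa : dsec (tslice t at') by exact: (@section_slice _ _ _ _ (dual_bundle A) at' t).
have sb : dsec (tslice t bt) by exact: (@section_slice _ _ _ _ (dual_bundle A) bt t).
have saf := section_fst sa; have sbf := section_fst sb.
rewrite (form2_point mL sat sbt saf sbf (p := (x, t)) erefl erefl).
rewrite (form2_point mR sat sbt saf sbf (p := (x, t)) erefl erefl) {mL mR sat sbt}.
move: (tslice t at') (tslice t bt) sa sb saf sbf => a b sa sb saf sbf.
have [La [sLa LaE]] := lie_derivative_exists hbar sX saf.
have [Lb [sLb LbE]] := lie_derivative_exists hbar sX sbf.
have [Ma [sMa MaE]] := lie_derivative_exists hbar sY saf.
have [Mb [sMb MbE]] := lie_derivative_exists hbar sY sbf.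
have lLa : lie_derivative_of MA bar X (fun q : MR => a q.1) La by split.
have lLb : lie_derivative_of MA bar X (fun q : MR => b q.1) Lb by split.
have lMa : lie_derivative_of MA bar Y (fun q : MR => a q.1) Ma by split.
have lMb : lie_derivative_of MA bar Y (fun q : MR => b q.1) Mb by split.
rewrite -[RHS]/(St 1 2 (form1 X) (dform hat (form1 Y)) [:: (fun q : MR => a q.1); (fun q : MR => b q.1)] (x, t) -
  St 1 2 (form1 Y) (dform hat (form1 X)) [:: (fun q : MR => a q.1); (fun q : MR => b q.1)] (x, t)).
rewrite (St_valueE hLs sphi sX0 cX0 phX0 hSt x t sX sY sa sb lLa lLb).
rewrite (St_valueE hLs sphi sX0 cX0 phX0 hSt x t sY sX sa sb lMa lMb).
rewrite (hat_form1_barE x t sX sY sa sb).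
have sXt := section_slice t sX; have sYt := section_slice t sY.
have laX := bar_lie_derivative sphi t sX sa lLa.
have lbX := bar_lie_derivative sphi t sX sb lLb.
have laY := bar_lie_derivative sphi t sY sa lMa.
have lbY := bar_lie_derivative sphi t sY sb lMb.
(* The compatibility of the slices removes the value on [[X_t, Y_t]], and the condition on Lie
   derivatives removes the values on [phi0]. What is left is a polynomial identity in the remaining
   quantities. *)
rewrite (compatE hLs sX0 hS compat x sXt sYt sa sb laX lbX laY lbY).
rewrite (lie_sliceE x t sX sa) (lie_sliceE x t sX sb) (lie_sliceE x t sY sa) (lie_sliceE x t sY sb).
have eX : dotp (tslice t X x) (phi0 x) = tpair phi0 X (x, t) by exact: dotpC.
have eY : dotp (tslice t Y x) (phi0 x) = tpair phi0 Y (x, t) by exact: dotpC.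
rewrite eX eY {eX eY}.
have eX' : dotp (phi0 x) (tderiv X (x, t)) = tpair phi0 (tderiv X) (x, t) by [].
have eY' : dotp (phi0 x) (tderiv Y (x, t)) = tpair phi0 (tderiv Y) (x, t) by [].
rewrite eX' eY' {eX' eY'}.
move: (tpair phi0 X (x, t)) (tpair phi0 Y (x, t)) (tpair phi0 (tderiv X) (x, t))
  (tpair phi0 (tderiv Y) (x, t)) (expR (- t)) => *.
move: (Q (tslice t X) a b x) (Q (tslice t Y) a b x)
  (Q (tslice t (tderiv X)) a b x) (Q (tslice t (tderiv Y)) a b x) => *.
move: (vderiv (sanchor L (tslice t X)) _ _) (vderiv (sanchor L (tslice t Y)) _ _) => *.
move: (vderiv (sanchor Ls a) (fun y => dotp (phi0 y) (X (y, t))) x)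
  (vderiv (sanchor Ls b) (fun y => dotp (phi0 y) (X (y, t))) x)
  (vderiv (sanchor Ls a) (fun y => dotp (phi0 y) (Y (y, t))) x)
  (vderiv (sanchor Ls b) (fun y => dotp (phi0 y) (Y (y, t))) x) => *.
move: (Q _ _ _ _) (Q _ _ _ _) (Q _ _ _ _) (Q _ _ _ _) => *.
move: (dotp (X0 x) (a x)) (dotp (X0 x) (b x)) => *.
move: (tderiv (tderiv X) (x, t)) (tderiv (tderiv Y) (x, t)) => *.
move: (tbracket L X (tderiv Y) (x, t)) (tbracket L Y (tderiv X) (x, t)) => *.
move: (bracket L (tslice t X) X0 x) (bracket L (tslice t Y) X0 x) => *.
move: (tderiv X (x, t)) (tderiv Y (x, t)) => *.
ring.
Qed.

End time_compatibility.

(** * The induced Poisson structure *)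

Section exact_forms.
Context {R : realType} {n : nat} {M : manifold R n}.
Implicit Types (f g : M -> R) (x : M).

(** The coefficients of [dfun L f] are the derivatives along the anchors of the basis vectors;
    linearity of the anchor extends this to every [v]. *)
Lemma dfun_dotp (r : nat) (L : algebroid M r) f x v : linear (anchor L x) ->
  smooth_at f x -> dotp (dfun L f x) v = pderiv x (anchor L x v) f.
Proof.
move=> lin sf; pose F := HB.pack_for {linear 'rV[R]_r -> 'rV[R]_n} (anchor L x)
  (GRing.isLinear.Build _ _ _ _ (anchor L x) lin).
rewrite [v in RHS]matrix_sum_delta big_ord1 -[anchor L x _]/(F _) linear_sum pderiv_sumv//.
rewrite dotpE; apply: eq_bigr => i _.
by rewrite linearZ pderivZv// mxE mulrC.
Qed.

Local Notation df := (dfun (tangent_algebroid M)).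

Lemma df_dotp f x v : smooth_at f x -> dotp (df f x) v = pderiv x v f.
Proof. by move=> sf; rewrite dfun_dotp. Qed.

Lemma smooth_df f : smooth_fun f -> smooth_section (dual_bundle (tangent_bundle M)) (df f).
Proof.
move=> sf; apply: smooth_section_pairing => Z sZ x.
apply: (@smooth_at_ext _ _ _ _ (vderiv Z f)).
  by near=> y; rewrite df_dotp.
apply: (@smooth_at_vderiv _ _ _ _ _ x) => //; first exact: mdom_mem.
by apply: sZ; exact: mdom_mem.
Unshelve. all: by end_near.
Qed.

(** The combination of the chart coordinates with coefficients [v], extended to a global function,
    has differential [v] at [x]. *)
Lemma df_through x (v : 'rV[R]_n) : exists f, smooth_fun f /\ df f x = v.
Proof.
have sc : smooth_at (fun y => \sum_j v 0 j * mchart x y 0 j) x.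
  apply: smooth_at_sum => j _; apply: smooth_atM; first exact: smooth_at_cst.
  exact: smooth_at_coord.
have [f [sf fE]] := smooth_extension sc.
exists f; split => //; apply/rowP => i.
rewrite -(dotp_delta _ i) df_dotp// (pderiv_ext _ fE) pderiv_sum; last first.
  move=> j; apply: smooth_atM; [exact: smooth_at_cst|exact: smooth_at_coord].
rewrite -[RHS]dotp_delta dotpE; apply: eq_bigr => j _.
rewrite (pderivM _ (smooth_at_cst (v 0 j) x) (smooth_at_coord x j)) pderiv_coord.
by rewrite pderiv_cst mul0r addr0.
Qed.

End exact_forms.

Lemma dotp_row_mx (R : realType) (m k : nat) (a c : 'rV[R]_m) (b d : 'rV[R]_k) :
  dotp (row_mx a b) (row_mx c d) = dotp a c + dotp b d.
Proof. by rewrite /dotp tr_row_mx mul_row_col mxE. Qed.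

Lemma dotp_lsubmx (R : realType) (m k : nat) (u : 'rV[R]_(m + k)) (v : 'rV[R]_m) :
  dotp (lsubmx u) v = dotp u (row_mx v 0).
Proof. by rewrite -[u in RHS]hsubmxK dotp_row_mx dotp0r addr0. Qed.

(** * Consequences of the formula defining the induced Jacobi structure *)

Section induced_jacobi.
Context {R : realType} {n : nat} {M : manifold R n} {r : nat}.
Variables (L Ls : algebroid M r) (phi0 X0 : M -> 'rV[R]_r).
Variables (Lam : altform M n) (E : M -> 'rV[R]_n).
Hypothesis jac : is_induced_jacobi L Ls phi0 X0 Lam E.
Implicit Types (f g : M -> R) (x : M).
Local Notation df := (dfun (tangent_algebroid M)).

Lemma dfun_cst (L' : algebroid M r) (c : R) x : dfun L' (cst c) x = 0.
Proof. by apply/rowP => i; rewrite !mxE; exact: pderiv_cst. Qed.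

Lemma df_cst (c : R) : df (cst c) = fun=> 0.
Proof. by apply/funext => x; apply/rowP => i; rewrite !mxE; exact: pderiv_cst. Qed.

Let mLam : is_form (dual_bundle (tangent_bundle M)) 2 Lam.
Proof. by case: jac => -[]. Qed.

Let Lam0l f x : smooth_fun f -> Lam [:: (fun=> 0); df f] x = 0.
Proof.
by move=> sf; rewrite (tensorial0 (form2_tensoriall mLam (smooth_df sf))).
Qed.

Let Lam0r f x : smooth_fun f -> Lam [:: df f; (fun=> 0)] x = 0.
Proof.
by move=> sf; rewrite (tensorial0 (form2_tensorialr mLam (smooth_df sf))).
Qed.

Let s1 : smooth_fun (cst 1 : M -> R) := smooth_fun_cst 1.

Let vderiv_cst V (c : R) x : vderiv V (cst c : M -> R) x = 0.
Proof. exact: pderiv_cst. Qed.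

(** At [f = g = 1] all derivatives vanish and the defining formula reduces to [0 = - phi0(X0)]. *)
Lemma induced_pairing0 x : dotp (phi0 x) (X0 x) = 0.
Proof.
have := jac.2 _ _ s1 s1 x; rewrite !df_cst vderiv_cst !dfun_cst !scale1r !add0r mulr0 subr0 addr0.
have := Lam0l x s1; rewrite df_cst => -> /esym/eqP.
by rewrite oppr_eq0 => /eqP.
Qed.

Lemma induced_Er f x : smooth_fun f -> vderiv E f x = - dotp (phi0 x) (dfun Ls f x).
Proof.
move=> sf; have := jac.2 _ _ s1 sf x.
rewrite df_cst vderiv_cst dfun_cst Lam0l// !scale1r !add0r mul1r mulr0 subr0.
by rewrite dotpDr dotpZr induced_pairing0 mulr0 addr0.
Qed.

Lemma induced_El f x : smooth_fun f -> vderiv E f x = dotp (dfun L f x) (X0 x).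
Proof.
move=> sf; have := jac.2 _ _ sf s1 x.
rewrite df_cst vderiv_cst dfun_cst Lam0r// !scale1r !add0r mul1r mulr0 add0r.
by rewrite dotpDl dotpZl induced_pairing0 mulr0 addr0 => /oppr_inj.
Qed.

(** On expanding the right-hand side, the terms with one undifferentiated factor are those accounted
    for by [E], and the term [f g phi0(X0)] vanishes. *)
Lemma induced_Lam f g x : smooth_fun f -> smooth_fun g ->
  Lam [:: df f; df g] x = - dotp (dfun L f x) (dfun Ls g x).
Proof.
move=> sf sg; have := jac.2 _ _ sf sg x.
rewrite (induced_Er x sg) (induced_El x sf) !dotpDl !dotpDr !dotpZl !dotpZr induced_pairing0.
move: (Lam _ _) (dotp _ _) (dotp _ _) (dotp _ _) (f x) (g x) => l a b c u v h.
lra.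
Qed.

End induced_jacobi.

(** * Comparison with the Poissonization *)

Section poissonization.
Context {R : realType} {n : nat} {M : manifold R n} {r : nat}.
Variables (A : vbundle M r) (L Ls : algebroid M r) (phi0 X0 : M -> 'rV[R]_r).
Variables (Lam : altform M n) (E : M -> 'rV[R]_n).
Let MR := time_manifold M.
Local Notation bar := (bar_algebroid L phi0).
Local Notation hat := (hat_algebroid Ls X0).
Local Notation df := (dfun (tangent_algebroid M)).
Local Notation tdf := (dfun (tangent_algebroid MR)).
Local Notation cosec := (smooth_section (dual_bundle (tangent_bundle M))).
Local Notation tcosec := (smooth_section (dual_bundle (tangent_bundle MR))).
Hypothesis jac : is_induced_jacobi L Ls phi0 X0 Lam E.
Implicit Types (f g : MR -> R) (x : M) (t : R).

Lemma dfun_bar f x t : smooth_fun f ->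
  dfun bar f (x, t) = dfun L (slice t f) x + dt f (x, t) *: phi0 x.
Proof.
move=> sf; apply/rowP => i; rewrite [LHS]mxE.
apply: etrans (pderiv_time _ _ (sf (x, t))) _.
rewrite dotp_delta [RHS]mxE; congr (_ + _); first by rewrite mxE.
by rewrite mxE; exact: mulrC.
Qed.

Lemma dfun_hat g x t : smooth_fun g ->
  dfun hat g (x, t) = expR (- t) *: (dfun Ls (slice t g) x + dt g (x, t) *: X0 x).
Proof.
move=> sg; apply/rowP => i; rewrite [LHS]mxE.
apply: etrans (pderivZv _ _ (sg (x, t))) _; rewrite [RHS]mxE; congr (_ * _).
apply: etrans (pderiv_time _ _ (sg (x, t))) _.
rewrite dotp_delta [RHS]mxE; congr (_ + _); first by rewrite mxE.
by rewrite mxE; exact: mulrC.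
Qed.

Lemma dfun_bar_hat f g x t : smooth_fun f -> smooth_fun g ->
  - dotp (dfun bar f (x, t)) (dfun hat g (x, t)) = expR (- t) *
  (Lam [:: df (slice t f); df (slice t g)] x +
   (dt f (x, t) * vderiv E (slice t g) x - dt g (x, t) * vderiv E (slice t f) x)).
Proof.
move=> sf sg; have sft := smooth_fun_slice t sf; have sgt := smooth_fun_slice t sg.
rewrite dfun_bar// dfun_hat// (induced_Lam jac x sft sgt) (induced_Er jac x sgt).
rewrite (induced_El jac x sft) dotpZr !dotpDl !dotpDr !dotpZl !dotpZr (induced_pairing0 jac).
move: (dotp _ _) (dotp _ _) (dotp _ _) (dt f _) (dt g _) (expR _) => *; ring.
Qed.

Lemma tdf_dotp f x t (v : 'rV[R]_n) (c : R) : smooth_fun f ->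
  dotp (tdf f (x, t)) (row_mx v c%:M) = pderiv x v (slice t f) + c * dt f (x, t).
Proof. by move=> sf; rewrite df_dotp; [exact: pderiv_time|exact: sf]. Qed.

Lemma scalar_mx0 : (0 : R)%:M = 0 :> 'rV[R]_1.
Proof. by rewrite raddf0. Qed.

Lemma lsubmx_tdf f x t : smooth_fun f -> lsubmx (tdf f (x, t)) = df (slice t f) x.
Proof.
move=> sf; apply/rowP => k; rewrite -!(dotp_delta _ k) dotp_lsubmx -scalar_mx0.
rewrite tdf_dotp// mul0r addr0 df_dotp//; exact: smooth_fun_slice.
Qed.

Lemma row_mx0_section (Z : M -> 'rV[R]_n) : smooth_section (tangent_bundle M) Z ->
  smooth_section (tangent_bundle MR) (fun q : MR => row_mx (Z q.1) 0).
Proof.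
move=> sZ p q pq.
apply: (@smooth_at_ext _ _ _ _ (fun z : MR =>
   row_mx (Z z.1 *m tangent_triv p.1 z.1) (0 : R)%:M)).
  near=> z; rewrite -scalar_mx0; apply/esym; apply: tangent_triv_time.
  by near: z; apply: nbhs_mdom.
apply: smooth_at_row_mx; first exact: (smooth_at_fst (sZ _ _ pq)).
apply/smooth_at_mxP => i j; exact: smooth_at_cst.
Unshelve. all: by end_near.
Qed.

(** Smoothness is tested by pairing with vector fields on [M], after lifting them to the product
    with zero [d/dt] component. *)
Lemma lsubmx_cosection (al : MR -> 'rV[R]_(n + 1)) t : tcosec al ->
  cosec (tslice t (fun q => lsubmx (al q))).
Proof.
move=> sal; apply: smooth_section_pairing => Z sZ.
have := smooth_fun_slice t (smooth_dotp sal (row_mx0_section sZ)).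
by rewrite /slice /tslice; under eq_fun do rewrite -dotp_lsubmx.
Qed.

Lemma poissonization2E (al be : MR -> 'rV[R]_(n + 1)) x t :
  poissonization Lam E [:: al; be] (x, t) = expR (- t) *
  (Lam [:: tslice t (fun q => lsubmx (al q)); tslice t (fun q => lsubmx (be q))] x +
   (dotp (al (x, t)) (row_mx 0 1%:M) * dotp (be (x, t)) (row_mx (E x) 0) -
    dotp (be (x, t)) (row_mx 0 1%:M) * dotp (al (x, t)) (row_mx (E x) 0))).
Proof.
rewrite /poissonization wedge11E /alt2 /lift_mvf.
by rewrite !(dotpC (ddt _)) !(dotpC (lift_vf E _)).
Qed.

Lemma induced_poisson_poissonization Lamt : is_induced_poisson bar hat Lamt ->
  eq_multisection (tangent_bundle MR) Lamt (poissonization Lam E).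
Proof.
move=> [[mLamt _ _] lamE].
have mLam : is_form (dual_bundle (tangent_bundle M)) 2 Lam by case: jac => -[].
move=> als sals; have [S2|S2] := eqVneq (size als) 2; last first.
  rewrite (form_degree mLamt S2); apply/funext => p.
  rewrite /poissonization wedge11E /lift_mvf (form_degree mLam) ?size_map//.
  rewrite -[LHS]/(0 : R) -[(0 : M -> R) p.1]/(0 : R) add0r.
  by case: als S2 {sals} => [|al [|be [|ga als]]] //= _; rewrite mulr0.
case: als S2 sals => [|al [|be [|]]] // _ /smooth_sections2[sal sbe].
apply/funext => -[x t]; set p : MR := (x, t).
(* At a single point every covector is a differential, so in [Lamt] both arguments may be exchanged
   for exact forms. The Poissonization needs only the values of its arguments at [p], together with
   the same property of [Lam] on [M]. *)
have [f [sf fE]] := df_through p (al p).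
have [g [sg gE]] := df_through p (be p).
rewrite (form2_point mLamt sal sbe (smooth_df sf) (smooth_df sg) (esym fE) (esym gE)).
have := lamE f g sf sg p.
have v0 (h : MR -> R) : vderiv (0 : MR -> 'rV[R]_(n + 1)) h p = 0 by exact: pderiv0v.
rewrite !v0 !mulr0 subr0 addr0 !scaler0 !addr0 => ->.
rewrite dfun_bar_hat// poissonization2E -fE -gE.
have sft := smooth_fun_slice t sf; have sgt := smooth_fun_slice t sg.
have E1 (h : MR -> R) : smooth_fun h -> dotp (tdf h p) (row_mx 0 1%:M) = dt h p.
  move=> sh; apply: etrans (tdf_dotp x t 0 1 sh) _.
  by rewrite pderiv0v add0r mul1r.
have E2 (h : MR -> R) : smooth_fun h ->
    dotp (tdf h p) (row_mx (E x) 0) = vderiv E (slice t h) x.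
  move=> sh; rewrite -scalar_mx0; apply: etrans (tdf_dotp x t (E x) 0 sh) _.
  by rewrite mul0r addr0.
rewrite !E1// !E2//; congr (_ * (_ + _)).
apply: (form2_point mLam).
- exact: smooth_df.
- exact: smooth_df.
- exact: lsubmx_cosection.
- exact: lsubmx_cosection.
- by rewrite /tslice -/p -fE lsubmx_tdf.
- by rewrite /tslice -/p -gE lsubmx_tdf.
Qed.

End poissonization.

Theorem theorem4p11 (R : realType) (n r : nat) (M : manifold R n)
  (A : vbundle M r) (L Ls : algebroid M r) (phi0 X0 : M -> 'rV[R]_r)
  (Lam : altform M n) (E : M -> 'rV[R]_n)
  (schouten_ex : exists S, is_schouten A L S)
  (bialg : is_generalized_lie_bialgebroid A L Ls phi0 X0)
  (jac : is_induced_jacobi L Ls phi0 X0 Lam E) :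
  is_lie_bialgebroid (time_bundle A)
    (bar_algebroid L phi0) (hat_algebroid Ls X0) /\
  (forall Lamt : altform (time_manifold M) (n + 1),
    is_induced_poisson (bar_algebroid L phi0) (hat_algebroid Ls X0) Lamt ->
    eq_multisection (tangent_bundle (time_manifold M))
      Lamt (poissonization Lam E)).
Proof.
split; last exact: induced_poisson_poissonization.
(* The conditions of the generalized bialgebroid hold for every Schouten bracket on [A]; this one
   gives access to them. *)
have [S hS] := schouten_ex.
case: bialg => hL hLs [sphi cphi] sX0 cX0 compat lie.
split.
- exact: bar_is_lie_algebroid.
- exact: hat_dual_lie_algebroid.
- move=> St hSt X Y sX sY.
  exact: (time_compat hL hLs sphi cphi sX0 cX0 (induced_pairing0 jac) hS (compat S hS)
    (fun P mP => lie S hS 1%N P mP) hSt sX sY).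
Qed.
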